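(* For integers $n\ge 0$ and $t\in(0,\infty)$ let $$R_n(t)=(-1)^n\Biggl[\ln\Gamma(t)-\biggl(t-\frac12\biggr)\ln t+t-\frac12\ln(2\pi)-\sum_{k=1}^n\frac{B_{2k}}{(2k)(2k-1)}\frac1{t^{2k-1}}\Biggr],$$ so that $$-R_n'(t)=(-1)^{n+1}\Biggl[\psi(t)-\ln t+\frac{1}{2t}+\sum_{k=1}^n\frac{B_{2k}}{2k}\frac1{t^{2k}}\Biggr],$$ where empty sums are $0$. Write $\deg_{\mathrm{cm}}^{t}[h(t)]$ for the completely monotonic degree of a completely monotonic function $h$ on $(0,\infty)$ with respect to $t\in(0,\infty)$. Then: (1) $\deg_{\mathrm{cm}}^{t}[R_0(t)]=0$ and $\deg_{\mathrm{cm}}^{t}[R_1(t)]=1$; (2) $\deg_{\mathrm{cm}}^{t}[-R_0'(t)]=1$ and $\deg_{\mathrm{cm}}^{t}[-R_1'(t)]=2$; (3) for every integer $n\ge 2$, $$2n-1\le \deg_{\mathrm{cm}}^{t}[-R_n'(t)]\le 2n.$$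
   Context: $\Gamma$ is the classical Euler gamma function, $\psi=\Gamma'/\Gamma$ is the digamma function, and the Bernoulli numbers $B_n$ are defined by $$\frac{z}{e^z-1}=\sum_{n=0}^\infty B_n\frac{z^n}{n!}=1-\frac z2+\sum_{k=1}^\infty B_{2k}\frac{z^{2k}}{(2k)!},\qquad |z|<2\pi.$$ A function $h$ on an interval $I$ is completely monotonic on $I$ if it has derivatives of all orders on $I$ and $(-1)^n h^{(n)}(t)\ge 0$ for all $t\in I$ and all integers $n\ge 0$. Completely monotonic degree: let $h$ be completely monotonic on $(0,\infty)$ and let $h(\infty)=\lim_{t\to\infty}h(t)\ge 0$. If $r\ge 0$ is a real number such that, for real $\alpha\ge 0$, the function $t^\alpha[h(t)-h(\infty)]$ is completely monotonic on $(0,\infty)$ if and only if $\alpha\le r$, then $h$ is said to be of completely monotonic degree $r$, written $\deg_{\mathrm{cm}}^{t}[h(t)]=r$. If $t^\alpha[h(t)-h(\infty)]$ is completely monotonic on $(0,\infty)$ for all $\alpha\in\mathbb R$, the degree is $\infty$. It is known from earlier work that, for every $n\ge 0$, $R_n$ is completely monotonic on $(0,\infty)$, and hence so is $-R_n'$; so the degrees above refer to completely monotonic functions. *)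

(* Defs.v *)
From mathcomp Require Import all_boot all_order all_algebra.
From mathcomp Require Import all_classical all_reals all_analysis.

Set Implicit Arguments.
Unset Strict Implicit.
Unset Printing Implicit Defensive.

Import Order.TTheory GRing.Theory Num.Theory.
Import numFieldNormedType.Exports.

Local Open Scope classical_set_scope.
Local Open Scope ring_scope.

(* Functions on (0, +oo) are represented by total functions R -> R; only their
   values at positive arguments are meaningful, and the definitions below only
   look at those. *)

Definition Gamma (R : realType) (t : R) : R :=
  Rintegral (@lebesgue_measure R) `]0, +oo[
    (fun u => u `^ (t - 1) * expR (- u)).

Definition digamma (R : realType) (t : R) : R :=
  derive1 (@Gamma R) t / Gamma t.

(* B is the sequence of Bernoulli numbers.  The generating function identity on
   the real points of the punctured disc determines B uniquely; the point z = 0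
   is excluded because z / (e^z - 1) is 0 / 0 there. *)
Definition is_bernoulli (R : realType) (B : nat -> R) : Prop :=
  forall z : R, z != 0 -> `|z| < 2 * pi ->
    series (fun n => B n * (z ^+ n / n`!%:R)) @ \oo --> z / (expR z - 1).

(* Completely monotonic on (0, +oo). *)
Definition completely_monotonic (R : realType) (h : R -> R) : Prop :=
  forall (n : nat) (t : R), 0 < t ->
    derivable (derive1n n h) t 1 /\ 0 <= (-1) ^+ n * derive1n n h t.

(* cm_degree h d : the completely monotonic degree of h is d, a nonnegative
   real number or +oo.  Here l is h(oo). *)
Definition cm_degree (R : realType) (h : R -> R) (d : \bar R) : Prop :=
  completely_monotonic h /\
  exists2 l : R, h t @[t --> +oo] --> l &
    match d with
    | r%:E => 0 <= r /\ forall a : R, 0 <= a ->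
        (completely_monotonic (fun t => t `^ a * (h t - l)) <-> a <= r)
    | +oo%E => forall a : R,
        completely_monotonic (fun t => t `^ a * (h t - l))
    | -oo%E => False
    end.

(* R_n; the argument B is meant to be the sequence of Bernoulli numbers. *)
Definition Rn (R : realType) (B : nat -> R) (n : nat) (t : R) : R :=
  (-1) ^+ n *
  (ln (Gamma t) - (t - 1 / 2) * ln t + t - 1 / 2 * ln (2 * pi)
   - \sum_(1 <= k < n.+1)
       B (2 * k)%N / ((2 * k)%:R * (2 * k - 1)%:R) * (1 / t ^+ (2 * k - 1))).

(* Main.v *)
(* By Binet's formula, R_0 is the Laplace transform of delta(u) / u, where
   delta(u) = 1 / (e^u - 1) - 1 / u + 1 / 2 = sum_m 2 u / (u^2 + c_m^2) and
   c_m = 2 pi (m + 1).  Subtracting the first n terms of the power series of delta,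
   -R_n' is the Laplace transform of
   f_n(u) = sum_m 2 u^(2n+1) / (c_m^(2n) (u^2 + c_m^2)) > 0.
   If f is O(u^n), its Laplace transform is O(t^-(n+1)) at 0+, whereas h completely
   monotonic of degree at least a forces h(t) >= h(1) t^-a on (0, 1): this bounds the
   degrees from above.  From below, t^p L f = L f^(p) when f and its derivatives of
   order < p vanish at 0+, so it suffices that f^(p) >= 0.  For f_n and p = 2n - 1 this
   holds for each summand separately.  For R_1, -R_0' and -R_1' one uses delta' >= 0 and
   delta'' <= 0, which is equivalent to Lazarevic's inequality
   cosh x <= (sinh x / x)^3. *)

Require Import Defs.
From mathcomp Require Import all_boot all_order all_algebra.
From mathcomp Require Import all_classical all_reals all_analysis.
From mathcomp Require Import measurable_realfun zify ring lra.

Import Order.TTheory GRing.Theory Num.Theory.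
Import numFieldNormedType.Exports.

Local Open Scope classical_set_scope.
Local Open Scope ring_scope.

Set Implicit Arguments.
Unset Strict Implicit.
Unset Printing Implicit Defensive.

Section DerivativeRules.
Context {R : realType}.
Implicit Types (f g : R -> R) (x a b c : R).

(** Gamma is given only by its integral, so Binet's formula has to be earned. Its right-hand side
    obeys the functional equation of ln Gamma; Wendel's inequality then makes the difference
    constant, and duplication together with Gamma(1/2) = sqrt pi fixes the constant. The partial
    fractions of delta come from repeatedly halving the argument of coth, with real parts written
    out. What decides the upper bounds is the growth of f_n at infinity, u^(2n-1) for n >= 1, and
    not its order 2n + 1 at 0. The kernel delta(u)/u of R_0 decays like 1/(2u), a case that
    comparison with monomials does not settle. The lower bound 2n - 1 is where the termwise argument
    stops: the derivative of order 2n of one summand of f_n is a multiple of Re (u + ic)^-(2n+1),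
    which changes sign for n >= 1. For n = 1 the missing order is regained only from the sum as a
    whole. A degree exists at all because the admissible exponents form a down-closed set that
    contains its supremum. *)

Lemma is_derive1D f g x a b : is_derive x 1 f a -> is_derive x 1 g b ->
  is_derive x 1 (fun y => f y + g y) (a + b).
Proof. by move=> *; exact: is_deriveD. Qed.

Lemma is_derive1N f x a : is_derive x 1 f a -> is_derive x 1 (fun y => - f y) (- a).
Proof. by move=> *; exact: is_deriveN. Qed.

Lemma is_derive1M f g x a b : is_derive x 1 f a -> is_derive x 1 g b ->
  is_derive x 1 (fun y => f y * g y) (a * g x + f x * b).
Proof.
move=> fa gb; apply: (is_derive_eq (@is_deriveM _ _ f g x 1 a b fa gb)).
by rewrite addrC /GRing.scale /= mulrC.
Qed.

Lemma is_derive1V f x a : f x != 0 -> is_derive x 1 f a ->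
  is_derive x 1 (fun y => (f y)^-1) (- a * (f x) ^- 2).
Proof.
move=> f0 fa; apply: (is_derive_eq (is_deriveV f0 fa)).
by rewrite /GRing.scale /= mulNr mulrC mulNr.
Qed.

Lemma is_derive1X f n x a : is_derive x 1 f a ->
  is_derive x 1 (fun y => f y ^+ n) (n%:R * f x ^+ n.-1 * a).
Proof.
move=> fa; have -> : (fun y => f y ^+ n) = f ^+ n.
  apply/funext => y; elim: n => [|n IH]; first by rewrite !expr0.
  by rewrite !exprS IH.
exact: is_deriveX.
Qed.

Lemma is_derive1_expR f x a : is_derive x 1 f a ->
  is_derive x 1 (fun y => expR (f y)) (expR (f x) * a).
Proof. by move=> fa; exact: (is_derive1_comp (is_derive_expR _) fa). Qed.

Lemma is_derive1_lnc f x a : 0 < f x -> is_derive x 1 f a ->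
  is_derive x 1 (fun y => ln (f y)) ((f x)^-1 * a).
Proof. by move=> f0 fa; exact: (is_derive1_comp (is_derive1_ln f0) fa). Qed.

Lemma is_derive1_id x : is_derive x 1 (fun y : R => y) 1.
Proof. exact: is_derive_id. Qed.

Lemma is_derive1_cst (k x : R) : is_derive x 1 (fun _ : R => k) 0.
Proof. exact: is_derive_cst. Qed.

Lemma is_derive1_sum (F : nat -> R -> R) (F' : nat -> R) (m n : nat) x :
  (forall i, is_derive x 1 (F i) (F' i)) ->
  is_derive x 1 (fun y => \sum_(m <= i < n) F i y) (\sum_(m <= i < n) F' i).
Proof.
move=> FF'; elim: n => [|n IH].
  rewrite big_geq//; under eq_fun do rewrite big_geq//.
  exact: is_derive1_cst.
have [mn|nm] := leqP m n; last first.
  rewrite big_geq//; under eq_fun do rewrite big_geq//.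
  exact: is_derive1_cst.
rewrite big_nat_recr//=; under eq_fun do rewrite big_nat_recr//=.
exact: is_derive1D.
Qed.

Lemma gt0_eq_is_derive f g x a : (forall y, 0 < y -> f y = g y) -> 0 < x ->
  is_derive x 1 f a -> is_derive x 1 g a.
Proof.
move=> fg x0; apply: near_eq_is_derive.
by near=> y; apply: fg; near: y; exact: lt_nbhsr.
Unshelve. all: by end_near. Qed.

Lemma cvgyV : (t^-1 : R) @[t --> +oo] --> (0:R).
Proof.
pose proof (@gtr0_cvgV0 R R (+oo : set_system R) _ (fun t : R => t)) as h.
by apply h; [exact: nbhs_pinfty_gt|exact: cvg_id].
Qed.

Lemma continuous1D f g x : {for x, continuous f} -> {for x, continuous g} ->
  {for x, continuous (fun y => f y + g y)}.
Proof. by move=> *; exact: cvgD. Qed.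

Lemma continuous1B f g x : {for x, continuous f} -> {for x, continuous g} ->
  {for x, continuous (fun y => f y - g y)}.
Proof. by move=> *; exact: cvgB. Qed.

Lemma continuous1M f g x : {for x, continuous f} -> {for x, continuous g} ->
  {for x, continuous (fun y => f y * g y)}.
Proof. by move=> *; exact: cvgM. Qed.

Lemma is_derive_continuous f x a : is_derive x 1 f a -> {for x, continuous f}.
Proof. by move=> [/derivable1_diffP/differentiable_continuous]. Qed.

End DerivativeRules.

Create HintDb der.

(** The derivative is an evar filled in by the rules; conditions of nonvanishing (inverses) and
    positivity (logarithms) remain as subgoals. The clauses for partial applications catch functions
    that appear eta-reduced. *)
Ltac der := first [eapply is_derive1_cst | eapply is_derive1_id | lazymatch goal with
  | |- is_derive _ _ (fun y => @?f y + @?g y) _ => eapply is_derive1D; [der|der]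
  | |- is_derive _ _ (fun y => @?f y * @?g y) _ => eapply is_derive1M; [der|der]
  | |- is_derive _ _ ( *%R ?c) _ => eapply (@is_derive1M _ (fun _ => c) (fun y => y)); [der|der]
  | |- is_derive _ _ (+%R ?c) _ => eapply (@is_derive1D _ (fun _ => c) (fun y => y)); [der|der]
  | |- is_derive _ _ -%R _ => eapply (@is_derive1N _ (fun y => y)); der
  | |- is_derive _ _ (fun y => - (@?f y)) _ => eapply is_derive1N; der
  | |- is_derive _ _ (@GRing.inv _) _ => eapply (@is_derive1V _ (fun y => y)); [|der]
  | |- is_derive _ _ (fun y => (@?f y)^-1) _ => eapply is_derive1V; [|der]
  | |- is_derive _ _ (fun y => (@?f y) ^+ ?n) _ => eapply is_derive1X; der
  | |- is_derive _ _ expR _ => eapply (@is_derive1_expR _ (fun y => y)); der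
  | |- is_derive _ _ (fun y => expR (@?f y)) _ => eapply is_derive1_expR; der
  | |- is_derive _ _ (@ln _) _ => eapply (@is_derive1_lnc _ (fun y => y)); [|der]
  | |- is_derive _ _ (fun y => ln (@?f y)) _ => eapply is_derive1_lnc; [|der]
  | _ => try solve [eauto 2 with der nocore]
  end].

(** * Completely monotonic functions and their degree *)

Section CompletelyMonotonic.
Context {R : realType}.
Implicit Types (f g h : R -> R) (H G D : nat -> R -> R) (t a b : R).

(** [derive1n] differentiates a total function about which nothing is known at nonpositive points;
    agreement on (0, +oo) propagates through all orders because this set is open. *)
Lemma derive1n_eq D h : (forall t, 0 < t -> D 0%N t = h t) ->
  (forall n t, 0 < t -> is_derive t 1 (D n) (D n.+1 t)) ->
  forall n t, 0 < t -> is_derive t 1 (derive1n n h) (D n.+1 t) /\ derive1n n h t = D n t.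
Proof.
move=> Dh DD; elim=> [|n IH] t t0.
  by split; [exact: gt0_eq_is_derive (DD _ _ t0)|rewrite /= Dh].
have E s : 0 < s -> D n.+1 s = derive1n n.+1 h s.
  move=> s0; have [ds _] := IH _ s0.
  by rewrite derive1nS derive1E; apply/esym/derive_val.
split; last by rewrite E.
exact: gt0_eq_is_derive E t0 (DD _ _ t0).
Qed.

(** [H n] is the n-th derivative with its sign absorbed. Such a chain can be multiplied, or given as
    a family of integrals, without handling iterated derivatives. *)
Lemma completely_monotonicP h : completely_monotonic h <->
  exists H, [/\ forall t, 0 < t -> H 0%N t = h t,
    forall n t, 0 < t -> is_derive t 1 (H n) (- H n.+1 t) &
    forall n t, 0 < t -> 0 <= H n t].
Proof.
split=> [cmh|[H [H0 dH Hge0]]].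
  exists (fun n t => (-1) ^+ n * derive1n n h t); split.
  - by move=> t _; rewrite expr0 mul1r.
  - move=> n t t0; have [dh _] := cmh n t t0.
    have := is_derive1M (is_derive1_cst ((-1) ^+ n) t) (@derivableP _ _ _ _ _ _ dh).
    move/is_derive_eq; apply.
    by rewrite mul0r add0r derive1nS derive1E exprS !mulN1r mulNr opprK.
  - by move=> n t t0; have [_] := cmh n t t0.
move=> n t t0.
pose D n t := (-1) ^+ n * H n t.
have D0 s : 0 < s -> D 0%N s = h s by move=> s0; rewrite /D expr0 mul1r H0.
have DD m (s : R) : 0 < s -> is_derive s 1 (D m) (D m.+1 s).
  move=> s0; have := is_derive1M (is_derive1_cst ((-1) ^+ m) s) (dH m s s0).
  move/is_derive_eq; apply.
  by rewrite mul0r add0r /D exprS mulN1r mulNr mulrN.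
have [dh ->] := derive1n_eq D0 DD n t0; split; first by case: dh.
by rewrite /D mulrA -exprMn mulrNN mulr1 expr1n mul1r Hge0.
Qed.

Lemma completely_monotonic_eq f g : (forall t, 0 < t -> f t = g t) ->
  completely_monotonic f -> completely_monotonic g.
Proof.
move=> fg /completely_monotonicP[H [H0 dH Hge0]]; apply/completely_monotonicP.
by exists H; split=> // t t0; rewrite H0// fg.
Qed.

Lemma completely_monotonicM f g : completely_monotonic f ->
  completely_monotonic g -> completely_monotonic (fun t => f t * g t).
Proof.
move=> /completely_monotonicP[H [H0 dH Hge0]] /completely_monotonicP[G [G0 dG Gge0]].
apply/completely_monotonicP.
(* Leibniz' rule without binomial coefficients: [M n i j] is the [n]-th iterate
   of [(i, j) |-> (i.+1, j) + (i, j.+1)] on the products [H i * G j]. *)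
pose M := fix M n i j t := if n is n'.+1 then M n' i.+1 j t + M n' i j.+1 t
  else H i t * G j t.
have M_ge0 n i j t : 0 < t -> 0 <= M n i j t.
  move=> t0; elim: n i j => [|n IH] i j /=; first by rewrite mulr_ge0 ?Hge0 ?Gge0.
  by rewrite addr_ge0.
have dM n i j t : 0 < t -> is_derive t 1 (M n i j) (- M n.+1 i j t).
  move=> t0; elim: n i j => [|n IH] i j.
    apply: is_derive_eq; first exact: is_derive1M (dH i _ t0) (dG j _ t0).
    rewrite /=.
    by rewrite mulNr mulrN -opprD.
  by have := is_derive1D (IH i.+1 j) (IH i j.+1); rewrite -opprD.
exists (fun n => M n 0%N 0%N); split.
- by move=> t t0 /=; rewrite H0// G0.
- by move=> n t t0; exact: dM.
- by move=> n t t0; exact: M_ge0.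
Qed.

Lemma completely_monotonic_powRN b : 0 <= b ->
  completely_monotonic (fun t => t `^ (- b)).
Proof.
move=> b0; apply/completely_monotonicP.
exists (fun n t => (\prod_(0 <= k < n) (b + k%:R)) * t `^ (- b - n%:R)); split.
- by move=> t t0; rewrite big_geq// mul1r subr0.
- move=> n t t0.
  apply: is_derive_eq; first exact: is_derive1M (is_derive1_cst _ t) (is_derive1_powR _ t0).
  rewrite mul0r add0r big_nat_recr//= -natr1 opprD addrA -opprD mulNr mulrN mulrA.
  by [].
- move=> n t t0; rewrite mulr_ge0 ?powR_ge0// prodr_ge0// => k _.
  by rewrite addr_ge0.
Qed.

(** The missing factor t^(b-a) is itself completely monotonic. Hence the admissible exponents form a
    down-closed set. *)
Lemma completely_monotonic_powR_le h a b : b <= a ->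
  completely_monotonic (fun t => t `^ a * h t) ->
  completely_monotonic (fun t => t `^ b * h t).
Proof.
move=> ba cma.
have ab0 : 0 <= a - b by rewrite subr_ge0.
apply: completely_monotonic_eq (completely_monotonicM (completely_monotonic_powRN ab0) cma).
move=> t t0; rewrite mulrA -powRD; last by rewrite (gt_eqF t0) implybT.
by congr (_ `^ _ * _); ring.
Qed.

Lemma completely_monotonic_nincr h s t : completely_monotonic h ->
  0 < s -> s <= t -> h t <= h s.
Proof.
move=> /completely_monotonicP[H [H0 dH Hge0]] s0 st.
have t0 := lt_le_trans s0 st.
rewrite -!H0//.
have [|x|c] := @MVT_segment _ (H 0%N) (fun x => - H 1%N x) _ _ st.
- by move=> x; rewrite in_itv/= => /andP[sx _]; apply: dH; exact: lt_trans sx.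
- apply: derivable_within_continuous => y; rewrite in_itv/= => /andP[sx _].
  by have [] := dH 0%N y (lt_le_trans s0 sx).
rewrite in_itv/= => /andP[sc _] E.
by rewrite -subr_le0 E mulNr oppr_le0 mulr_ge0 ?subr_ge0// Hge0// (lt_le_trans s0).
Qed.

(* [N n 0 0 a] is the [n]-th derivative of [t `^ a * h t]: Leibniz' rule as in
   [completely_monotonicM], now keeping track of the exponent. *)
Lemma completely_monotonic_powR_sup h d : completely_monotonic h ->
  (forall a, a < d -> completely_monotonic (fun t => t `^ a * h t)) ->
  completely_monotonic (fun t => t `^ d * h t).
Proof.
move=> /completely_monotonicP[H [H0 dH Hge0]] cm n t t0.
pose T i a t : R := (\prod_(0 <= k < i) (a - k%:R)) * t `^ (a - i%:R).
pose N := fix N n i j a t := if n is n'.+1 then N n' i.+1 j a t - N n' i j.+1 a t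
  else T i a t * H j t.
have dT i a (s : R) : 0 < s -> is_derive s 1 (T i a) (T i.+1 a s).
  move=> s0.
  apply: is_derive_eq; first exact: is_derive1M (is_derive1_cst _ s) (is_derive1_powR _ s0).
  by rewrite mul0r add0r /T big_nat_recr//= -natr1 opprD addrA mulrA.
have dN m i j a (s : R) : 0 < s -> is_derive s 1 (N m i j a) (N m.+1 i j a s).
  move=> s0; elim: m i j => [|m IH] i j.
    by have := is_derive1M (dT i a s s0) (dH j s s0); rewrite mulrN.
  by have := is_derive1D (IH i.+1 j) (is_derive1N (IH i j.+1)).
have E a : (forall m (s : R), 0 < s -> is_derive s 1 (derive1n m (fun t => t `^ a * h t)) (N m.+1 0%N 0%N a s) /\
    derive1n m (fun t => t `^ a * h t) s = N m 0%N 0%N a s).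
  have N0 s : 0 < s -> N 0%N 0%N 0%N a s = s `^ a * h s.
    by move=> s0; rewrite /= /T big_geq// mul1r subr0 H0.
  by move=> m s; exact: (derive1n_eq N0 (fun m s => @dN m 0%N 0%N a s)).
have [dE ->] := E d n t t0; split; first by case: dE.
have cT i a : {for a, continuous (fun a => T i a t)}.
  apply: continuous1M; last first.
    have -> : (fun a => t `^ (a - i%:R)) = (fun a => expR ((a - i%:R) * ln t)).
      by apply/funext => b; rewrite /powR gt_eqF.
    by apply: is_derive_continuous; der.
  elim: i => [|i IH].
    have -> : (fun y : R => \prod_(0 <= k < 0) (y - k%:R)) = (fun=> 1).
      by apply/funext => y; rewrite big_geq.
    exact: cvg_cst.
  have -> : (fun y : R => \prod_(0 <= k < i.+1) (y - k%:R)) =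
            (fun y => \prod_(0 <= k < i) (y - k%:R) * (y - i%:R)).
    by apply/funext => y; rewrite big_nat_recr.
  by apply: continuous1M => //; apply: is_derive_continuous; der.
have cN m i j a : {for a, continuous (fun a => N m i j a t)}.
  elim: m i j => [|m IH] i j /=.
    by apply: continuous1M; [exact: cT|exact: cvg_cst].
  exact: (continuous1B (IH _ _) (IH _ _)).
(* For fixed n and t the signed derivative is continuous in the exponent, so its sign passes to the
   left limit at [d]. *)
pose S := fun a => (-1) ^+ n * N n 0%N 0%N a t.
have cS : S a @[a --> d^'-] --> S d.
  apply: cvg_at_left_filter.
  exact: (cvgMr (cN n 0%N 0%N d)).
rewrite -/(S d) -(cvg_lim _ cS)//; apply: limr_ge; first by apply/cvg_ex; exists (S d).
near=> a; have ad : a < d by near: a; exact: nbhs_left_lt.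
by have [_] := cm a ad n t t0; rewrite (E a n t t0).2.
Unshelve. all: by end_near. Qed.

(* A completely monotonic function is nonincreasing, which forces
   [t `^ a * h t >= h 1] on (0, 1). *)
Lemma not_completely_monotonic_powR h a : 0 < h 1 ->
  (exists b C, b < a /\ forall t, 0 < t < 1 -> h t <= C * t `^ (- b)) ->
  ~ completely_monotonic (fun t => t `^ a * h t).
Proof.
move=> h1 [b [C [ba hC]]] cm.
have : C * t `^ (a - b) @[t --> 0^'+] --> C * 0.
  by apply: cvgMr; apply: powR_cvg0; rewrite subr_gt0.
rewrite mulr0 => /cvgr_lt/(_ _ h1) => nearC.
near (0:R)^'+ => t.
have t0 : 0 < t by near: t; exact: nbhs_right_gt.
have t1 : t < 1 by near: t; exact: nbhs_right_lt.
have := completely_monotonic_nincr cm t0 (ltW t1).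
rewrite powR1 mul1r leNgt => /negP; apply.
have : C * t `^ (a - b) < h 1 by near: t; exact: nearC.
apply: le_lt_trans; rewrite powRD ?(gt_eqF t0) ?implybT// mulrCA.
by rewrite ler_wpM2l ?powR_ge0// hC// t0.
Unshelve. all: by end_near. Qed.

(** The degree is the supremum of the admissible exponents: it is bounded by [q] because of the
    growth at 0+, attained by continuity in the exponent, and every smaller exponent is
    admissible. *)
Lemma cm_degree_between h p q : 0 <= p -> p <= q ->
  completely_monotonic (fun t => t `^ p * h t) -> h t @[t --> +oo] --> 0 -> 0 < h 1 ->
  (forall a, q < a -> exists b C, b < a /\ forall t, 0 < t < 1 -> h t <= C * t `^ (- b)) ->
  exists2 d, cm_degree h d%:E & p <= d <= q.
Proof.
move=> p0 pq cmp h0 h1 hq.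
have cmh : completely_monotonic h.
  apply: completely_monotonic_eq (completely_monotonic_powR_le p0 cmp).
  by move=> t _; rewrite powRr0 mul1r.
pose S := [set a | completely_monotonic (fun t => t `^ a * h t)].
have ubS : ubound S q.
  move=> a Sa; rewrite leNgt; apply/negP => qa.
  exact: not_completely_monotonic_powR h1 (hq a qa) Sa.
have hsS : has_sup S by split; [exists p|exists q].
have pS : p <= sup S by apply: sup_upper_bound.
have cmS : completely_monotonic (fun t => t `^ (sup S) * h t).
  apply: completely_monotonic_powR_sup => // a aS.
  have [b Sb ab] := sup_gt (proj1 hsS) aS.
  exact: completely_monotonic_powR_le (ltW ab) Sb.
exists (sup S); last by rewrite pS/= ge_sup//; exists p.
split=> //; exists 0 => //; split; first exact: le_trans pS.
move=> a a0; under eq_fun do rewrite subr0.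
split=> [cma|aS]; first exact: sup_upper_bound.
exact: completely_monotonic_powR_le cmS.
Qed.

End CompletelyMonotonic.

(** * Laplace transforms on (0, +oo) *)

Section Laplace.
Context {R : realType}.
Notation mu := (@lebesgue_measure R).
Notation D := (`]0%R, +oo[%classic : set R).
Implicit Types (f g F G : R -> R) (s t u : R).

Lemma continuous_measurable_gt0 f :
  (forall u, 0 < u -> {for u, continuous f}) -> measurable_fun D f.
Proof.
move=> cf; apply: subspace_continuous_measurable_fun; first exact: measurable_itv.
apply: continuous_in_subspaceT => u; rewrite inE/= in_itv/= andbT => u0.
exact: cf.
Qed.

Lemma measurable_gt0_expR t : measurable_fun D (fun u => expR (- (t * u))).
Proof.
apply: continuous_measurable_gt0 => u _; apply: is_derive_continuous; der.
Qed.

(** Tonelli on the region phi(s) < u of the open quadrant. It serves twice: phi(s) = s gives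
    integration by parts, phi(s) = s^2 relates a gamma value to the Gaussian integral. *)
Lemma tonelli_gt0 (phi G k : R -> R) :
  measurable_fun setT phi ->
  measurable_fun D G -> measurable_fun D k ->
  (forall u, 0 < u -> 0 <= G u) -> (forall u, 0 < u -> 0 <= k u) ->
  (\int[mu]_(s in D) ((G s)%:E * \int[mu]_(u in D `&` [set u | (phi s < u)%R]) (k u)%:E) =
   \int[mu]_(u in D) ((k u)%:E * \int[mu]_(s in D `&` [set s | (phi s < u)%R]) (G s)%:E))%E.
Proof.
move=> mphi mG mk G0 k0.
have mD : measurable D by exact: measurable_itv.
pose H (z : R * R) : \bar R := ((G \_ D) z.1 * (k \_ D) z.2 * (phi z.1 < z.2)%R%:R)%:E.
have restr_ge0 f : (forall u, 0 < u -> 0 <= f u) -> forall u, 0 <= (f \_ D) u.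
  move=> f0 u; rewrite patchE; case: ifPn => //; rewrite inE/= in_itv/= andbT.
  exact: f0.
have H0 z : (0 <= H z)%E by rewrite lee_fin !mulr_ge0 ?restr_ge0.
have mG' : measurable_fun setT (G \_ D) by exact/(measurable_restrictT _ mD).
have mk' : measurable_fun setT (k \_ D) by exact/(measurable_restrictT _ mD).
have mlt : measurable_fun [set: R * R] (fun z : R * R => (phi z.1 < z.2)%R%:R : R).
  have : measurable_fun [set: R * R] (fun z : R * R => (phi z.1 < z.2)%R).
    apply: measurable_fun_ltr; last exact: measurable_snd.
    exact: measurableT_comp measurable_fst.
  move=> mb; apply: (measurableT_comp (f := fun b : bool => (b%:R : R))) => //.
have mH : measurable_fun setT H.
  apply/measurable_EFinP; apply: measurable_funM => //.
  apply: measurable_funM.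
    exact: (measurableT_comp mG' measurable_fst).
  exact: (measurableT_comp mk' measurable_snd).
have mlt1 s : measurable (D `&` [set u | (phi s < u)%R]).
  by apply: measurableI => //; rewrite -set_itvoy; exact: measurable_itv.
have mlt2 u : measurable (D `&` [set s | (phi s < u)%R]).
  apply: measurableI => //; rewrite -[X in measurable X]setTI.
  have -> : [set s | (phi s < u)%R] = phi @^-1` `]-oo, u[%classic.
    by rewrite set_itvNyo.
  by apply: mphi => //; exact: measurable_itv.
have E1 s u : H (s, u) = (((G \_ D) s)%:E * ((k \_ (D `&` [set u | (phi s < u)%R])) u)%:E)%E.
  rewrite -EFinM /H /=; congr EFin; rewrite -mulrA; congr (_ * _).
  rewrite !patchE in_setI [X in _ && X]/=; case: (u \in D); last by rewrite mul0r.
  case: ltP => us.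
    by rewrite mulr1 ifT//; apply/mem_set.
  by rewrite mulr0 ifF//; apply/negbTE/negP => /set_mem/=; rewrite ltNge us.
have E2 s u : H (s, u) = (((k \_ D) u)%:E * ((G \_ (D `&` [set s | (phi s < u)%R])) s)%:E)%E.
  rewrite -EFinM /H /=; congr EFin; rewrite mulrAC mulrC; congr (_ * _).
  rewrite !patchE in_setI [X in _ && X]/=; case: (s \in D); last by rewrite mul0r.
  case: ltP => us.
    by rewrite mulr1 ifT//; apply/mem_set.
  by rewrite mulr0 ifF//; apply/negbTE/negP => /set_mem/=; rewrite ltNge us.
have subr_ge0' f B : (forall u, 0 < u -> 0 <= f u) -> forall u, 0 <= (f \_ (D `&` B)) u.
  move=> f0 u; rewrite patchE; case: ifPn => //; rewrite inE/= in_itv/= andbT => -[u0 _].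
  exact: f0.
have mr f B : measurable (D `&` B) -> measurable_fun D f -> measurable_fun setT (f \_ (D `&` B)).
  move=> mDB mf; apply/(measurable_restrictT _ mDB).
  by apply: (measurable_funS mD _ mf); exact: subIsetl.
have I1 s : (\int[mu]_u H (s, u) = ((G \_ D) s)%:E *
    \int[mu]_(u in D `&` [set u | (phi s < u)%R]) (k u)%:E)%E.
  under eq_integral => u _ do rewrite E1.
  rewrite ge0_integralZl//; last 3 first.
  - by apply/measurable_EFinP; exact: mr.
  - by move=> u _; rewrite lee_fin subr_ge0'.
  - by rewrite lee_fin restr_ge0.
  congr (_ * _)%E; rewrite [RHS]integral_mkcond.
  by apply: eq_integral => u _; rewrite restrict_EFin.
have I2 u : (\int[mu]_s H (s, u) = ((k \_ D) u)%:E *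
    \int[mu]_(s in D `&` [set s | (phi s < u)%R]) (G s)%:E)%E.
  under eq_integral => s _ do rewrite E2.
  rewrite ge0_integralZl//; last 3 first.
  - by apply/measurable_EFinP; exact: mr.
  - by move=> s _; rewrite lee_fin subr_ge0'.
  - by rewrite lee_fin restr_ge0.
  congr (_ * _)%E; rewrite [RHS]integral_mkcond.
  by apply: eq_integral => s _; rewrite restrict_EFin.
have := @fubini_tonelli _ _ _ _ _ mu mu H mH H0.
under eq_integral => s _ do rewrite I1.
under [X in _ = X]eq_integral => u _ do rewrite I2.
move=> FT; rewrite integral_mkcond [RHS]integral_mkcond.
have J (f : R -> R) (g : R -> \bar R) :
    (\int[mu]_u ((fun u => (f u)%:E * g u) \_ D) u = \int[mu]_u (((f \_ D) u)%:E * g u))%E.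
  by apply: eq_integral => u _; rewrite !patchE; case: ifPn => // _; rewrite mul0e.
by rewrite !J.
Qed.

Let mD : (measurable : set (set (measurableTypeR R))) D. Proof. exact: measurable_itv. Qed.

Lemma cvgy_expRM t : 0 < t -> expR (- (t * u)) @[u --> +oo] --> (0:R).
Proof.
move=> t0; apply: (@cvg_comp _ _ _ (fun u => t * u) (fun u : R => expR (- u)) _ +oo).
  exact: gt0_cvgMry.
exact: cvgr_expR.
Qed.

Lemma integral_expR_gt t s : 0 < t ->
  (\int[mu]_(u in `]s, +oo[) (t * expR (- (t * u)))%:E = (expR (- (t * s)))%:E)%E.
Proof.
move=> t0.
have c u : {for u, continuous (fun u => t * expR (- (t * u)))}.
  by apply: is_derive_continuous; der.
have d u : is_derive u 1 (fun u => - expR (- (t * u))) (t * expR (- (t * u))).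
  by eapply is_derive_eq; [der|cbv beta; ring].
rewrite integral_itv_obnd_cbnd; last first.
  apply/measurable_EFinP; apply: measurable_funTS.
  by apply: continuous_measurable_fun => u; exact: c.
rewrite (@ge0_continuous_FTC2y _ _ (fun u => - expR (- (t * u))) _ 0).
- by rewrite -EFinB sub0r opprK.
- by move=> u _; rewrite mulr_ge0 ?expR_ge0 ?ltW.
- by apply: continuous_subspaceT => u; exact: c.
- by rewrite -[X in _ --> X]oppr0; apply: cvgN; exact: cvgy_expRM.
- by move=> u _; have [] := d u.
- apply: cvg_at_right_filter; exact: is_derive_continuous (d s).
- by move=> u _; rewrite derive1E; exact: derive_val.
Qed.

Definition laplace f t : R := \int[mu]_(u in D) (f u * expR (- (t * u))).

(** Integrability is asked for all t > 0 at once; this makes the class stable under multiplication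
    by u, hence the transforms infinitely differentiable. *)
Definition laplaceable f := forall t, 0 < t ->
  mu.-integrable D (EFin \o (fun u => f u * expR (- (t * u)))).

Lemma laplaceable_measurable f : laplaceable f -> measurable_fun D f.
Proof.
move=> /(_ 1 ltr01)/integrableP[/measurable_EFinP mf _].
have -> : f = (fun u => (f u * expR (- (1 * u))) * expR (- (-1 * u))).
  by apply/funext => u; rewrite -mulrA -expRD mulN1r mul1r opprK addNr expR0 mulr1.
by apply: measurable_funM => //; exact: measurable_gt0_expR.
Qed.

Lemma measurable_laplace f t : measurable_fun D f ->
  measurable_fun D (fun u => (f u * expR (- (t * u)))%:E).
Proof.
move=> mf; apply/measurable_EFinP; apply: measurable_funM => //.
exact: measurable_gt0_expR.
Qed.

Lemma le_laplaceable f g : measurable_fun D g ->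
  (forall u, 0 < u -> `|g u| <= f u) -> laplaceable f -> laplaceable g.
Proof.
move=> mg gf lf t t0.
apply: (le_integrable mD _ _ (lf t t0)); first exact: measurable_laplace.
move=> u /=; rewrite in_itv/= andbT => u0; rewrite lee_fin !normrM.
by rewrite ler_wpM2r// (le_trans (gf u u0))// ler_norm.
Qed.

Lemma laplaceableD f g : laplaceable f -> laplaceable g ->
  laplaceable (fun u => f u + g u).
Proof.
move=> lf lg t t0.
have := integrableD mD (lf t t0) (lg t t0).
by apply: eq_integrable => // u _; rewrite /= -EFinD mulrDl.
Qed.

Lemma laplaceableZ k f : laplaceable f -> laplaceable (fun u => k * f u).
Proof.
move=> lf t t0.
have := integrableZl mD k (lf t t0).
by apply: eq_integrable => // u _; rewrite /= -EFinM mulrA.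
Qed.

Lemma laplaceable_cst k : laplaceable (fun=> k).
Proof.
have l1 : laplaceable (fun=> 1).
  move=> t t0; apply/integrableP; split; first exact: measurable_laplace.
  have h u : (`|(EFin \o (fun u => 1 * expR (- (t * u)))%R) u| =
     t^-1%:E * (t * expR (- (t * u)))%R%:E)%E.
    rewrite /= ger0_norm ?mul1r ?expR_ge0// -EFinM mulrA mulVf ?mul1r// gt_eqF//.
  under eq_integral => u _ do rewrite h.
  rewrite ge0_integralZl//; last 3 first.
  - by apply/measurable_EFinP; apply: measurable_funM => //; exact: measurable_gt0_expR.
  - by move=> u _; rewrite lee_fin mulr_ge0 ?expR_ge0 ?ltW.
  - by rewrite lee_fin invr_ge0 ltW.
  by rewrite integral_expR_gt// -EFinM ltry.
have -> : (fun=> k) = (fun _ : R => k * 1) by apply/funext => u; rewrite mulr1.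
exact: laplaceableZ.
Qed.

(** The factor u is absorbed by half of the decay: u e^(-tu) <= (2/t) e^(-tu/2), from x <= e^x at x
    = tu/2. *)
Lemma laplaceableM_id f : laplaceable f -> laplaceable (fun u => u * f u).
Proof.
move=> lf t t0; have t20 : 0 < t / 2 by rewrite divr_gt0.
have le_u (u : R) : 0 < u ->
    `|u * f u * expR (- (t * u))| <= `|2 / t * (f u * expR (- (t / 2 * u)))|.
  move=> u0; rewrite !normrM [`|u|]gtr0_norm// -normrM [`|2 / t|]gtr0_norm ?divr_gt0//.
  rewrite [`|expR (- (t * u))|]ger0_norm ?expR_ge0// [`|expR _|]ger0_norm ?expR_ge0//.
  rewrite -mulrA mulrCA [leRHS]mulrCA ler_wpM2l//.
  have -> : t * u = t / 2 * u + t / 2 * u by field.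
  rewrite opprD expRD mulrA ler_wpM2r ?expR_ge0//.
  rewrite expRN ler_pdivrMr ?expR_gt0//.
  have h : t / 2 * u <= expR (t / 2 * u).
    by apply: le_trans (expR_ge1Dx _); rewrite lerDr.
  have {1}-> : u = 2 / t * (t / 2 * u) by field; rewrite gt_eqF.
  by rewrite ler_wpM2l// divr_ge0// ltW.
have := integrableZl mD (2 / t) (lf _ t20).
apply: le_integrable => //.
  apply: measurable_laplace; apply: measurable_funM => //.
  exact: laplaceable_measurable.
move=> u /=; rewrite in_itv/= andbT => u0; rewrite lee_fin.
exact: le_u.
Qed.

Lemma laplaceableXn_id n f : laplaceable f -> laplaceable (fun u => u ^+ n * f u).
Proof.
move=> lf; elim: n => [|n IH].
  by have -> : (fun u => u ^+ 0 * f u) = f by apply/funext => u; rewrite mul1r.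
have -> : (fun u => u ^+ n.+1 * f u) = (fun u => u * (u ^+ n * f u)).
  by apply/funext => u; rewrite exprS mulrA.
exact: laplaceableM_id.
Qed.

Lemma laplaceableX n : laplaceable (fun u => u ^+ n).
Proof.
have -> : (fun u : R => u ^+ n) = (fun u => u ^+ n * 1) by apply/funext => u; rewrite mulr1.
exact/laplaceableXn_id/laplaceable_cst.
Qed.

Lemma eq_laplace f g t : (forall u, 0 < u -> f u = g u) -> laplace f t = laplace g t.
Proof.
by move=> fg; apply: eq_Rintegral => u; rewrite inE/= in_itv/= andbT => /fg ->.
Qed.

Lemma laplaceD f g t : laplaceable f -> laplaceable g -> 0 < t ->
  laplace (fun u => f u + g u) t = laplace f t + laplace g t.
Proof.
move=> lf lg t0; rewrite /laplace -RintegralD//; last 2 first.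
- exact: lf.
- exact: lg.
by apply: eq_Rintegral => u _; rewrite mulrDl.
Qed.

Lemma laplaceZ k f t : laplaceable f -> 0 < t ->
  laplace (fun u => k * f u) t = k * laplace f t.
Proof.
move=> lf t0; rewrite /laplace -RintegralZl//; last exact: lf.
by apply: eq_Rintegral => u _; rewrite mulrA.
Qed.

Lemma laplace_ge0 f t : (forall u, 0 < u -> 0 <= f u) -> 0 <= laplace f t.
Proof.
move=> f0; apply: Rintegral_ge0 => u /=; rewrite in_itv/= andbT => u0.
by rewrite mulr_ge0 ?expR_ge0 ?f0.
Qed.

Lemma le_laplace f g t : laplaceable f -> laplaceable g -> 0 < t ->
  (forall u, 0 < u -> f u <= g u) -> laplace f t <= laplace g t.
Proof.
move=> lf lg t0 fg; apply: le_Rintegral => //; [exact: lf|exact: lg|].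
move=> u /=; rewrite in_itv/= andbT => u0.
by rewrite ler_wpM2r ?expR_ge0 ?fg.
Qed.

Lemma EFin_laplace f t : laplaceable f -> 0 < t ->
  (laplace f t)%:E = (\int[mu]_(u in D) (f u * expR (- (t * u)))%:E)%E.
Proof. by move=> lf t0; rewrite fineK//; exact: integrable_fin_num (lf t t0). Qed.

Lemma laplaceable_lty f : measurable_fun D f -> (forall u, 0 < u -> 0 <= f u) ->
  (forall t, 0 < t -> (\int[mu]_(u in D) (f u * expR (- (t * u)))%:E < +oo)%E) ->
  laplaceable f.
Proof.
move=> mf f0 foo t t0; apply/integrableP; split; first exact: measurable_laplace.
apply: le_lt_trans (foo t t0); apply: ge0_le_integral => //.
- by apply: measurableT_comp => //; exact: measurable_laplace.
- exact: measurable_laplace.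
- move=> u; rewrite /= in_itv/= andbT => u0.
  by rewrite lee_fin ger0_norm// mulr_ge0 ?expR_ge0 ?f0.
Qed.

Lemma laplace_cst k t : 0 < t -> laplace (fun=> k) t = k / t.
Proof.
move=> t0; have E : laplace (fun=> t) t = 1.
  rewrite /laplace /Rintegral integral_expR_gt//= mulr0 oppr0 expR0//.
have -> : laplace (fun=> k) t = laplace (fun=> k / t * t) t.
  by apply: eq_laplace => u _; rewrite mulfVK// gt_eqF.
by rewrite laplaceZ ?E ?mulr1//; exact: laplaceable_cst.
Qed.

Lemma is_derive_laplace f t : laplaceable f -> 0 < t ->
  is_derive t 1 (laplace f) (- laplace (fun u => u * f u) t).
Proof.
move=> lf t0.
pose h t u := f u * expR (- (t * u)).
have d (x u : R) : is_derive x 1 (h^~ u) (- (u * f u * expR (- (x * u)))).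
  by eapply is_derive_eq; [rewrite /h; der|cbv beta; ring].
have dE x u : partial1of2 h x u = - (u * f u * expR (- (x * u))).
  by rewrite partial1of2E; exact: derive_val.
(* On ]t/2, t + 1[ the exponential is largest at the left end, so its value at t/2 dominates. *)
pose G (u : R) : R := `|u * f u * expR (- (t / 2 * u))|.
have t2 : 0 < t / 2 by rewrite divr_gt0.
have It : `]t / 2, t + 1[%classic t by rewrite /= in_itv/= ltrDl ltr01 andbT; lra.
have intf x : `]t / 2, t + 1[%classic x -> mu.-integrable D (EFin \o h x).
  by rewrite /= in_itv/= => /andP[x0 _]; apply: lf; exact: lt_trans x0.
have intG : mu.-integrable D (EFin \o (G \_ D)).
  have := integrable_abse (laplaceableM_id lf t2).
  apply: eq_integrable => // u uD; rewrite /= patchE uD//.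
have G0 u : 0 <= (G \_ D) u by rewrite patchE; case: ifPn => // _; rewrite /G.
have Gub x u : `]t / 2, t + 1[%classic x -> D u -> `|partial1of2 h x u| <= (G \_ D) u.
  move=> xI uD; rewrite patchE mem_set// dE normrN /G !normrM.
  move: xI uD; rewrite /= !in_itv/= andbT => /andP[xt _] u0.
  rewrite ler_wpM2l// !ger0_norm ?expR_ge0// ler_expR lerN2 ler_wpM2r ?ltW//.
have dh x u : `]t / 2, t + 1[%classic x -> D u -> derivable (h^~ u) x 1.
  by move=> _ _; have [] := d x u.
apply: DeriveDef; first exact: (derivable_under_integral mD It intf dh G0 intG Gub).
rewrite -derive1E (differentiation_under_integral mD It intf dh G0 intG Gub).
rewrite /laplace -mulN1r -RintegralZl//; last exact: laplaceableM_id.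
by apply: eq_Rintegral => u _; rewrite dE mulN1r.
Qed.

(** The easy half of Bernstein's theorem: each differentiation brings down a factor -u. *)
Lemma completely_monotonic_laplace f : laplaceable f ->
  (forall u, 0 < u -> 0 <= f u) -> completely_monotonic (laplace f).
Proof.
move=> lf f0; apply/completely_monotonicP.
exists (fun n => laplace (fun u => u ^+ n * f u)); split.
- by move=> t _; apply: eq_laplace => u _; rewrite mul1r.
- move=> n t t0; apply: is_derive_eq (is_derive_laplace (laplaceableXn_id n lf) t0) _.
  by congr (- _); apply: eq_laplace => u _; rewrite mulrA -exprS.
- move=> n t t0; apply: laplace_ge0 => u u0.
  by rewrite mulr_ge0 ?f0// exprn_ge0// ltW.
Qed.

(** Only the limit of [F] at 0+ is known, and [G] may be unbounded there. The interval is therefore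
    exhausted by [a n, u[ and the integral obtained by monotone convergence. *)
Lemma integral_gt0_FTC F G u : 0 < u ->
  (forall s, 0 < s -> is_derive s 1 F (G s)) ->
  (forall s, 0 < s -> {for s, continuous G}) ->
  (forall s, 0 < s -> 0 <= G s) -> F s @[s --> 0^'+] --> 0 ->
  (\int[mu]_(s in D `&` [set s | (s < u)%R]) (G s)%:E = (F u)%:E)%E.
Proof.
move=> u0 dF cG G0 F0.
(* [n.+2] keeps [a n] strictly below [u] even for n = 0. *)
pose a n : R := u * n.+2%:R^-1.
have a0 n : 0 < a n by rewrite mulr_gt0// invr_gt0.
have au n : a n < u.
  by rewrite /a gtr_pMr// invf_lt1// ltr1n.
have ha n m : (n <= m)%N -> a m <= a n.
  by move=> nm; rewrite ler_pM2l// lef_pV2 ?posrE// ler_nat !ltnS.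
have ca : a n @[n --> \oo] --> (0:R).
  rewrite -(mulr0 u); apply: cvgMr.
  by have := @cvg_harmonic R; rewrite -cvg_shiftS.
have mG n : measurable_fun `[a n, u[ G.
  have : measurable_fun D G by exact: continuous_measurable_gt0.
  apply: measurable_funS => // s /=; rewrite !in_itv/= andbT => /andP[+ _].
  exact: lt_le_trans.
have -> : D `&` [set s | s < u] = \bigcup_n `[a n, u[%classic.
  apply/seteqP; split=> [s [/=]|s [n _ /=]]; last first.
    by rewrite !in_itv/= andbT => /andP[an ->]; rewrite (lt_le_trans (a0 n)).
  rewrite in_itv/= andbT => s0 su.
  have [n _ hn] : \forall n \near \oo, a n <= s.
    exact: (cvgr_le _ ca).
  exists n => //=; rewrite in_itv/= su andbT; apply: hn => /=; exact: leqnn.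
have H1 n : (\int[mu]_(s in `[a n, u[) (G s)%:E = (F u - F (a n))%:E)%E.
  rewrite integral_itv_bndo_bndc; last exact/measurable_EFinP.
  rewrite (@continuous_FTC2 _ G F)//.
  - apply: continuous_in_subspaceT => s; rewrite inE/= in_itv/= => /andP[as_ _].
    by apply: cG; exact: lt_le_trans as_.
  - split.
    + move=> s; rewrite in_itv/= => /andP[as_ _].
      by have [] := dF s (lt_trans (a0 n) as_).
    + by apply: cvg_at_right_filter; exact: is_derive_continuous (dF _ (a0 n)).
    + by apply: cvg_at_left_filter; exact: is_derive_continuous (dF _ u0).
  - move=> s; rewrite in_itv/= => /andP[as_ _].
    by rewrite derive1E; have [_ ->] := dF s (lt_trans (a0 n) as_).
have c1 : (\int[mu]_(s in `[a n, u[) (G s)%:E @[n --> \oo] -->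
    \int[mu]_(s in \bigcup_n `[a n, u[%classic) (G s)%:E)%E.
  apply: ge0_nondecreasing_set_cvg_integral.
  - move=> n m nm; rewrite subsetEset => s /=; rewrite !in_itv/= => /andP[an ->].
    by rewrite (le_trans (ha _ _ nm)).
  - by move=> n; exact: measurable_itv.
  - by move=> n; apply/measurable_EFinP; exact: mG.
  - move=> n s /=; rewrite in_itv/= => /andP[an _]; rewrite lee_fin G0//.
    exact: lt_le_trans an.
have c2 : ((F u - F (a n))%:E @[n --> \oo] --> (F u)%:E)%E.
  apply: cvg_EFin; first exact: nearW.
  rewrite -[X in _ --> X]subr0; apply: cvgB; first exact: cvg_cst.
  by move/cvg_at_rightP : F0; apply; split.
rewrite -(cvg_lim _ c1)//; under eq_fun do rewrite H1.
exact: cvg_lim.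
Qed.

(** Integration by parts as an exchange of integrals: F(u) is the integral of [G] over (0, u), and
    e^(-ts) that of t e^(-tu) over u > s. As G >= 0, finiteness of the left-hand side comes out of
    the computation. *)
Lemma laplace_parts F G t : laplaceable F -> 0 < t ->
  (forall s, 0 < s -> is_derive s 1 F (G s)) ->
  (forall s, 0 < s -> {for s, continuous G}) ->
  (forall s, 0 < s -> 0 <= G s) -> F s @[s --> 0^'+] --> 0 ->
  (\int[mu]_(u in D) (G u * expR (- (t * u)))%:E = (t * laplace F t)%:E)%E.
Proof.
move=> lF t0 dF cG G0 F0.
have mG : measurable_fun D G by exact: continuous_measurable_gt0.
have k0 u : 0 < u -> 0 <= t * expR (- (t * u)) by rewrite mulr_ge0 ?expR_ge0 ?ltW.
have mk : measurable_fun D (fun u => t * expR (- (t * u))).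
  by apply: measurable_funM => //; exact: measurable_gt0_expR.
have := tonelli_gt0 (@measurable_id _ _ setT) mG mk G0 k0.
have -> : (\int[mu]_(s in D) ((G s)%:E * \int[mu]_(u in D `&` [set u | (s < u)%R]) (t * expR (- (t * u)))%:E)
  = \int[mu]_(u in D) (G u * expR (- (t * u)))%:E)%E.
  apply: eq_integral => s; rewrite inE/= in_itv/= andbT => s0.
  have -> : D `&` [set u | s < u] = `]s, +oo[%classic.
    rewrite -set_itvoy; apply/seteqP; split=> u /=; rewrite !in_itv/= !andbT; first by case.
    by move=> su; split=> //; exact: lt_trans su.
  by rewrite integral_expR_gt// EFinM.
have -> : (\int[mu]_(u in D) ((t * expR (- (t * u)))%:E * \int[mu]_(s in D `&` [set s | (s < u)%R]) (G s)%:E)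
  = \int[mu]_(u in D) (t%:E * (F u * expR (- (t * u)))%:E))%E.
  apply: eq_integral => u; rewrite inE/= in_itv/= andbT => u0.
  by rewrite (integral_gt0_FTC u0 dF)// -!EFinM; congr EFin; ring.
move=> ->; rewrite integralZl//; last exact: lF.
by rewrite -EFin_laplace.
Qed.

Lemma laplaceable_parts F G : laplaceable F ->
  (forall s, 0 < s -> is_derive s 1 F (G s)) ->
  (forall s, 0 < s -> {for s, continuous G}) ->
  (forall s, 0 < s -> 0 <= G s) -> F s @[s --> 0^'+] --> 0 -> laplaceable G.
Proof.
move=> lF dF cG G0 F0; apply: laplaceable_lty => //.
  exact: continuous_measurable_gt0.
by move=> t t0; rewrite (laplace_parts lF t0 dF)// ltry.
Qed.

Lemma laplaceMparts F G t : laplaceable F -> 0 < t ->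
  (forall s, 0 < s -> is_derive s 1 F (G s)) ->
  (forall s, 0 < s -> {for s, continuous G}) ->
  (forall s, 0 < s -> 0 <= G s) -> F s @[s --> 0^'+] --> 0 ->
  t * laplace F t = laplace G t.
Proof.
move=> lF t0 dF cG G0 F0; apply: EFin_inj.
by rewrite -(laplace_parts lF t0 dF)// EFin_laplace//; exact: (laplaceable_parts lF).
Qed.

Lemma laplaceX n t : 0 < t -> laplace (fun u => u ^+ n) t = n`!%:R / t ^+ n.+1.
Proof.
move=> t0; elim: n => [|n IH].
  by rewrite (laplace_cst 1).
have := @laplaceMparts (fun u => u ^+ n.+1) (fun u => n.+1%:R * u ^+ n) t (laplaceableX n.+1) t0.
rewrite (laplaceZ n.+1%:R (laplaceableX n) t0) IH => P.
apply: (mulfI (lt0r_neq0 t0)); etransitivity; first apply: P; last first.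
- rewrite factS natrM [t ^+ n.+2]exprS; set x := t ^+ n.+1.
  by field; rewrite !gt_eqF// exprn_gt0.
- apply: cvg_at_right_filter; have := is_derive_continuous (is_derive1X n.+1 (is_derive1_id (0:R))).
  by rewrite /prop_for /continuous_at expr0n.
- by move=> s s0; rewrite mulr_ge0// exprn_ge0// ltW.
- by move=> s _; apply: is_derive_continuous; der.
- by move=> s _; eapply is_derive_eq; [der|cbv beta => /=; ring].
Qed.

Lemma laplace_cvg0 f C n : laplaceable f -> (forall u, 0 < u -> 0 <= f u <= C * u ^+ n) ->
  laplace f t @[t --> +oo] --> 0.
Proof.
move=> lf fC.
have C0 : 0 <= C by have /andP[f0] := fC 1 ltr01; rewrite expr1n mulr1; exact: le_trans.
apply: (@squeeze_cvgr _ _ _ _ (cst 0) (fun t => (C * n`!%:R) * t^-1)).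
- near=> t; have t1 : 1 <= t by near: t; exact: nbhs_pinfty_ge.
  have t0 : 0 < t := lt_le_trans ltr01 t1.
  apply/andP; split; first by apply: laplace_ge0 => u /fC/andP[].
  apply: (@le_trans _ _ (laplace (fun u => C * u ^+ n) t)).
    by apply: le_laplace => //; [exact/laplaceableZ/laplaceableX|move=> u /fC/andP[]].
  rewrite laplaceZ//; last exact: laplaceableX.
  rewrite laplaceX// -mulrA ler_wpM2l// ler_wpM2l//.
  by rewrite lef_pV2 ?posrE ?exprn_gt0// exprS ler_peMr ?exprn_ege1// ltW.
- exact: cvg_cst.
- rewrite -[X in _ --> X](mulr0 (C * n`!%:R)); apply: cvgMr.
  exact: cvgyV.
Unshelve. all: by end_near. Qed.

(** A vanishing transform would make the positive integrand zero almost everywhere, hence (0, +oo)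
    negligible, while its measure is infinite. *)
Lemma laplace_gt0 f t : laplaceable f -> 0 < t ->
  (forall u, 0 < u -> 0 < f u) -> 0 < laplace f t.
Proof.
move=> lf t0 f0; rewrite lt_neqAle eq_sym laplace_ge0 ?andbT; last first.
  by move=> u /f0/ltW.
apply/eqP => L0.
have : (\int[mu]_(u in D) `|(f u * expR (- (t * u)))%:E| = 0)%E.
  rewrite -[RHS](congr1 EFin L0) EFin_laplace//; apply: eq_integral => u.
  rewrite inE/= in_itv/= andbT => u0.
  by rewrite ger0_norm// mulr_ge0 ?expR_ge0// ltW// f0.
move/(ae_eq_integral_abs mu mD (measurable_laplace t (laplaceable_measurable lf))).
move=> /(@measure_negligible _ _ _ mu).
have -> : (~` [set u | D u -> (f u * expR (- (t * u)))%:E = cst 0%E u]) = D.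
  apply/seteqP; split=> u /=; first by move=> /not_implyP[].
  move=> uD; apply/not_implyP; split=> //=; move: uD; rewrite in_itv/= andbT => u0 [] /eqP.
  by rewrite mulf_eq0 expR_eq0 orbF gt_eqF// f0.
move=> h; have M : lebesgue_measure (`]0%R, +oo[%classic : set R) = +oo%E.
  by rewrite lebesgue_measure_itv/= ltry.
by have := etrans (esym M) (h mD).
Qed.

Lemma laplace_nneseries (f : nat -> R -> R) F t :
  (forall m, measurable_fun D (f m)) -> (forall m u, 0 < u -> 0 <= f m u) ->
  (forall u, 0 < u -> series (f ^~ u) n @[n --> \oo] --> F u) ->
  (\int[mu]_(u in D) (F u * expR (- (t * u)))%:E =
   \sum_(0 <= m <oo) \int[mu]_(u in D) (f m u * expR (- (t * u)))%:E)%E.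
Proof.
move=> mf f0 fF; rewrite -integral_nneseries//; last 2 first.
- by move=> n; exact: measurable_laplace.
- move=> n u /=; rewrite in_itv/= andbT => u0.
  by rewrite lee_fin mulr_ge0 ?expR_ge0 ?f0.
apply: eq_integral => u; rewrite inE/= in_itv/= andbT => u0.
apply/esym/cvg_lim => //; under eq_fun do rewrite sumEFin.
apply: cvg_EFin; first exact: nearW.
by under eq_fun do rewrite -mulr_suml; apply: cvgMl; exact: fF.
Qed.

End Laplace.

(** * Partial fractions of the hyperbolic cotangent *)

Lemma ge0_of_derive {R : realType} (f f' : R -> R) (x : R) : (forall y : R, 0 <= y -> is_derive y 1 f (f' y)) ->
  (forall y, 0 <= y -> 0 <= f' y) -> 0 <= f 0 -> 0 <= x -> 0 <= f x.
Proof.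
move=> df f'0 f0 x0; apply: le_trans f0 _.
have [y| |c] := @MVT_segment _ f f' _ _ x0.
- by rewrite in_itv/= => /andP[/ltW y0 _]; exact: df.
- apply: derivable_within_continuous => y; rewrite in_itv/= => /andP[y0 _].
  by have [] := df y y0.
by rewrite in_itv/= subr0 => /andP[c0 _] E; rewrite -subr_ge0 E mulr_ge0// f'0.
Qed.

Section Hyperbolic.
Context {R : realType}.
Implicit Types (x y z w : R).

Definition sinh x : R := (expR x - expR (- x)) / 2.
Definition cosh x : R := (expR x + expR (- x)) / 2.

Lemma is_derive_sinh x : is_derive x 1 sinh (cosh x).
Proof. by eapply is_derive_eq; [rewrite /sinh; der|cbv beta; rewrite /cosh; field]. Qed.

Lemma is_derive_cosh x : is_derive x 1 cosh (sinh x).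
Proof. by eapply is_derive_eq; [rewrite /cosh; der|cbv beta; rewrite /sinh; field]. Qed.

Hint Resolve is_derive_sinh is_derive_cosh is_derive_sin is_derive_cos : der.

Lemma sinh0 : sinh 0 = 0.
Proof. by rewrite /sinh oppr0 subrr mul0r. Qed.

Lemma cosh0 : cosh 0 = 1.
Proof. by rewrite /cosh oppr0 expR0; field. Qed.

Lemma cosh_gt0 x : 0 < cosh x.
Proof. by rewrite divr_gt0// addr_gt0// expR_gt0. Qed.

Lemma sinh_gt0 x : 0 < x -> 0 < sinh x.
Proof. by move=> x0; rewrite divr_gt0// subr_gt0 ltr_expR gtrN. Qed.

Lemma sinh_ge0 x : 0 <= x -> 0 <= sinh x.
Proof. by rewrite le_eqVlt => /predU1P[<-|/sinh_gt0/ltW//]; rewrite sinh0. Qed.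

Lemma cosh2Dsinh2 x : cosh x ^+ 2 = 1 + sinh x ^+ 2.
Proof. by rewrite /cosh /sinh expRN; field; rewrite gt_eqF ?expR_gt0. Qed.

Lemma cosh_ge1 x : 1 <= cosh x.
Proof.
rewrite -ler_sqr ?nnegrE ?(ltW (cosh_gt0 _))//.
by rewrite expr1n cosh2Dsinh2 lerDl sqr_ge0.
Qed.

Lemma sinhD x y : sinh (x + y) = sinh x * cosh y + cosh x * sinh y.
Proof. by rewrite /sinh /cosh opprD !expRD; field. Qed.

Lemma le_sinh x : 0 <= x -> x <= sinh x.
Proof.
move=> x0; rewrite -subr_ge0; apply: (@ge0_of_derive R (fun y => sinh y - y) (fun y => cosh y - 1)) => //.
- by move=> y _; eapply is_derive_eq; [der|].
- by move=> y _; rewrite subr_ge0 cosh_ge1.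
- by rewrite sinh0 subr0.
Qed.

Lemma le_cosh x y : 0 <= x -> x <= y -> cosh x <= cosh y.
Proof.
move=> x0 xy; rewrite -ler_sqr ?nnegrE ?(ltW (cosh_gt0 _))// !cosh2Dsinh2.
rewrite lerD2l ler_sqr ?nnegrE ?sinh_ge0// ?(le_trans x0)//.
by rewrite ler_pM2r// lerB// ler_expR// lerN2.
Qed.

Lemma sinh_le x : 0 <= x -> sinh x <= x * cosh x.
Proof.
move=> x0; rewrite -subr_ge0.
apply: (@ge0_of_derive R (fun y => y * cosh y - sinh y) (fun y => y * sinh y)) => //.
- by move=> y _; eapply is_derive_eq; [der|cbv beta; ring].
- by move=> y y0; rewrite mulr_ge0// sinh_ge0.
- by rewrite mul0r sinh0 subr0.
Qed.

(** sin x >= x - x^3/6, and x < 2 on this range gives x^2/6 <= 2/3. This crude form of Jordan's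
    inequality bounds the denominator of [coth2] from below. *)
Lemma sin_ge_third x : 0 <= x <= pi / 2 -> x / 3 <= sin x.
Proof.
move=> /andP[x0 xpi].
have x2 : x < 2 by apply: le_lt_trans xpi _; exact: pihalf_lt2.
have sin_le y : 0 <= y -> sin y <= y.
  move=> y0; rewrite -subr_ge0.
  apply: (@ge0_of_derive R (fun y => y - sin y) (fun y => 1 - cos y)) => //.
  by rewrite sin0 subr0.
have cos_ge y : 0 <= y -> 0 <= cos y - 1 + y ^+ 2 / 2.
  apply: (@ge0_of_derive R (fun y => cos y - 1 + y ^+ 2 / 2) (fun y => y - sin y)).
  - move=> z _; by eapply is_derive_eq; [der|cbv beta => /=; field].
  - by move=> z z0; rewrite subr_ge0 sin_le.
  - by rewrite cos0 expr0n/=; lra.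
have : 0 <= sin x - x + x ^+ 3 / 6.
  apply: (@ge0_of_derive R (fun y => sin y - y + y ^+ 3 / 6) (fun y => cos y - 1 + y ^+ 2 / 2)) => //.
  - move=> z _; by eapply is_derive_eq; [der|cbv beta => /=; field].
  - by rewrite sin0 expr0n/=; lra.
have : x ^+ 3 / 6 <= x * (2 / 3).
  rewrite exprS -mulrA ler_wpM2l//.
  have : x ^+ 2 <= 2 ^+ 2 by rewrite ler_sqr// ?nnegrE// ltW.
  lra.
lra.
Qed.

(* The real part of coth (z + i w). *)
Definition coth2 z w : R := sinh z * cosh z / (sinh z ^+ 2 + sin w ^+ 2).

(** Real part of coth(2 zeta) = (coth zeta + coth(zeta + i pi/2)) / 2 at zeta = (z + iw)/2; the
    second summand is tanh zeta. *)
Lemma coth2_duplication z w : 0 < z ->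
  coth2 z w = (coth2 (z / 2) (w / 2) + coth2 (z / 2) (w / 2 + pi / 2)) / 2.
Proof.
move=> z0; rewrite /coth2 sinDpihalf.
have [a [-> a0]] : exists a, z = a + a /\ 0 < a.
  by exists (z / 2); rewrite divr_gt0//; split=> //; field.
have [b ->] : exists b, w = b + b by exists (w / 2); field.
have -> : (a + a) / 2 = a by field.
have -> : (b + b) / 2 = b by field.
rewrite sinhD sinD.
have -> : cosh (a + a) = 1 + 2 * sinh a ^+ 2.
  by rewrite /cosh /sinh opprD !expRD expRN; field; rewrite gt_eqF ?expR_gt0.
have := cosh2Dsinh2 a; have := cos2Dsin2 b.
have := sinh_gt0 a0; have := cosh_gt0 a.
set s := sinh a; set c := cosh a; set p := sin b; set q := cos b => c0 s0 pq cs.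
have s20 : 0 < s ^+ 2 by rewrite exprn_gt0.
have n1 : s ^+ 2 + p ^+ 2 != 0 by rewrite gt_eqF// ltr_pwDl// sqr_ge0.
have n2 : s ^+ 2 + q ^+ 2 != 0 by rewrite gt_eqF// ltr_pwDl// sqr_ge0.
have E : (s * c + c * s) ^+ 2 + (p * q + q * p) ^+ 2 = 4 * ((s ^+ 2 + p ^+ 2) * (s ^+ 2 + q ^+ 2)).
  have -> : (s * c + c * s) ^+ 2 = 4 * s ^+ 2 * c ^+ 2 by ring.
  have -> : (p * q + q * p) ^+ 2 = 4 * p ^+ 2 * q ^+ 2 by ring.
  have -> : q ^+ 2 = 1 - p ^+ 2 by rewrite -pq; ring.
  by rewrite cs; ring.
rewrite E.
have <- : s ^+ 2 + p ^+ 2 + (s ^+ 2 + q ^+ 2) = 1 + 2 * s ^+ 2 by transitivity (2 * s ^+ 2 + (q ^+ 2 + p ^+ 2)); [ring|rewrite pq; ring].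
by field; rewrite n1 n2.
Qed.

(** The shift pi/2 of the duplication formula becomes an index shift: term j of level k splits into
    the terms j and j + 2^k of level k + 1. *)
Lemma coth2_iter z w k : 0 < z ->
  coth2 z w = 2 ^- k * \sum_(0 <= j < 2 ^ k) coth2 (z / 2 ^+ k) ((w + pi * j%:R) / 2 ^+ k).
Proof.
move=> z0; elim: k => [|k IH].
  by rewrite expn0 big_nat1 expr0 !divr1 mulr0 addr0 invr1 mul1r.
rewrite IH expnS mul2n -addnn [in RHS](@big_cat_nat _ _ _ (2 ^ k)%N)//=; last exact: leq_addr.
rewrite -{3}[(2 ^ k)%N]add0n big_addn addnK -big_split/= !mulr_sumr.
apply: eq_bigr => j _.
rewrite coth2_duplication; last by rewrite divr_gt0// exprn_gt0.
have e : (2 : R) ^+ k != 0 by rewrite gt_eqF// exprn_gt0.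
have -> : z / 2 ^+ k / 2 = z / 2 ^+ k.+1 by rewrite exprS; field.
have -> : (w + pi * j%:R) / 2 ^+ k / 2 = (w + pi * j%:R) / 2 ^+ k.+1 by rewrite exprS; field.
have -> : (w + pi * j%:R) / 2 ^+ k.+1 + pi / 2 = (w + pi * (j + 2 ^ k)%:R) / 2 ^+ k.+1.
  by rewrite natrD natrX exprS; field.
by rewrite exprS; field.
Qed.

Lemma coth2Dpi z w : coth2 z (w + pi) = coth2 z w.
Proof. by rewrite /coth2 sinDpi sqrrN. Qed.

Lemma coth2N z w : coth2 z (- w) = coth2 z w.
Proof. by rewrite /coth2 sinN sqrrN. Qed.

Lemma coth2_ge0 z w : 0 <= z -> 0 <= coth2 z w.
Proof.
move=> z0; rewrite divr_ge0 ?addr_ge0 ?sqr_ge0// mulr_ge0 ?sinh_ge0//.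
exact/ltW/cosh_gt0.
Qed.

End Hyperbolic.

#[local] Hint Resolve is_derive_sinh is_derive_cosh is_derive_sin is_derive_cos : der.

(** * Passage to the limit in the iterated duplication formula of coth *)

Section CothSeries.
Context {R : realType}.
Implicit Types (x y z w : R).

Lemma cvg_series_pointwise (A : nat -> nat -> R) (a : nat -> R) J :
  (forall j, A k j @[k --> \oo] --> a j) -> series (A k) J @[k --> \oo] --> series a J.
Proof.
move=> Aa; elim: J => [|J IH].
  rewrite /series/= big_geq//; under eq_fun do rewrite big_geq//.
  exact: cvg_cst.
rewrite /series/= big_nat_recr//=; under eq_fun do rewrite big_nat_recr//=.
exact: cvgD.
Qed.

(** Dominated convergence for sums of growing length. Nonnegativity keeps the partial sums of the
    limit below [L], and the tail bound, uniform in k, keeps them above L - T J. *)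
Lemma tannery (A : nat -> nat -> R) (a T : nat -> R) (n : nat -> nat) (L : R) :
  (forall k j, 0 <= A k j) -> (forall j, A k j @[k --> \oo] --> a j) ->
  series (A k) (n k) @[k --> \oo] --> L -> (forall J, \forall k \near \oo, (J <= n k)%N) ->
  (forall k J, \sum_(J.+1 <= j < n k) A k j <= T J) -> T J @[J --> \oo] --> 0 ->
  series a J @[J --> \oo] --> L.
Proof.
move=> A0 Aa AL nJ AT T0.
have sa J := @cvg_series_pointwise A a J Aa.
have H J : L - T J <= series a J.+1 <= L.
  apply/andP; split.
    rewrite lerBlDr.
    apply: (ler_cvg_to AL (cvgD (sa J.+1) (cvg_cst (T J)))).
    near=> k; have Jk : (J.+1 <= n k)%N by near: k; exact: nJ.
    rewrite /series/= (@big_cat_nat _ _ _ J.+1 0 (n k))//= lerD2l.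
    exact: AT.
  apply: (ler_cvg_to (sa J.+1) AL).
  near=> k; have Jk : (J.+1 <= n k)%N by near: k; exact: nJ.
  rewrite /series/= (@big_cat_nat _ _ _ J.+1 0 (n k))//= lerDl.
  by apply: sumr_ge0.
rewrite -cvg_shiftS; apply: (@squeeze_cvgr _ _ _ _ (fun J => L - T J) (cst L)).
- by apply: nearW => J; exact: H.
- by rewrite -[X in _ --> X]subr0; apply: cvgB => //; exact: cvg_cst.
- exact: cvg_cst.
Unshelve. all: by end_near. Qed.

Lemma big_nat_sym (g : nat -> R) M : (0 < M)%N ->
  (forall j, (j <= M + M)%N -> g (M + M - j)%N = g j) ->
  \sum_(0 <= j < M + M) g j = g 0%N + g M + 2 * \sum_(1 <= j < M) g j.
Proof.
move=> M0 gsym.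
rewrite (@big_cat_nat _ _ _ M)//=; last exact: leq_addr.
rewrite big_ltn// [X in _ + X]big_ltn; last by rewrite -[X in (X < _)%N]addn0 ltn_add2l.
have -> : \sum_(M.+1 <= j < M + M) g j = \sum_(1 <= j < M) g j.
  rewrite big_nat_rev/= -[M.+1]add1n big_addn addnK; apply: eq_big_nat => j /andP[j1 jM].
  have -> : (1 + M + (M + M) - (j + M).+1 = M + M - j)%N by lia.
  by rewrite gsym//; lia.
ring.
Qed.

Lemma is_derive0_cvg (f : R -> R) a : f 0 = 0 -> is_derive (0:R) 1 f a ->
  f y / y @[y --> (0:R)^'] --> a.
Proof.
move=> f0 [df <-].
have -> : (fun y => f y / y) = (fun h => h^-1 *: ((f \o shift 0) (h *: (1:R)) - f 0)).
  by apply/funext => y; rewrite /= f0 subr0 addr0 /GRing.scale/= mulr1 mulrC.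
exact: df.
Qed.

(** coth zeta ~ 1/zeta at 0, so with zeta = y(1 + il) the limit is Re 1/(1 + il). *)
Lemma cvg_coth2 l : y * coth2 y (l * y) @[y --> (0:R)^'] --> (1 + l ^+ 2)^-1.
Proof.
have cs : sinh y / y @[y --> (0:R)^'] --> (1:R).
  by rewrite -(@cosh0 R); apply: is_derive0_cvg; [exact: sinh0|exact: is_derive_sinh].
have cp : sin (l * y) / y @[y --> (0:R)^'] --> l.
  apply: (@is_derive0_cvg (fun y => sin (l * y))); first by rewrite mulr0 sin0.
  have d : is_derive (0:R) 1 (fun y => l * y) l by eapply is_derive_eq; [der|cbv beta; ring].
  have := is_derive1_comp (is_derive_sin (l * 0)) d.
  by rewrite mulr0 cos0 mul1r.
have cc : cosh y @[y --> (0:R)^'] --> (1:R).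
  by rewrite -(@cosh0 R); apply: cvg_within_filter; exact: is_derive_continuous (is_derive_cosh 0).
have n0 : 1 ^+ 2 + l ^+ 2 != 0 by rewrite gt_eqF// expr1n ltr_pwDl// sqr_ge0.
have : (sinh y / y) * cosh y / ((sinh y / y) ^+ 2 + (sin (l * y) / y) ^+ 2) @[y --> (0:R)^'] -->
    1 * 1 / (1 ^+ 2 + l ^+ 2).
  apply: cvgM; first exact: cvgM.
  apply: cvgV => //; apply: cvgD; rewrite expr2; under eq_fun do rewrite expr2; exact: cvgM.
rewrite expr1n !mul1r; apply: cvg_trans; apply: near_eq_cvg; near=> y.
have y0 : y != 0 by near: y; exact: nbhs_dnbhs_neq.
rewrite /coth2.
have -> : (sinh y / y) ^+ 2 + (sin (l * y) / y) ^+ 2 =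
    (sinh y ^+ 2 + sin (l * y) ^+ 2) / y ^+ 2 by field.
by rewrite invfM invrK; set q := (_ + _)^-1; field.
Unshelve. all: by end_near. Qed.

Lemma cvg_coth2_pihalf : y * coth2 y (pi / 2) @[y --> (0:R)^'] --> (0:R).
Proof.
have -> : (fun y => y * coth2 y (pi / 2)) =
    (fun y => y * (sinh y * cosh y / (sinh y ^+ 2 + 1))).
  by apply/funext => y; rewrite /coth2 sin_pihalf expr1n.
apply: cvg_within_filter.
have : {for 0, continuous (fun y : R => y * (sinh y * cosh y / (sinh y ^+ 2 + 1)))}.
  by eapply is_derive_continuous; der; rewrite gt_eqF// ltr_wpDl// sqr_ge0.
by rewrite /prop_for /continuous_at mul0r.
Qed.

(* The summands are paired as [j <-> 2 ^ k.+1 - j] in [coth2_iter], which leaves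
   twice the sum over [1 <= j < 2 ^ k] and the two self-paired terms. *)
Lemma coth2_paired z k : 0 < z -> let y := z / 2 ^+ k.+1 in
  \sum_(0 <= j < (2 ^ k).-1) 2 / z * (y * coth2 y (pi * j.+1%:R / z * y)) =
  coth2 z 0 - (y * coth2 y (0 * y)) / z - (y * coth2 y (pi / 2)) / z.
Proof.
move=> z0 y.
have e0 : (2 : R) ^+ k != 0 by rewrite gt_eqF// exprn_gt0.
have z0' : z != 0 by rewrite gt_eqF.
have yE : y = z / (2 * 2 ^+ k) by rewrite /y exprS.
have kgt0 : (0 < 2 ^ k)%N by rewrite expn_gt0.
pose g (j : nat) := coth2 y (pi * j%:R / 2 ^+ k.+1).
have gsym j : (j <= 2 ^ k + 2 ^ k)%N -> g (2 ^ k + 2 ^ k - j)%N = g j.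
  move=> jk; rewrite /g -coth2N -coth2Dpi; congr coth2.
  by rewrite natrB// natrD natrX exprS; field.
rewrite (@coth2_iter _ z 0 k.+1)// -/y expnS mul2n -addnn.
under [in RHS]eq_bigr do rewrite add0r.
rewrite (big_nat_sym kgt0 gsym) big_add1 mulr_sumr /g.
rewrite mul0r mulr0 mul0r.
have -> : pi * (2 ^ k)%:R / 2 ^+ k.+1 = pi / 2 :> R by rewrite natrX exprS; field.
rewrite mulrDr mulrDr.
have -> : y * coth2 y 0 / z = 2 ^- k.+1 * coth2 y 0 by rewrite yE exprS; set c := coth2 _ _; field; rewrite z0' e0.
have -> : y * coth2 y (pi / 2) / z = 2 ^- k.+1 * coth2 y (pi / 2).
  by rewrite yE exprS; set c := coth2 _ _; field; rewrite z0' e0.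
have -> : forall a b c : R, a + b + c - a - b = c by move=> a b c; ring.
rewrite mulr_sumr; apply: eq_bigr => j _.
have -> : pi * j.+1%:R / z * y = pi * j.+1%:R / 2 ^+ k.+1 by rewrite yE exprS; field; rewrite z0' e0.
by rewrite yE exprS; set c := coth2 _ _; field; rewrite z0' e0.
Qed.

(** The range of j keeps the angle t in [0, pi/2], so the denominator is at least (t/3)^2, while the
    numerator is at most y cosh^2 z. The powers of 2 in y and t cancel, which makes the bound
    uniform in k. *)
Lemma coth2_term_le z k (j : nat) : 0 < z -> (j < (2 ^ k).-1)%N ->
  2 / z * (z / 2 ^+ k.+1 * coth2 (z / 2 ^+ k.+1) (pi * j.+1%:R / z * (z / 2 ^+ k.+1))) <= 8 * z * cosh z ^+ 2 / j.+1%:R ^+ 2.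
Proof.
move=> z0 jk; set y := z / 2 ^+ k.+1; have jk' : (j.+1 <= 2 ^ k)%N by lia.
have e0 : (0 : R) < 2 ^+ k by rewrite exprn_gt0.
have yz : y <= z.
  by rewrite /y ler_pdivrMr ?exprn_gt0// ler_peMr ?(ltW z0)// exprn_ege1// ler1n.
have y0 : 0 < y by rewrite divr_gt0// exprn_gt0.
set t := pi * j.+1%:R / z * y.
have tE : t = pi * j.+1%:R / 2 ^+ k.+1 by rewrite /t /y; field; rewrite !gt_eqF// exprn_gt0.
have t0 : 0 < t by rewrite tE divr_gt0 ?exprn_gt0// mulr_gt0// pi_gt0.
have tpi : t <= pi / 2.
  have -> : pi / 2 = pi * 2 ^+ k / 2 ^+ k.+1 :> R by rewrite [2 ^+ k.+1]exprS; field; rewrite gt_eqF.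
  rewrite tE ler_pM2r ?invr_gt0 ?exprn_gt0// ler_pM2l ?pi_gt0//.
  by rewrite -natrX ler_nat.
have st : (t / 3) ^+ 2 <= sinh y ^+ 2 + sin t ^+ 2.
  rewrite -[leLHS]add0r lerD ?sqr_ge0// ler_sqr ?nnegrE ?sin_ge_third ?(ltW t0)//.
    by rewrite divr_ge0// ltW.
  by rewrite sin_ge0_pi// (ltW t0)/=; have := @pi_gt0 R; move: tpi; lra.
have t3 : 0 < (t / 3) ^+ 2 by rewrite exprn_gt0// divr_gt0.
have h : coth2 y t <= y * cosh z ^+ 2 / (t / 3) ^+ 2.
  rewrite /coth2 ler_pM ?invr_ge0 ?addr_ge0 ?sqr_ge0//.
  - by rewrite mulr_ge0 ?sinh_ge0 ?ltW ?cosh_gt0.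
  - have := sinh_le (ltW y0); have := le_cosh (ltW y0) yz.
    have c0 := cosh_gt0 y => cyz sy.
    rewrite expr2 mulrA; apply: ler_pM => //; [exact: sinh_ge0 (ltW y0)|exact: ltW|].
    by apply: le_trans sy _; rewrite ler_wpM2l// ltW.
  - by rewrite lef_pV2 ?posrE ?(lt_le_trans t3).
have d0 : 0 < 2 / z * y by rewrite mulr_gt0// divr_gt0.
rewrite mulrA; apply: (@le_trans _ _ (2 / z * y * (y * cosh z ^+ 2 / (t / 3) ^+ 2))).
  by rewrite ler_wpM2l// ltW.
have -> : 2 / z * y * (y * cosh z ^+ 2 / (t / 3) ^+ 2) =
    (18 / pi ^+ 2) * (z * cosh z ^+ 2 / j.+1%:R ^+ 2).
  have n0 : 0 < j.+1%:R :> R by [].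
  have p0 := @pi_gt0 R; rewrite /t; move: y0 n0 p0 z0.
  move: (cosh z) (pi : R) (j.+1%:R : R) (y : R) => c p n x x0 n0 p0 z0.
  by field; rewrite !gt_eqF.
have -> : 8 * z * cosh z ^+ 2 / j.+1%:R ^+ 2 = 8 * (z * cosh z ^+ 2 / j.+1%:R ^+ 2) by rewrite !mulrA.
rewrite ler_wpM2r//.
  by rewrite divr_ge0 ?sqr_ge0// mulr_ge0 ?sqr_ge0// ltW.
(* 18 is 2 times 3^2, and pi >= 2 already gives 18/pi^2 <= 8. *)
rewrite ler_pdivrMr ?exprn_gt0 ?pi_gt0//.
have : (2 : R) ^+ 2 <= pi ^+ 2 by rewrite ler_sqr ?nnegrE ?pi_ge2 ?pi_ge0.
lra.
Qed.

Lemma sum_inv_sqr_le m n : \sum_(m.+1 <= j < n) j.+1%:R ^- 2 <= m.+1%:R^-1 :> R.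
Proof.
have [mn|nm] := leqP m.+1 n; last by rewrite big_geq// ltnW.
(* 1/(j+1)^2 <= 1/j - 1/(j+1) telescopes; keeping the term -1/n makes the induction on n
   possible. *)
suff : \sum_(m.+1 <= j < n) j.+1%:R ^- 2 <= m.+1%:R^-1 - n%:R^-1 :> R.
  by move=> h; apply: le_trans h _; rewrite gerBl.
elim: n mn => // n IH; rewrite leq_eqVlt => /predU1P[[<-]|mn].
  by rewrite big_geq// subrr.
rewrite big_nat_recr//=; have n0 : (0 < n)%N by lia.
apply: le_trans (lerD (IH _) (lexx _)) _; first by lia.
rewrite -addrA lerD2l addrC -lerBrDr.
have np : 0 < n%:R :> R by rewrite ltr0n.
have -> : - n.+1%:R^-1 - - n%:R^-1 = (n%:R * n.+1%:R)^-1 :> R.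
  by rewrite -natr1; field; rewrite !gt_eqF// natr1 ltr0n.
rewrite lef_pV2 ?posrE ?mulr_gt0 ?exprn_gt0 ?ltr0n// expr2 ler_wpM2r//.
by rewrite ler_nat.
Qed.

Lemma coth_series z : 0 < z ->
  series (fun j => 2 * z / (z ^+ 2 + (pi * j.+1%:R) ^+ 2)) n @[n --> \oo] -->
  coth2 z 0 - z^-1.
Proof.
move=> z0; have z0' : z != 0 by rewrite gt_eqF.
pose y k := z / 2 ^+ k.+1.
have y0 k : 0 < y k by rewrite divr_gt0// exprn_gt0.
have cy : y k @[k --> \oo] --> (0:R).
  rewrite -(mulr0 z); apply: cvgMr.
  have := @cvg_geometric R 1 2^-1; rewrite ger0_norm// invf_lt1// ltr1n => /(_ isT).
  rewrite -cvg_shiftS; apply: cvg_trans; apply: near_eq_cvg; apply: nearW => k.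
  by rewrite /geometric/= mul1r exprVn.
have Y (f : R -> R) (a : R) : f x @[x --> (0:R)^'] --> a -> f (y k) @[k --> \oo] --> a.
  by move=> /cvgr_dnbhsP; apply; split=> // k; rewrite gt_eqF.
apply: (@tannery (fun k j => 2 / z * (y k * coth2 (y k) (pi * j.+1%:R / z * y k)))
  _ (fun J => 8 * z * cosh z ^+ 2 * J.+1%:R^-1) (fun k => (2 ^ k).-1)).
- by move=> k j; rewrite mulr_ge0 ?divr_ge0 ?(ltW z0)// mulr_ge0 ?coth2_ge0 ?ltW.
- move=> j; have -> : 2 * z / (z ^+ 2 + (pi * j.+1%:R) ^+ 2) =
      2 / z * (1 + (pi * j.+1%:R / z) ^+ 2)^-1.
    have p : 0 < z ^+ 2 + (pi * j.+1%:R) ^+ 2 by rewrite ltr_pwDl ?exprn_gt0 ?sqr_ge0.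
    have -> : 1 + (pi * j.+1%:R / z) ^+ 2 = (z ^+ 2 + (pi * j.+1%:R) ^+ 2) / z ^+ 2 by field.
    by rewrite invfM invrK; move: p; set q := (_ + _) => p; field; rewrite z0' gt_eqF.
  by apply: cvgMr; apply: (Y (fun y => y * coth2 y (pi * j.+1%:R / z * y))); exact: cvg_coth2.
(* The term j = 0 accounts for 1/z in the limit, because y coth y -> 1; the self-paired middle term
   at pi/2 contributes nothing. *)
- have -> : coth2 z 0 - z^-1 = coth2 z 0 - (1 + 0 ^+ 2)^-1 / z - 0 / z.
    by rewrite expr0n/= addr0 invr1 mul1r mul0r subr0.
  rewrite /series/=; under eq_fun do rewrite coth2_paired//.
  apply: cvgB; first (apply: cvgB; first exact: cvg_cst).
    by apply: cvgMl; apply: (Y (fun y => y * coth2 y (0 * y))); exact: cvg_coth2.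
  by apply: cvgMl; apply: (Y (fun y => y * coth2 y (pi / 2))); exact: cvg_coth2_pihalf.
- move=> J; near=> k; have := ltn_expl k (isT : (1 < 2)%N).
  have : (J <= k)%N by near: k; exact: nbhs_infty_ge.
  lia.
- move=> k J; apply: (@le_trans _ _ (\sum_(J.+1 <= j < (2 ^ k).-1)
      8 * z * cosh z ^+ 2 * j.+1%:R ^- 2)).
    by apply: ler_sum_nat => j /andP[_ jk]; exact: coth2_term_le.
  rewrite -mulr_sumr ler_wpM2l ?sum_inv_sqr_le// mulr_ge0 ?sqr_ge0// mulr_ge0//.
  exact: ltW.
- rewrite -[X in _ --> X](mulr0 (8 * z * cosh z ^+ 2)); apply: cvgMr.
  exact: cvg_harmonic.
Unshelve. all: by end_near. Qed.

End CothSeries.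

(** * The kernel of Binet's formula *)

Section BinetKernel.
Context {R : realType}.
Implicit Types (t u z c : R).

Definition binet_kernel u : R := (expR u - 1)^-1 - u^-1 + 1 / 2.

Definition pole (m : nat) : R := 2 * pi * m.+1%:R.

Lemma pole_gt0 m : 0 < pole m.
Proof. by rewrite !mulr_gt0 ?pi_gt0. Qed.

Lemma pole_ge m : m.+1%:R <= pole m.
Proof. by rewrite ler_peMl//; have := @pi_ge2 R; lra. Qed.

Lemma sqrD_gt0 u c : 0 < c -> 0 < u ^+ 2 + c ^+ 2.
Proof. by move=> c0; rewrite ltr_wpDl ?sqr_ge0 ?exprn_gt0. Qed.

(** coth(u/2) = 1 + 2/(e^u - 1), so coth(u/2) - 2/u is twice the kernel, and the series is that of
    coth at z = u/2. *)
Lemma cvg_binet_kernel u : 0 < u ->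
  series (fun m => 2 * u / (u ^+ 2 + pole m ^+ 2)) n @[n --> \oo] --> binet_kernel u.
Proof.
move=> u0.
have e1 : 1 < expR u by rewrite expR_gt1.
have := coth_series (divr_gt0 u0 (ltr0n _ 2)).
have -> : coth2 (u / 2) 0 - (u / 2)^-1 = 2 * binet_kernel u.
  have E : expR u = expR (u / 2) ^+ 2 by rewrite expr2 -expRD; congr expR; field.
  have v1 : 1 < expR (u / 2) by rewrite expR_gt1 divr_gt0.
  rewrite /coth2 /sinh /cosh sin0 expr0n/= addr0 /binet_kernel E expRN.
  move: (expR (u / 2)) v1 => v v1.
  have n1 : v ^+ 2 - 1 != 0 by rewrite subr_eq0 gt_eqF// exprn_egt1.
  have n2 : v != 0 by rewrite gt_eqF// (lt_trans ltr01).
  have n3 : u != 0 by rewrite gt_eqF.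
  by field; rewrite n1 n2 n3.
move=> /(cvgMr (a := 2^-1)); rewrite mulKf//; apply: cvg_trans.
apply: near_eq_cvg; apply: nearW => n.
rewrite /series/= mulr_sumr; apply: eq_bigr => m _; rewrite /pole.
have := sqrD_gt0 u (pole_gt0 m); rewrite /pole => p0.
have -> : (u / 2) ^+ 2 + (pi * m.+1%:R) ^+ 2 = (u ^+ 2 + (2 * pi * m.+1%:R) ^+ 2) / 4 by field.
by set q := (_ + _); rewrite invfM invrK; field; rewrite gt_eqF.
Qed.

Definition atom n c u : R := 2 * u ^+ (2 * n).+1 / (c ^+ (2 * n) * (u ^+ 2 + c ^+ 2)).

Lemma atom_ge0 n c u : 0 < c -> 0 < u -> 0 <= atom n c u.
Proof.
move=> c0 u0; rewrite divr_ge0 ?mulr_ge0 ?exprn_ge0 ?(ltW c0) ?(ltW u0)//.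
exact/ltW/sqrD_gt0.
Qed.

Lemma atomS n c u : 0 < c ->
  atom n.+1 c u = 2 * c ^- (2 * n.+1) * u ^+ (2 * n).+1 - atom n c u.
Proof.
move=> c0; rewrite /atom; have := sqrD_gt0 u c0 => p.
have -> : (2 * n.+1 = (2 * n).+2)%N by lia.
rewrite !exprS; move: (u ^+ (2 * n)) => U.
have : 0 < c ^+ (2 * n) by rewrite exprn_gt0.
move: (c ^+ (2 * n)) => C C0; rewrite !expr0 !mulr1.
have q : c * c + u * u != 0 by rewrite gt_eqF// addrC -!expr2.
by field; rewrite !gt_eqF// addrC -!expr2.
Qed.

Lemma atom_expansion n c u : 0 < c ->
  2 * u / (u ^+ 2 + c ^+ 2) =
  \sum_(1 <= k < n.+1) (-1) ^+ k.-1 * 2 * c ^- (2 * k) * u ^+ (2 * k).-1 + (-1) ^+ n * atom n c u.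
Proof.
move=> c0; elim: n => [|n IH].
  by rewrite big_geq// /atom muln0 !expr0 mul1r add0r !mul1r.
have e : ((2 * n.+1).-1 = (2 * n).+1)%N by lia.
rewrite IH [in RHS]big_nat_recr//; cbv beta; rewrite e /= atomS//.
rewrite [(-1) ^+ n.+1]exprS -addrA; congr (_ + _).
move: (c ^+ (2 * n.+1)) (u ^+ (2 * n).+1) ((-1) ^+ n) (atom n c u) => C U s a.
ring.
Qed.

Lemma atom_le n c u : 0 < c -> 0 < u -> atom n c u <= 2 * c ^- (2 * n.+1) * u ^+ (2 * n).+1.
Proof. by move=> c0 u0; rewrite -subr_ge0 -atomS// atom_ge0. Qed.

Lemma is_cvg_inv_pole_sum k : (0 < k)%N -> cvgn (series (fun m => pole m ^- (2 * k))).
Proof.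
move=> k0.
have h m : 0 <= pole m ^- (2 * k) by rewrite invr_ge0 exprn_ge0// ltW// pole_gt0.
apply: nondecreasing_is_cvgn.
  by apply: nondecreasing_series => m _ _; exact: h.
exists (1 + 1) => _ [n _ <-]; rewrite /series/=.
apply: (@le_trans _ _ (\sum_(0 <= m < n) m.+1%:R ^- 2)).
  apply: ler_sum => m _.
  have m1 : (1:R) <= m.+1%:R by rewrite ler1n.
  have p1 := le_trans m1 (pole_ge m).
  rewrite lef_pV2 ?posrE ?exprn_gt0 ?pole_gt0//.
  apply: (@le_trans _ _ (pole m ^+ 2)); first by rewrite ler_sqr ?nnegrE ?pole_ge// ltW// pole_gt0.
  by apply: ler_weXn2l => //; lia.
case: n => [|n]; first by rewrite big_geq.
rewrite big_ltn// expr1n invr1 lerD2l.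
by have := @sum_inv_sqr_le R 0 n.+1; rewrite invr1.
Qed.

(** This is zeta(2k)/(2 pi)^(2k). That [kernel_coef k] equals B_2k/(2k)! is therefore Euler's
    formula for zeta(2k), obtained in [is_bernoulli_coef]. *)
Definition inv_pole_sum k : R := limn (series (fun m => pole m ^- (2 * k))).

Lemma cvg_inv_pole_sum k : (0 < k)%N ->
  series (fun m => pole m ^- (2 * k)) n @[n --> \oo] --> inv_pole_sum k.
Proof. by move=> k0; exact: is_cvg_inv_pole_sum. Qed.

Definition kernel_coef k : R := (-1) ^+ k.-1 * 2 * inv_pole_sum k.

Definition kernel_rem n u : R :=
  (-1) ^+ n * (binet_kernel u - \sum_(1 <= k < n.+1) kernel_coef k * u ^+ (2 * k).-1).

(* [(-1) ^ n * kernel_rem n] is the remainder of order n of the power series of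
   [binet_kernel]; the alternating signs of the geometric expansion of
   1 / (u^2 + c^2) make each [kernel_rem n] a sum of nonnegative atoms. *)
Lemma cvg_kernel_rem n u : 0 < u ->
  series (fun m => atom n (pole m) u) N @[N --> \oo] --> kernel_rem n u.
Proof.
move=> u0.
have H : (-1) ^+ n * (series (fun m => 2 * u / (u ^+ 2 + pole m ^+ 2)) N -
    \sum_(1 <= k < n.+1) (-1) ^+ k.-1 * 2 * series (fun m => pole m ^- (2 * k)) N * u ^+ (2 * k).-1)
   @[N --> \oo] --> kernel_rem n u.
  apply: cvgMr; apply: cvgB; first exact: cvg_binet_kernel.
  elim: n => [|n IH].
    by rewrite big_geq//; under eq_fun do rewrite big_geq//; exact: cvg_cst.
  rewrite big_nat_recr//=; under eq_fun do rewrite big_nat_recr//=.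
  by apply: cvgD => //; apply: cvgMl; apply: cvgMr; exact: cvg_inv_pole_sum.
apply: cvg_trans H; apply: near_eq_cvg; apply: nearW => N.
rewrite /series/=.
have -> : \sum_(1 <= k < n.+1) (-1) ^+ k.-1 * 2 * (\sum_(0 <= m < N) pole m ^- (2 * k)) * u ^+ (2 * k).-1
  = \sum_(0 <= m < N) \sum_(1 <= k < n.+1) (-1) ^+ k.-1 * 2 * pole m ^- (2 * k) * u ^+ (2 * k).-1.
  rewrite exchange_big; apply: eq_bigr => k _.
  by rewrite mulr_sumr mulr_suml.
rewrite -sumrB mulr_sumr; apply: eq_bigr => m _.
rewrite (atom_expansion n u (pole_gt0 m)) addrAC subrr add0r mulrA -exprMn mulrNN mulr1 expr1n mul1r//.
Qed.

Lemma kernel_rem_gt0 n u : 0 < u -> 0 < kernel_rem n u.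
Proof.
move=> u0; apply: (@lt_le_trans _ _ (atom n (pole 0) u)).
  rewrite divr_gt0 ?mulr_gt0 ?exprn_gt0 ?pole_gt0//.
  exact: sqrD_gt0 (pole_gt0 0).
have h := @cvg_kernel_rem n _ u0.
apply: (ler_cvg_to (f := fun=> atom n (pole 0) u) _ h); first exact: cvg_cst.
near=> N; have N0 : (0 < N)%N by near: N; exact: nbhs_infty_gt.
rewrite /series/= big_ltn// lerDl; apply: sumr_ge0 => m _.
exact: atom_ge0 (pole_gt0 m) u0.
Unshelve. all: by end_near. Qed.

Lemma kernel_rem_ge0 n u : 0 < u -> 0 <= kernel_rem n u.
Proof.
by move=> /(kernel_rem_gt0 n)/ltW.
Qed.

Lemma kernel_remS n u : kernel_rem n.+1 u =
  2 * inv_pole_sum n.+1 * u ^+ (2 * n).+1 - kernel_rem n u.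
Proof.
have e : ((2 * n.+1).-1 = (2 * n).+1)%N by lia.
rewrite /kernel_rem [in LHS]big_nat_recr//; cbv beta; rewrite e /kernel_coef /=.
have s : (-1) ^+ n.+1 * (-1) ^+ n = -1 :> R.
  by rewrite -exprD addSn addnn -mul2n exprS exprM sqrrN expr1n expr1n mulr1.
rewrite opprD addrA mulrDr mulrN !mulrA s [(-1) ^+ n.+1]exprS; ring.
Qed.

(** Consecutive remainders add up to a monomial and both are nonnegative: the alternating expansion
    envelops the kernel. *)
Lemma kernel_rem_le n u : 0 < u ->
  kernel_rem n u <= 2 * inv_pole_sum n.+1 * u ^+ (2 * n).+1.
Proof. by move=> u0; rewrite -subr_ge0 -kernel_remS kernel_rem_ge0. Qed.


(** Uniqueness of asymptotic expansions at 0+. Letting z tend to 0 kills the constant coefficient;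
    dividing by z then lowers N. *)
Lemma poly_small N (d : nat -> R) C e : 0 < e ->
  (forall z, 0 < z < e -> `|\sum_(0 <= i < N) d i * z ^+ i| <= C * z ^+ N) ->
  forall i, (i < N)%N -> d i = 0.
Proof.
move=> e0; elim: N d => // N IH d H.
have E z : \sum_(0 <= i < N.+1) d i * z ^+ i = d 0%N + z * \sum_(0 <= i < N) d i.+1 * z ^+ i.
  rewrite big_nat_recl// mulr1; congr (_ + _); rewrite mulr_sumr.
  by apply: eq_bigr => i _; rewrite exprS mulrCA.
have d0 : d 0%N = 0.
  apply/eqP; rewrite -normr_le0.
  pose K := `|C| * e ^+ N + \sum_(0 <= i < N) `|d i.+1| * e ^+ i.
  have Kz z : 0 < z < e -> `|d 0%N| <= z * K.
    move=> /andP[z0 ze]; have := H z; rewrite z0 ze E => /(_ isT) h.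
    rewrite -[d 0%N](addrK (z * \sum_(0 <= i < N) d i.+1 * z ^+ i)).
    rewrite mulrDr; apply: le_trans (ler_normB _ _) _; apply: lerD.
      apply: le_trans h _; rewrite exprS mulrCA ler_wpM2l ?(ltW z0)//.
      apply: (@le_trans _ _ (`|C| * z ^+ N)); first by rewrite ler_wpM2r ?ler_norm ?exprn_ge0// ltW.
      by rewrite ler_wpM2l// lerXn2r ?nnegrE ?(ltW z0) ?(ltW e0)// ltW.
    rewrite normrM gtr0_norm// ler_wpM2l ?(ltW z0)//.
    apply: le_trans (ler_norm_sum _ _ _) _; apply: ler_sum => i _.
    rewrite normrM ler_wpM2l// normrX gtr0_norm//.
    by rewrite lerXn2r ?nnegrE ?(ltW z0) ?(ltW e0)// ltW.
  have K0 : z * K @[z --> (0:R)^'+] --> (0:R).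
    rewrite -[X in _ --> X](mul0r K); apply: cvgMl.
    by apply: cvg_at_right_filter; exact: cvg_id.
  apply: (ler_cvg_to (f := fun=> `|d 0%N|) _ K0); first exact: cvg_cst.
  near=> z; apply: Kz; apply/andP; split.
    by near: z; exact: nbhs_right_gt.
  by near: z; exact: nbhs_right_lt.
case=> // i; rewrite ltnS; apply: (IH (fun j => d j.+1)) => z z0e.
have z0 : 0 < z by case/andP: z0e.
rewrite -(ler_pM2l z0); apply: le_trans _ (_ : C * z ^+ N.+1 <= _); last by rewrite exprS mulrCA.
by rewrite -{1}(gtr0_norm z0) -normrM -[z * _]add0r -{1}d0 -E H.
Unshelve. all: by end_near. Qed.

Lemma sum_geometric_le (q : R) m n : 0 <= q <= 1/2 ->
  \sum_(m <= i < n) q ^+ i <= 2 * q ^+ m.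
Proof.
move=> /andP[q0 q1]; have [mn|nm] := leqP m n; last first.
  by rewrite big_geq ?mulr_ge0 ?exprn_ge0// ltnW.
rewrite -{1}[m]add0n big_addn.
under eq_bigr do rewrite exprD.
rewrite -mulr_suml ler_wpM2r ?exprn_ge0// big_mkord.
set S := \sum_(i < _) _.
have : (1 - q) * S <= 1.
  by rewrite -opprB mulNr -subrX1 opprB gerBl exprn_ge0.
have S0 : 0 <= S by apply: sumr_ge0 => i _; rewrite exprn_ge0.
have : (1 - q) * S >= 1/2 * S by rewrite ler_wpM2r//; lra.
lra.
Qed.

(* Both sides are the coefficients of two asymptotic expansions at 0+ of the same
   function z / (e^z - 1). *)
Lemma is_bernoulli_coef (B : nat -> R) k : is_bernoulli B -> (0 < k)%N ->
  B (2 * k)%N / (2 * k)`!%:R = kernel_coef k.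
Proof.
move=> hB k0.
pose a n := B n / n`!%:R.
have aE z : 0 < z < 1 -> series (fun n => a n * z ^+ n) n @[n --> \oo] --> z / (expR z - 1).
  move=> /andP[z0 z1]; have := hB z; rewrite gt_eqF// => /(_ isT).
  rewrite gtr0_norm// => /(_ _).
  have : z < 2 * pi by have := @pi_ge2 R; lra.
  move=> h /(_ h); apply: cvg_trans; apply: near_eq_cvg; apply: nearW => n.
  by apply: eq_bigr => i _; rewrite /a; ring.
(* Convergence at z = 1/2 bounds the terms a_n 2^-n. *)
have [M M0 Ma] : exists2 M, 0 <= M & forall n, `|a n| <= M * 2 ^+ n.
  have h2 : 0 < (2^-1 : R) < 1 by lra.
  have /cvgP/cvg_seq_bounded[M [_ Mb]] := cvg_series_cvg_0 (cvgP _ (aE _ h2)).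
  exists (`|M| + 1) => [|n]; first by rewrite addr_ge0.
  have := Mb (`|M| + 1) _ n I; rewrite (le_lt_trans (ler_norm _)) ?ltrDl// => /(_ isT).
  by rewrite /= normrM normrX normfV [`|2|]gtr0_norm// exprVn ler_pdivrMr ?exprn_gt0.
(* 2k + 2 is the order at 0 of the remainder z [kernel_rem k z]. The coefficients [b] below are
   those of z/(e^z - 1) = 1 - z/2 + z [binet_kernel z]. *)
pose N := (2 * k).+2.
pose b n : R := match n with 0 => 1 | 1 => - 2^-1 | _ => if odd n then 0 else kernel_coef n./2 end.
suff /(_ (2 * k)%N) : forall i, (i < N)%N -> a i - b i = 0.
  rewrite /N => /(_ _)/eqP; rewrite subr_eq0 => h.
  rewrite -/(a _) (eqP (h _))//.
  rewrite /b; case: k {hB N h} k0 => // k _.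
  by rewrite mul2n doubleS/= odd_double/= doubleK.
have bE z : \sum_(0 <= i < N) b i * z ^+ i = 1 - z / 2 +
    \sum_(1 <= j < k.+1) kernel_coef j * z ^+ (2 * j).
  rewrite /N; elim: {hB N k0} k => [|k IH].
    rewrite muln0 [in RHS]big_geq// big_nat_recr//= big_nat1/=; ring.
  have be1 : b (2 * k).+2 = kernel_coef k.+1 by rewrite /b mul2n -doubleS odd_double doubleK.
  have be2 : b (2 * k).+3 = 0 by rewrite /b mul2n -doubleS/= odd_double.
  have -> : ((2 * k.+1).+2 = (2 * k).+4)%N by lia.
  have e2 : (2 * k.+1 = (2 * k).+2)%N by lia.
  rewrite [in RHS]big_nat_recr//; cbv beta; rewrite e2 [LHS]big_nat_recr// [in LHS]big_nat_recr//.
  by cbv beta; rewrite be1 be2 IH/= mul0r addr0 addrA.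
(* Below 1/4 the ratio 2z of the geometric majorant of the Bernoulli tail is at most 1/2. *)
apply: (@poly_small N _ (2 * M * 2 ^+ N + 2 * inv_pole_sum k.+1) (1/4)) => //.
move=> z /andP[z0 z4].
have z01 : 0 < z < 1 by lra.
rewrite (eq_bigr (fun i => a i * z ^+ i - b i * z ^+ i)); last by move=> i _; rewrite mulrBl.
rewrite sumrB bE mulrDl.
have -> : \sum_(0 <= i < N) a i * z ^+ i - (1 - z / 2 + \sum_(1 <= j < k.+1) kernel_coef j * z ^+ (2 * j)) =
  (\sum_(0 <= i < N) a i * z ^+ i - z / (expR z - 1)) + (-1) ^+ k * (z * kernel_rem k z).
  suff -> : (-1) ^+ k * (z * kernel_rem k z) =
      z / (expR z - 1) - (1 - z / 2 + \sum_(1 <= j < k.+1) kernel_coef j * z ^+ (2 * j)) by ring.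
  have <- : \sum_(1 <= i < k.+1) z * (kernel_coef i * z ^+ (2 * i).-1) =
            \sum_(1 <= j < k.+1) kernel_coef j * z ^+ (2 * j).
    by apply: eq_big_nat => j /andP[j1 _]; rewrite mulrCA -exprS prednK//; lia.
  rewrite -mulr_sumr /kernel_rem; set S := \sum_(_ <= _ < _) _.
  rewrite mulrCA [X in _ * X]mulrA -exprMn mulrNN mulr1 expr1n mul1r.
  have e1 : expR z - 1 != 0 by rewrite subr_eq0 gt_eqF// expR_gt1.
  by rewrite /binet_kernel; field; rewrite e1 gt_eqF.
apply: le_trans (ler_normD _ _) _; apply: lerD.
  rewrite distrC.
  have h : series (fun n => a n * z ^+ n) m - \sum_(0 <= i < N) a i * z ^+ i @[m --> \oo] -->
     z / (expR z - 1) - \sum_(0 <= i < N) a i * z ^+ i.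
    by apply: cvgB; [exact: aE|exact: cvg_cst].
  apply: (ler_cvg_to (g := fun=> 2 * M * 2 ^+ N * z ^+ N) (cvg_norm h)); first exact: cvg_cst.
  near=> m; have mN : (N <= m)%N by near: m; exact: nbhs_infty_ge.
  rewrite /series/= (@big_cat_nat _ _ _ N 0 m)//= addrAC subrr add0r.
  apply: le_trans (ler_norm_sum _ _ _) _.
  apply: (@le_trans _ _ (\sum_(N <= i < m) M * (2 * z) ^+ i)).
    apply: ler_sum => i _; rewrite normrM exprMn mulrA.
    by rewrite normrX (gtr0_norm z0) ler_wpM2r ?exprn_ge0// ltW.
  rewrite -mulr_sumr; apply: le_trans (ler_wpM2l M0 (sum_geometric_le _ _ _)) _; first by lra.
  by rewrite exprMn; lra.
rewrite normrM normrX normrN1 expr1n mul1r ger0_norm; last first.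
  by rewrite mulr_ge0 ?kernel_rem_ge0// ltW.
rewrite /N [z ^+ _.+2]exprS [leRHS]mulrCA; apply: ler_wpM2l; first exact: ltW.
exact: kernel_rem_le.
Unshelve. all: by end_near. Qed.

End BinetKernel.

(** * Laplace transforms of the partial fractions *)

Section Atoms.
Context {R : realType}.
Notation D := (`]0%R, +oo[%classic : set R).
Implicit Types (t u c M : R).

(** Trades the sign condition on the derivative for a bound: adding Ms to [F] makes the derivative G
    + M >= 0, and the extra term M/t cancels. *)
Lemma laplaceMparts_bounded (F G : R -> R) M t : 0 < t ->
  (forall s : R, is_derive s 1 F (G s)) -> (forall s, {for s, continuous G}) ->
  (forall s, 0 < s -> `|G s| <= M) -> F 0 = 0 -> laplaceable F -> laplaceable G ->
  t * laplace F t = laplace G t.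
Proof.
move=> t0 dF cG GM F0 lF lG.
have lM : laplaceable (fun s => M * s).
  by have -> : (fun s => M * s) = (fun s => M * s ^+ 1) by []; exact/laplaceableZ/laplaceableX.
have lFM : laplaceable (fun s => F s + M * s) by exact: laplaceableD.
have := @laplaceMparts _ (fun s => F s + M * s) (fun s => G s + M) t lFM t0.
rewrite (laplaceD lF lM t0) (laplaceD lG (laplaceable_cst M) t0) laplace_cst//.
have -> : laplace (fun s => M * s) t = M / t ^+ 2.
  have -> : (fun s => M * s) = (fun s => M * s ^+ 1) by [].
  by rewrite (laplaceZ M (laplaceableX 1) t0) laplaceX// mul1r.
have -> : t * (laplace F t + M / t ^+ 2) = t * laplace F t + M / t by field; rewrite gt_eqF.
move=> h; apply: (addIr (M / t)); apply: h.
- by move=> s _; eapply is_derive_eq; [der; exact: dF|cbv beta; ring].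
- by move=> s _; apply: continuous1D => //; exact: cvg_cst.
- by move=> s /GM; rewrite ler_norml => /andP[h _]; lra.
- apply: cvg_at_right_filter.
  have : {for 0, continuous (fun s => F s + M * s)}.
    by eapply is_derive_continuous; der; exact: dF.
  by rewrite /prop_for/continuous_at F0 mulr0 addr0.
Qed.

(* [cpow c j u = (x, y)] with (u + ic)^-(j+1) = x - iy. *)
Fixpoint cpow c (j : nat) u : R * R :=
  let d := u ^+ 2 + c ^+ 2 in
  if j is j'.+1 then
    let: (x, y) := cpow c j' u in (x * (u / d) - y * (c / d), x * (c / d) + y * (u / d))
  else (u / d, c / d).

Lemma is_derive_cpow c j u : 0 < c ->
  is_derive u 1 (fun u => (cpow c j u).1) (- (j.+1%:R * (cpow c j.+1 u).1)) /\
  is_derive u 1 (fun u => (cpow c j u).2) (- (j.+1%:R * (cpow c j.+1 u).2)).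
Proof.
move=> c0; have p0 := sqrD_gt0 u c0.
have d1 : is_derive u 1 (fun u => (cpow c 0 u).1) (- (1%:R * (cpow c 1 u).1)).
  by rewrite /=; eapply is_derive_eq; [der; rewrite gt_eqF|cbv beta => /=; field; rewrite gt_eqF].
have d2 : is_derive u 1 (fun u => (cpow c 0 u).2) (- (1%:R * (cpow c 1 u).2)).
  by rewrite /=; eapply is_derive_eq; [der; rewrite gt_eqF|cbv beta => /=; field; rewrite gt_eqF].
elim: j => [//|j [IH1 IH2]].
have e1 : (fun u => (cpow c j.+1 u).1) = (fun u => (cpow c j u).1 * (cpow c 0 u).1 - (cpow c j u).2 * (cpow c 0 u).2).
  by apply/funext => x /=; case: (cpow c j x).
have e2 : (fun u => (cpow c j.+1 u).2) = (fun u => (cpow c j u).1 * (cpow c 0 u).2 + (cpow c j u).2 * (cpow c 0 u).1).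
  by apply/funext => x /=; case: (cpow c j x).
rewrite e1 e2; split.
  eapply is_derive_eq.
    exact: (is_derive1D (is_derive1M IH1 d1) (is_derive1N (is_derive1M IH2 d2))).
  rewrite /=; case: (cpow c j u) => x y /=.
  by rewrite -[in RHS]natr1; ring.
eapply is_derive_eq.
  exact: (is_derive1D (is_derive1M IH1 d2) (is_derive1M IH2 d1)).
rewrite /=; case: (cpow c j u) => x y /=.
by rewrite -[in RHS]natr1; ring.
Qed.

(** The squares of both components add up to |u + ic|^(-2(j+1)), and |u + ic| >= c. *)
Lemma cpow_le c j u : 0 < c -> `|(cpow c j u).1| <= c ^- j.+1.
Proof.
move=> c0; have p0 := sqrD_gt0 u c0.
have E : (cpow c j u).1 ^+ 2 + (cpow c j u).2 ^+ 2 = (u ^+ 2 + c ^+ 2) ^- j.+1.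
  elim: j => [|j /=].
    by rewrite /= expr1; field; rewrite gt_eqF.
  case: (cpow c j u) => x y /=; move: p0; set d := u ^+ 2 + c ^+ 2 => p0.
  rewrite [d ^+ j.+2]exprS invfM => <-.
  transitivity (((u / d) ^+ 2 + (c / d) ^+ 2) * (x ^+ 2 + y ^+ 2)); first by ring.
  by rewrite !exprMn -[X in X * _]mulrDl -/d; field; rewrite gt_eqF.
rewrite -ler_sqr ?nnegrE ?invr_ge0 ?exprn_ge0// ?(ltW c0)//.
rewrite real_normK ?num_real//.
have : (cpow c j u).1 ^+ 2 <= (u ^+ 2 + c ^+ 2) ^- j.+1 by rewrite -E lerDl sqr_ge0.
move/le_trans; apply.
have -> : c ^- j.+1 ^+ 2 = (c ^+ 2)^-1 ^+ j.+1 by rewrite !exprVn -!exprM mulnC.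
rewrite -exprVn.
apply: lerXn2r; rewrite ?nnegrE ?invr_ge0 ?exprn_ge0 ?(ltW c0) ?(ltW p0)//.
by rewrite lef_pV2 ?posrE ?exprn_gt0// lerDr sqr_ge0.
Qed.

(** Real parts of (ic)^-(j+1): zero for odd exponents, which makes boundary terms at 0 vanish, and
    c^-(j+1) up to sign for even ones. *)
Lemma cpow0 c l : 0 < c -> (cpow c (2 * l).+1 0).1 = (-1) ^+ l.+1 * c ^- (2 * l.+1) /\ (cpow c (2 * l) 0).1 = 0.
Proof.
move=> c0; have c1 : c != 0 by rewrite gt_eqF.
have e1 j : cpow c j.+1 0 = (- (cpow c j 0).2 / c, (cpow c j 0).1 / c).
  by rewrite /=; case: (cpow c j 0) => x y /=; congr pair; rewrite expr0n/=; field.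
suff h : cpow c (2 * l) 0 = (0, (-1) ^+ l * c ^- (2 * l).+1).
  rewrite e1 h/=; split=> //; have -> : (2 * l.+1 = (2 * l).+2)%N by lia.
  by rewrite [(-1) ^+ l.+1]exprS [c ^+ (2 * l).+2]exprS; field; rewrite expf_neq0.
elim: l => [|l IH].
  by rewrite muln0 /=; congr pair; rewrite expr0n/= ?expr0 ?expr1; field.
have -> : (2 * l.+1 = (2 * l).+2)%N by lia.
rewrite !e1 IH/= !mul0r; congr pair; first by rewrite oppr0 mul0r.
by rewrite [(-1) ^+ l.+1]exprS [c ^+ (2 * l).+3]exprS [c ^+ (2 * l).+2]exprS; field; rewrite expf_neq0.
Qed.

(* [atom_top n c] is the derivative of order 2n - 1 of [atom n c], whose lower
   derivatives all vanish at 0; it is nonnegative because |(u + ic)^-2n| <= c^-2n. *)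
Definition atom_top n c u : R :=
  2 * (2 * n).-1`!%:R * (c ^- (2 * n) - (-1) ^+ n * (cpow c (2 * n).-1 u).1).

Lemma atom_top_ge0 n c u : (0 < n)%N -> 0 < c ->
  0 <= atom_top n c u <= 4 * (2 * n).-1`!%:R * c ^- (2 * n).
Proof.
move=> n0 c0; have := @cpow_le c (2 * n).-1 u c0; rewrite prednK; last by lia.
have <- : `|(-1) ^+ n * (cpow c (2 * n).-1 u).1| = `|(cpow c (2 * n).-1 u).1|.
  by rewrite normrM normrX normrN1 expr1n mul1r.
rewrite ler_norml => /andP[h1 h2].
rewrite mulr_ge0/=; [|by rewrite mulr_ge0|lra].
have -> : 4 * (2 * n).-1`!%:R * c ^- (2 * n) = 2 * (2 * n).-1`!%:R * (2 * c ^- (2 * n)) :> R by ring.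
by rewrite ler_wpM2l ?mulr_ge0//; lra.
Qed.

Lemma laplaceable_cpow c j : 0 < c -> laplaceable (fun u => (cpow c j u).1).
Proof.
move=> c0; apply: (@le_laplaceable _ (fun=> c ^- j.+1)).
- apply: continuous_measurable_gt0 => u _.
  exact: is_derive_continuous (is_derive_cpow j u c0).1.
- by move=> u _; exact: cpow_le.
- exact: laplaceable_cst.
Qed.

Lemma laplaceable_atom_top n c : 0 < c -> laplaceable (atom_top n c).
Proof.
move=> c0; apply: laplaceableZ; apply: laplaceableD; first exact: laplaceable_cst.
have -> : (fun u => - ((-1) ^+ n * (cpow c (2 * n).-1 u).1)) =
          (fun u => - (-1) ^+ n * (cpow c (2 * n).-1 u).1).
  by apply/funext => u; rewrite mulNr.
exact/laplaceableZ/laplaceable_cpow.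
Qed.

Lemma laplaceable_atom n c : 0 < c -> laplaceable (atom n c).
Proof.
move=> c0; apply: (@le_laplaceable _ (fun u => 2 * c ^- (2 * n.+1) * u ^+ (2 * n).+1)).
- apply: continuous_measurable_gt0 => u _.
  eapply is_derive_continuous; rewrite /atom; der.
  by rewrite mulf_neq0 ?gt_eqF ?exprn_gt0 ?sqrD_gt0.
- by move=> u u0; rewrite ger0_norm ?atom_ge0// atom_le.
- exact/laplaceableZ/laplaceableX.
Qed.

Lemma continuous_cpow c j u : 0 < c -> {for u, continuous (fun u => (cpow c j u).1)}.
Proof. by move=> c0; exact: is_derive_continuous (is_derive_cpow j u c0).1. Qed.

Lemma laplace_cpow c j t : 0 < c -> 0 < t -> (cpow c j 0).1 = 0 ->
  t * laplace (fun u => (cpow c j u).1) t = - j.+1%:R * laplace (fun u => (cpow c j.+1 u).1) t.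
Proof.
move=> c0 t0 p0; rewrite -[RHS](laplaceZ _ (laplaceable_cpow _ c0) t0).
apply: (@laplaceMparts_bounded _ _ (j.+1%:R * c ^- j.+2)) => //.
- by move=> s; apply: is_derive_eq (is_derive_cpow j s c0).1 _; rewrite mulNr.
- by move=> s; apply: continuous1M; [exact: cvg_cst|exact: continuous_cpow].
- by move=> s _; rewrite normrM normrN normr_nat ler_wpM2l// cpow_le.
- exact: laplaceable_cpow.
- exact/laplaceableZ/laplaceable_cpow.
Qed.

Lemma laplace_atom_top n c t : 0 < c -> 0 < t -> laplace (atom_top n c) t =
  2 * (2 * n).-1`!%:R * (c ^- (2 * n) / t - (-1) ^+ n * laplace (fun u => (cpow c (2 * n).-1 u).1) t).
Proof.
move=> c0 t0; have l1 := laplaceable_cpow (2 * n).-1 c0.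
have l2 := laplaceableZ (- (-1) ^+ n) l1.
rewrite -mulNr -(laplaceZ _ l1 t0) -(laplace_cst _ t0) -laplaceD//; last exact: laplaceable_cst.
rewrite -laplaceZ//; last by apply: laplaceableD => //; exact: laplaceable_cst.
by apply: eq_laplace => u _; rewrite mulNr.
Qed.

(** Each induction step adds a factor t^2. [atomS] trades the atom for its predecessor and a
    monomial with explicit transform; two integrations by parts then lead from the previous
    [atom_top] to the next one. The boundary values are those at 0 of that [atom_top] and of the
    real part of an odd power of 1/(u + ic), both zero. *)
Lemma laplaceM_atom n c t : (0 < n)%N -> 0 < c -> 0 < t ->
  t ^+ (2 * n).-1 * laplace (atom n c) t = laplace (atom_top n c) t.
Proof.
move=> + c0 t0; have t1 : t != 0 by rewrite gt_eqF.
have atomSE m : laplace (atom m.+1 c) t =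
    2 * c ^- (2 * m.+1) * ((2 * m).+1`!%:R / t ^+ (2 * m).+2) - laplace (atom m c) t.
  rewrite -(laplaceX _ t0) -(laplaceZ _ (laplaceableX _) t0) -mulN1r.
  rewrite -(laplaceZ _ (laplaceable_atom m c0) t0) -laplaceD//.
  - by apply: eq_laplace => u _; rewrite atomS// mulN1r.
  - exact/laplaceableZ/laplaceableX.
  - exact/laplaceableZ/laplaceable_atom.
case: n => // n _; elim: n => [|n IH].
  rewrite atomSE laplace_atom_top// muln1 muln0 [2.-1]/= factS fact0.
  have -> : laplace (atom 0 c) t = 2 * laplace (fun u => (cpow c 0 u).1) t.
    rewrite -(laplaceZ _ (laplaceable_cpow 0 c0) t0); apply: eq_laplace => u _.
    by rewrite /atom muln0 expr0 mul1r expr1 /= mulrA.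
  have h := laplace_cpow c0 t0 (cpow0 0 c0).2.
  rewrite [in LHS]expr1 mulrBr [t * (2 * laplace _ _)]mulrCA h.
  by rewrite !expr2 ?expr1 muln1; field; rewrite t1 gt_eqF.
have e : (2 * n.+2).-1 = (2 * n.+1).+1 by lia.
have c1 : c != 0 by rewrite gt_eqF.
have -> : t ^+ (2 * n.+2).-1 * laplace (atom n.+2 c) t =
   2 * c ^- (2 * n.+2) * (2 * n.+1).+1`!%:R / t - t ^+ 2 * laplace (atom_top n.+1 c) t.
  rewrite -IH atomSE e mulrBr; congr (_ - _).
    by rewrite [t ^+ _.+2]exprS; field; rewrite t1 !expf_neq0.
  rewrite mulrA -exprD; congr (_ ^+ _ * _); lia.
rewrite [RHS]laplace_atom_top// [in RHS]e.
have p0 : atom_top n.+1 c 0 = 0.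
  rewrite /atom_top; have -> : (2 * n.+1).-1 = (2 * n).+1 by lia.
  by rewrite (cpow0 n c0).1 mulrA -exprMn mulrNN mulr1 expr1n mul1r subrr mulr0.
have h1 : t * laplace (atom_top n.+1 c) t =
    2 * (2 * n.+1)`!%:R * (-1) ^+ n.+1 * laplace (fun u => (cpow c (2 * n.+1) u).1) t.
  have fE : (2 * n.+1)`!%:R = (2 * n.+1)%:R * (2 * n.+1).-1`!%:R :> R.
    have -> : (2 * n.+1 = (2 * n).+2)%N by lia.
    by rewrite factS natrM.
  have lc := laplaceable_cpow (2 * n.+1) c0.
  rewrite fE -(laplaceZ _ lc t0).
  have la := laplaceable_atom_top n.+1 c0; move: p0 la; rewrite /atom_top.
  move: ((2 * n.+1).-1`!%:R : R) (ler0n R (2 * n.+1).-1`!) => f f0 p0 la.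
  apply: (laplaceMparts_bounded (M := 2 * ((2 * n.+1)%:R * f) * c ^- (2 * n.+1).+1) t0 _ _ _ p0 la
    (laplaceableZ _ lc)).
  - move=> s; have := (is_derive_cpow (2 * n.+1).-1 s c0).1.
    rewrite prednK// => d; eapply is_derive_eq; first (der; exact: d).
    by cbv beta; ring.
  - by move=> s; apply: continuous1M; [exact: cvg_cst|exact: continuous_cpow].
  - move=> s _; rewrite !normrM normrX normrN1 expr1n mulr1 !normr_nat ger0_norm//.
    by rewrite ler_wpM2l ?mulr_ge0// cpow_le.
have h2 := laplace_cpow c0 t0 (cpow0 n.+1 c0).2.
have -> : t ^+ 2 * laplace (atom_top n.+1 c) t = 2 * (2 * n.+1)`!%:R * (-1) ^+ n.+1 *
    (- (2 * n.+1).+1%:R * laplace (fun u => (cpow c (2 * n.+1).+1 u).1) t).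
  by rewrite -h2 expr2 -mulrA h1 mulrCA.
rewrite [(2 * n.+1).+1`!]factS natrM [(-1) ^+ n.+2]exprS.
move: (laplace _ t) ((2 * n.+1)`!%:R : R) ((-1) ^+ n.+1 : R) (c ^- (2 * n.+2)) ((2 * n.+1).+1%:R : R).
by move=> L f s C m; field.
Qed.

End Atoms.

(** * Sign of the derivatives of the kernel *)

Section KernelPositivity.
Context {R : realType}.
Notation mu := (@lebesgue_measure R).
Notation D := (`]0%R, +oo[%classic : set R).
Implicit Types (t u x y z : R).

Lemma measurable_kernel_rem n : measurable_fun D (@kernel_rem R n).
Proof.
apply: (@measurable_fun_cvg _ _ R _ (fun N u => series (fun m => atom n (@pole R m) u) N)).
  move=> N; apply: continuous_measurable_gt0 => u _; rewrite /series/=.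
  eapply is_derive_continuous; apply: is_derive1_sum => m; rewrite /atom.
  have c0 := @pole_gt0 R m.
  by der; rewrite mulf_neq0 ?gt_eqF ?exprn_gt0 ?sqrD_gt0.
by move=> u /=; rewrite in_itv/= andbT => u0; exact: cvg_kernel_rem.
Qed.

Lemma laplaceable_kernel_rem n : laplaceable (@kernel_rem R n).
Proof.
apply: (@le_laplaceable _ (fun u => 2 * inv_pole_sum n.+1 * u ^+ (2 * n).+1)).
- exact: measurable_kernel_rem.
- by move=> u u0; rewrite ger0_norm ?kernel_rem_ge0// kernel_rem_le.
- exact/laplaceableZ/laplaceableX.
Qed.

(** The sum over the poles is exchanged with the transform by monotone convergence on both sides, so
    the series of atoms is never differentiated termwise. The sum of the [atom_top] converges, being
    dominated by the sum of c_m^(-2n) with n >= 1. *)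
Lemma completely_monotonic_kernel_rem n : (0 < n)%N ->
  completely_monotonic (fun t => t ^+ (2 * n).-1 * laplace (@kernel_rem R n) t).
Proof.
move=> n0.
pose g m u := atom_top n (@pole R m) u.
pose K : R := 4 * (2 * n).-1`!%:R.
have g_ge0 m u : 0 <= g m u by have /andP[] := @atom_top_ge0 _ n (pole m) u n0 (pole_gt0 m).
have g_le m u : g m u <= K * pole m ^- (2 * n).
  by have /andP[] := @atom_top_ge0 _ n (pole m) u n0 (pole_gt0 m).
have K0 : 0 <= K by rewrite mulr_ge0.
have KE N : series (fun m => K * @pole R m ^- (2 * n)) N = K * series (fun m => pole m ^- (2 * n)) N.
  by rewrite /series/= mulr_sumr.
have cK : series (fun m => K * @pole R m ^- (2 * n)) N @[N --> \oo] --> K * inv_pole_sum n.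
  by under eq_fun do rewrite KE; apply: cvgMr; exact: cvg_inv_pole_sum.
pose G u : R := limn (series (g ^~ u)).
have cG u : series (g ^~ u) N @[N --> \oo] --> G u.
  apply: (@series_le_cvg _ _ (fun m => K * @pole R m ^- (2 * n))) => //.
  - by move=> m; exact: le_trans (g_ge0 m u) (g_le m u).
  - exact: cvgP cK.
have G0 u : 0 <= G u.
  apply: (ler_cvg_to (f := fun=> 0) _ (cG u)); first exact: cvg_cst.
  by apply: nearW => N; exact: sumr_ge0.
have mg m : measurable_fun D (g m).
  exact: laplaceable_measurable (laplaceable_atom_top n (pole_gt0 m)).
have lG : laplaceable G.
  apply: (@le_laplaceable _ (fun=> K * inv_pole_sum n)).
  - apply: (@measurable_fun_cvg _ _ R _ (fun N u => series (g ^~ u) N)).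
      by move=> N; rewrite /series/=; apply: measurable_sum.
    by move=> u _; exact: cG.
  - move=> u _; rewrite ger0_norm//; apply: (ler_cvg_to (cG u) cK).
    by apply: nearW => N; exact: ler_sum.
  - exact: laplaceable_cst.
apply: completely_monotonic_eq (completely_monotonic_laplace lG (fun u _ => G0 u)).
move=> t t0; apply: EFin_inj; rewrite EFinM !EFin_laplace//; last exact: laplaceable_kernel_rem.
rewrite (laplace_nneseries (f := g) t mg (fun m u _ => g_ge0 m u) (fun u _ => cG u)).
rewrite (@laplace_nneseries _ (fun m => atom n (pole m)) _ t _ _ (fun u => @cvg_kernel_rem _ n u)); last 2 first.
- by move=> m; exact: laplaceable_measurable (laplaceable_atom n (pole_gt0 m)).
- by move=> m u u0; exact: atom_ge0 (pole_gt0 m) u0.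
rewrite -nneseriesZl; last first.
  move=> m _; apply: integral_ge0 => u /=; rewrite in_itv/= andbT => u0.
  by rewrite lee_fin mulr_ge0 ?expR_ge0// atom_ge0// pole_gt0.
apply: eq_eseriesr => m _.
rewrite -(EFin_laplace (laplaceable_atom n (pole_gt0 m)) t0).
rewrite -(EFin_laplace (laplaceable_atom_top n (pole_gt0 m)) t0) -EFinM.
by rewrite laplaceM_atom// pole_gt0.
Qed.

Lemma gt0_is_derive_le (f f' : R -> R) x y : (forall z : R, 0 < z -> is_derive z 1 f (f' z)) ->
  (forall z, 0 < z -> 0 <= f' z) -> 0 < x -> x <= y -> f x <= f y.
Proof.
move=> df f'0 x0 xy.
have [z| |c] := @MVT_segment _ f f' _ _ xy.
- by rewrite in_itv/= => /andP[xz _]; apply: df; exact: lt_trans xz.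
- apply: derivable_within_continuous => z; rewrite in_itv/= => /andP[xz _].
  by have [] := df z (lt_le_trans x0 xz).
rewrite in_itv/= => /andP[xc _] E; rewrite -subr_ge0 E mulr_ge0 ?subr_ge0// f'0//.
exact: lt_le_trans xc.
Qed.

(* Lazarevic's inequality; the logarithmic derivative of the quotient of both
   sides is nonnegative by [aux]. *)
Lemma lazarevic x : 0 < x -> x ^+ 3 * cosh x <= sinh x ^+ 3.
Proof.
have aux y : 0 <= y -> 0 <= y * cosh y + 2 * y - 3 * sinh y.
  apply: (@ge0_of_derive R (fun y => y * cosh y + 2 * y - 3 * sinh y) (fun y => y * sinh y - 2 * cosh y + 2)).
  - by move=> z _; eapply is_derive_eq; [der|cbv beta; ring].
  - move=> z.
    apply: (@ge0_of_derive R (fun z => z * sinh z - 2 * cosh z + 2) (fun y => y * cosh y - sinh y)).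
    + by move=> w _; eapply is_derive_eq; [der|cbv beta; ring].
    + by move=> w w0; rewrite subr_ge0 sinh_le.
    + by rewrite sinh0 cosh0; lra.
  - by rewrite sinh0 cosh0; lra.
pose T x := (sinh x / x) ^+ 3 / cosh x.
pose T' x := sinh x ^+ 2 / (x ^+ 4 * cosh x ^+ 2) * (3 * x + 2 * x * sinh x ^+ 2 - 3 * sinh x * cosh x).
have dT y : 0 < y -> is_derive y 1 T (T' y).
  move=> y0; have c0 := cosh_gt0 y.
  eapply is_derive_eq; first by (rewrite /T; der; rewrite gt_eqF).
  cbv beta => /=; rewrite /T'.
  have -> : 3 * y + 2 * y * sinh y ^+ 2 - 3 * sinh y * cosh y =
     3 * y * cosh y ^+ 2 - y * sinh y ^+ 2 - 3 * sinh y * cosh y by rewrite cosh2Dsinh2; ring.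
  by field; rewrite !gt_eqF.
have T'0 y : 0 < y -> 0 <= T' y.
  move=> y0; apply: mulr_ge0.
    by apply: divr_ge0; [exact: sqr_ge0|apply: mulr_ge0; [exact/exprn_ge0/ltW|exact: sqr_ge0]].
  (* By the double-angle formulas, the expression of [aux] at 2y is twice the last factor of
     [T']. *)
  have := aux (y + y); rewrite sinhD.
  have -> : cosh (y + y) = 1 + 2 * sinh y ^+ 2.
    by rewrite /cosh /sinh opprD !expRD expRN; field; rewrite gt_eqF ?expR_gt0.
  by rewrite addr_ge0 ?(ltW y0)// => /(_ isT); lra.
move=> x0; have c0 := cosh_gt0 x.
suff : 1 <= T x.
  rewrite /T ler_pdivlMr// mul1r expr_div_n ler_pdivlMr ?exprn_gt0//.
  by rewrite mulrC.
have cT : T y @[y --> (0:R)^'+] --> (1:R).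
  have cs : sinh y / y @[y --> (0:R)^'+] --> (1:R).
    apply: cvg_dnbhs_at_right; rewrite -(@cosh0 R).
    by apply: is_derive0_cvg; [exact: sinh0|exact: is_derive_sinh].
  have cc : cosh y @[y --> (0:R)^'+] --> (1:R).
    by rewrite -(@cosh0 R); apply: cvg_at_right_filter; exact: is_derive_continuous (is_derive_cosh 0).
  have -> : (1:R) = 1 * 1 * 1 / 1 by rewrite !mulr1 divr1.
  rewrite /T; under eq_fun do rewrite !exprS expr0 mulr1 mulrA.
  by apply: cvgM; [apply: cvgM => //; exact: cvgM|apply: cvgV => //; exact: oner_neq0].
apply: (ler_cvg_to (g := fun=> T x) cT); first exact: cvg_cst.
near=> e; apply: (gt0_is_derive_le dT T'0).
  by near: e; exact: nbhs_right_gt.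
by near: e; exact: nbhs_right_le.
Unshelve. all: by end_near. Qed.

Definition binet_kernel1 u : R := u ^- 2 - expR u / (expR u - 1) ^+ 2.

Definition binet_kernel2 u : R :=
  expR u * (expR u + 1) / (expR u - 1) ^+ 3 - 2 / u ^+ 3.

Lemma expR_sub1_gt0 u : 0 < u -> 0 < expR u - 1.
Proof. by move=> u0; rewrite subr_gt0 expR_gt1. Qed.

Lemma is_derive_binet_kernel u : 0 < u -> is_derive u 1 (@binet_kernel R) (binet_kernel1 u).
Proof.
move=> u0; have e0 := expR_sub1_gt0 u0.
eapply is_derive_eq; first by (rewrite /binet_kernel; der; rewrite gt_eqF).
by rewrite /binet_kernel1; cbv beta; field; rewrite !gt_eqF.
Qed.

Lemma is_derive_binet_kernel1 u : 0 < u -> is_derive u 1 binet_kernel1 (binet_kernel2 u).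
Proof.
move=> u0; have e0 := expR_sub1_gt0 u0.
eapply is_derive_eq; first by (rewrite /binet_kernel1; der; rewrite gt_eqF// exprn_gt0).
by rewrite /binet_kernel2; cbv beta => /=; field; rewrite !gt_eqF.
Qed.

Lemma continuous_binet_kernel1 u : 0 < u -> {for u, continuous binet_kernel1}.
Proof. by move=> u0; exact: is_derive_continuous (is_derive_binet_kernel1 u0). Qed.

Lemma continuous_binet_kernel2 u : 0 < u -> {for u, continuous binet_kernel2}.
Proof.
move=> u0; have e0 := expR_sub1_gt0 u0.
by eapply is_derive_continuous; rewrite /binet_kernel2; der; rewrite gt_eqF// exprn_gt0.
Qed.

Lemma expR_sinh u : expR u - 1 = 2 * expR (u / 2) * sinh (u / 2).
Proof.
have -> : expR u = expR (u / 2) ^+ 2 by rewrite expr2 -expRD; congr expR; field.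
by rewrite /sinh expRN; field; rewrite gt_eqF ?expR_gt0.
Qed.

Lemma expR_cosh u : expR u + 1 = 2 * expR (u / 2) * cosh (u / 2).
Proof.
have -> : expR u = expR (u / 2) ^+ 2 by rewrite expr2 -expRD; congr expR; field.
by rewrite /cosh expRN; field; rewrite gt_eqF ?expR_gt0.
Qed.

(** e^u/(e^u - 1)^2 = 1/(2 sinh(u/2))^2, so the claim comes down to u/2 <= sinh(u/2). *)
Lemma binet_kernel1_ge0 u : 0 < u -> 0 <= binet_kernel1 u.
Proof.
move=> u0; have x0 : 0 < u / 2 by rewrite divr_gt0.
have s0 := sinh_gt0 x0; have v0 := expR_gt0 (u / 2).
rewrite /binet_kernel1 expR_sinh.
have -> : expR u = expR (u / 2) ^+ 2 by rewrite expr2 -expRD; congr expR; field.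
have -> : expR (u / 2) ^+ 2 / (2 * expR (u / 2) * sinh (u / 2)) ^+ 2 = (2 * sinh (u / 2)) ^- 2.
  by field; rewrite !gt_eqF.
have p : 0 < 2 * sinh (u / 2) by rewrite mulr_gt0.
rewrite subr_ge0 lef_pV2 ?posrE ?exprn_gt0// ler_sqr ?nnegrE ?(ltW u0) ?(ltW p)//.
by have := le_sinh (ltW x0); lra.
Qed.

(** With x = u/2 the two terms are cosh x/(4 sinh^3 x) and 1/(4 x^3). *)
Lemma binet_kernel2_le0 u : 0 < u -> binet_kernel2 u <= 0.
Proof.
move=> u0; have x0 : 0 < u / 2 by rewrite divr_gt0.
have s0 := sinh_gt0 x0; have v0 := expR_gt0 (u / 2).
rewrite /binet_kernel2 expR_sinh expR_cosh.
have -> : expR u = expR (u / 2) ^+ 2 by rewrite expr2 -expRD; congr expR; field.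
have -> : expR (u / 2) ^+ 2 * (2 * expR (u / 2) * cosh (u / 2)) / (2 * expR (u / 2) * sinh (u / 2)) ^+ 3 =
    cosh (u / 2) / (4 * sinh (u / 2) ^+ 3).
  by field; rewrite !gt_eqF.
have -> : 2 / u ^+ 3 = (4 * (u / 2) ^+ 3)^-1 by field; rewrite !gt_eqF.
have := lazarevic x0; move: (u / 2) x0 s0 => x x0 s0 h.
have p : 0 < 4 * x ^+ 3 by rewrite mulr_gt0 ?exprn_gt0.
have q : 0 < 4 * sinh x ^+ 3 by rewrite mulr_gt0 ?exprn_gt0.
by rewrite subr_le0 (ler_pdivrMr _ _ q) (ler_pdivlMl _ _ p) -mulrA ler_wpM2l.
Qed.

Lemma binet_kernel_rem0 u : kernel_rem 0 u = @binet_kernel R u.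
Proof. by rewrite /kernel_rem big_geq// subr0 expr0 mul1r. Qed.

Lemma binet_kernel_gt0 u : 0 < u -> 0 < @binet_kernel R u.
Proof. by rewrite -binet_kernel_rem0; exact: kernel_rem_gt0. Qed.

Lemma binet_kernel_le u : 0 < u -> @binet_kernel R u <= kernel_coef 1 * u.
Proof.
move=> u0; have := kernel_rem_le 0 u0; rewrite binet_kernel_rem0 muln0 expr1.
by rewrite /kernel_coef/= expr0 mul1r.
Qed.

Lemma binet_kernel_le_half u : 0 < u -> @binet_kernel R u <= 1 / 2.
Proof.
move=> u0; have e0 := expR_sub1_gt0 u0.
rewrite /binet_kernel gerDr subr_le0 lef_pV2 ?posrE//.
by have := expR_ge1Dx u; lra.
Qed.

Lemma cvg0_monomial (C : R) n : C * u ^+ n.+1 @[u --> (0:R)^'+] --> (0:R).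
Proof.
apply: cvg_at_right_filter.
have : {for 0, continuous (fun u : R => C * u ^+ n.+1)} by eapply is_derive_continuous; der.
by rewrite /prop_for /continuous_at expr0n mulr0.
Qed.

Lemma cvg0_binet_kernel : @binet_kernel R u @[u --> 0^'+] --> 0.
Proof.
apply: (@squeeze_cvgr _ _ _ _ (cst 0) (fun u => kernel_coef 1 * u ^+ 1)).
- near=> u; have u0 : 0 < u by near: u; exact: nbhs_right_gt.
  by rewrite (ltW (binet_kernel_gt0 u0))/= binet_kernel_le.
- exact: cvg_cst.
- exact: cvg0_monomial.
Unshelve. all: by end_near. Qed.

Lemma laplaceable_binet_kernel : laplaceable (@binet_kernel R).
Proof.
have -> : @binet_kernel R = kernel_rem 0 by apply/funext => u; rewrite binet_kernel_rem0.
exact: laplaceable_kernel_rem.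
Qed.

Lemma completely_monotonic_binet_kernel :
  completely_monotonic (fun t => t * laplace (@binet_kernel R) t).
Proof.
have l1 : laplaceable binet_kernel1.
  apply: (laplaceable_parts laplaceable_binet_kernel) cvg0_binet_kernel.
  - exact: is_derive_binet_kernel.
  - exact: continuous_binet_kernel1.
  - exact: binet_kernel1_ge0.
apply: completely_monotonic_eq (completely_monotonic_laplace l1 binet_kernel1_ge0).
move=> t t0; apply/esym; apply: (laplaceMparts laplaceable_binet_kernel t0) cvg0_binet_kernel.
- exact: is_derive_binet_kernel.
- exact: continuous_binet_kernel1.
- exact: binet_kernel1_ge0.
Qed.

Lemma kernel_rem1 u : kernel_rem 1 u = kernel_coef 1 * u - @binet_kernel R u.
Proof. by rewrite /kernel_rem big_nat1 expr1; ring. Qed.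

Definition kernel_rem1_deriv u : R := kernel_coef 1 - binet_kernel1 u.

Lemma is_derive_kernel_rem1 u : 0 < u -> is_derive u 1 (@kernel_rem R 1) (kernel_rem1_deriv u).
Proof.
move=> u0; have -> : @kernel_rem R 1 = (fun u => kernel_coef 1 * u - binet_kernel u).
  by apply/funext => v; exact: kernel_rem1.
by eapply is_derive_eq; [der; exact: is_derive_binet_kernel|rewrite /kernel_rem1_deriv; cbv beta; ring].
Qed.

Lemma is_derive_kernel_rem1_deriv u : 0 < u -> is_derive u 1 kernel_rem1_deriv (- binet_kernel2 u).
Proof.
move=> u0; rewrite /kernel_rem1_deriv.
by eapply is_derive_eq; [der; exact: is_derive_binet_kernel1|cbv beta; ring].
Qed.

Lemma kernel_rem1_deriv_homo u v : 0 < u -> u <= v -> kernel_rem1_deriv u <= kernel_rem1_deriv v.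
Proof.
apply: gt0_is_derive_le is_derive_kernel_rem1_deriv _ => z z0.
by rewrite oppr_ge0 binet_kernel2_le0.
Qed.

Lemma kernel_rem1_MVT u v : 0 < u -> u < v ->
  exists2 c : R, u < c < v & kernel_rem 1 v - kernel_rem 1 u = kernel_rem1_deriv c * (v - u).
Proof.
move=> u0 uv.
have [z| |c] := @MVT _ (@kernel_rem R 1) kernel_rem1_deriv _ _ uv.
- by rewrite in_itv/= => /andP[uz _]; apply: is_derive_kernel_rem1; exact: lt_trans uz.
- apply: derivable_within_continuous => z; rewrite in_itv/= => /andP[uz _].
  by have [] := is_derive_kernel_rem1 (lt_le_trans u0 uz).
by rewrite in_itv/= => cuv E; exists c.
Qed.

Lemma cvg0_kernel_rem1 : @kernel_rem R 1 u @[u --> (0:R)^'+] --> (0:R).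
Proof.
apply: (@squeeze_cvgr _ _ _ _ (cst 0) (fun u => 2 * inv_pole_sum 2 * u ^+ 3)).
- near=> u; have u0 : 0 < u by near: u; exact: nbhs_right_gt.
  by rewrite kernel_rem_ge0//= kernel_rem_le.
- exact: cvg_cst.
- exact: cvg0_monomial.
Unshelve. all: by end_near. Qed.

(** [kernel_rem 1] is convex with limit 0 at 0+, so its chord from the origin is no steeper than its
    tangent at u. The mean value theorem is applied on [v, u] with v -> 0. *)
Lemma kernel_rem1_le_deriv u : 0 < u -> kernel_rem 1 u <= kernel_rem1_deriv u * u.
Proof.
move=> u0.
have c1 : kernel_rem 1 u - kernel_rem 1 v @[v --> (0:R)^'+] --> kernel_rem 1 u - 0.
  by apply: cvgB; [exact: cvg_cst|exact: cvg0_kernel_rem1].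
have c2 : kernel_rem1_deriv u * (u - v) @[v --> (0:R)^'+] --> kernel_rem1_deriv u * (u - 0).
  by apply: cvgMr; apply: cvgB; [exact: cvg_cst|apply: cvg_at_right_filter; exact: cvg_id].
move: c1 c2; rewrite !subr0 => c1 c2; apply: (ler_cvg_to c1 c2).
near=> v; have v0 : 0 < v by near: v; exact: nbhs_right_gt.
have vu : v < u by near: v; exact: nbhs_right_lt.
have [c /andP[vc cu] ->] := kernel_rem1_MVT v0 vu.
by rewrite ler_wpM2r ?subr_ge0 ?(ltW vu)// kernel_rem1_deriv_homo ?(ltW cu)// (lt_trans v0).
Unshelve. all: by end_near. Qed.

Lemma completely_monotonic_kernel_rem1 :
  completely_monotonic (fun t => t ^+ 2 * laplace (@kernel_rem R 1) t).
Proof.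
pose F1 u := kernel_rem1_deriv u.
have d0 := is_derive_kernel_rem1.
have d1 u : 0 < u -> is_derive u 1 F1 (- binet_kernel2 u) by exact: is_derive_kernel_rem1_deriv.
have F2 u : 0 < u -> 0 <= - binet_kernel2 u by rewrite oppr_ge0; exact: binet_kernel2_le0.
pose C : R := 2 * inv_pole_sum 2.
have remC u : 0 < u -> 0 <= kernel_rem 1 u <= C * u ^+ 3.
  by move=> u0; rewrite kernel_rem_ge0//= kernel_rem_le.
have F1_ge0 u : 0 < u -> 0 <= F1 u.
  move=> u0; rewrite -(pmulr_lge0 _ u0).
  exact: le_trans (kernel_rem_ge0 1 u0) (kernel_rem1_le_deriv u0).
(* Convexity again: with f = [kernel_rem 1], u F1(u) <= f(2u) - f(u) <= f(2u) <= C (2u)^3. Hence F1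
   -> 0 at 0+, the boundary condition of the second integration by parts. *)
have F1_le u : 0 < u -> F1 u <= 8 * C * u ^+ 2.
  move=> u0; have uu : u < 2 * u by lra.
  have [c /andP[uc _] E] := kernel_rem1_MVT u0 uu.
  have h1 : F1 u <= F1 c := kernel_rem1_deriv_homo u0 (ltW uc).
  have /andP[_ h2] := remC (2 * u) (lt_trans u0 uu).
  have /andP[h3 _] := remC u u0.
  rewrite -(ler_pM2r u0); apply: (@le_trans _ _ (F1 c * u)); first by rewrite ler_wpM2r// ltW.
  have -> : F1 c * u = kernel_rem 1 (2 * u) - kernel_rem 1 u by rewrite E /F1; ring.
  have -> : 8 * C * u ^+ 2 * u = C * (2 * u) ^+ 3 by ring.
  lra.
have cF1 : F1 u @[u --> (0:R)^'+] --> (0:R).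
  apply: (@squeeze_cvgr _ _ _ _ (cst 0) (fun u => 8 * C * u ^+ 2)).
  - near=> u; have u0 : 0 < u by near: u; exact: nbhs_right_gt.
    by rewrite F1_ge0//= F1_le.
  - exact: cvg_cst.
  - exact: cvg0_monomial.
have cont1 u : 0 < u -> {for u, continuous F1}.
  by move=> u0; exact: is_derive_continuous (d1 u u0).
have cont2 u : 0 < u -> {for u, continuous (fun u => - binet_kernel2 u)}.
  by move=> u0; apply: cvgN; exact: continuous_binet_kernel2.
have l0 := @laplaceable_kernel_rem 1.
have cF0 := cvg0_kernel_rem1.
have l1 : laplaceable F1 by exact: (laplaceable_parts l0 d0).
have l2 : laplaceable (fun u => - binet_kernel2 u) by exact: (laplaceable_parts l1 d1).
apply: completely_monotonic_eq (completely_monotonic_laplace l2 F2).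
move=> t t0; rewrite -(laplaceMparts l1 t0 d1)// -(laplaceMparts l0 t0 d0)//.
by rewrite expr2 mulrA.
Unshelve. all: by end_near. Qed.

Lemma laplaceable_binet_kernel_div : laplaceable (fun u => @binet_kernel R u / u).
Proof.
apply: (@le_laplaceable _ (fun=> kernel_coef 1)); last exact: laplaceable_cst.
  apply: continuous_measurable_gt0 => u u0; eapply is_derive_continuous.
  by der; [exact: is_derive_binet_kernel|rewrite gt_eqF].
move=> u u0; rewrite ger0_norm ?divr_ge0 ?(ltW u0) ?(ltW (binet_kernel_gt0 u0))//.
by rewrite ler_pdivrMr// binet_kernel_le.
Qed.

Lemma kernel_rem1_div_le u : 0 < u -> 0 <= @kernel_rem R 1 u / u <= kernel_coef 1.
Proof.
move=> u0; rewrite divr_ge0 ?kernel_rem_ge0 ?(ltW u0)//= ler_pdivrMr//.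
by rewrite kernel_rem1 lerBlDr lerDl (ltW (binet_kernel_gt0 u0)).
Qed.

Lemma laplaceable_kernel_rem1_div : laplaceable (fun u => @kernel_rem R 1 u / u).
Proof.
apply: (@le_laplaceable _ (fun=> kernel_coef 1)); last exact: laplaceable_cst.
  apply: continuous_measurable_gt0 => u u0; eapply is_derive_continuous.
  by der; [exact: is_derive_kernel_rem1|rewrite gt_eqF].
by move=> u u0; have /andP[h1 h2] := kernel_rem1_div_le u0; rewrite ger0_norm.
Qed.

(** The derivative of f(u)/u is (u f'(u) - f(u))/u^2, nonnegative by the tangent inequality
    [kernel_rem1_le_deriv]. *)
Lemma completely_monotonic_kernel_rem1_div :
  completely_monotonic (fun t => t * laplace (fun u => @kernel_rem R 1 u / u) t).
Proof.
pose G u := (kernel_rem1_deriv u * u - kernel_rem 1 u) / u ^+ 2.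
have d u : 0 < u -> is_derive u 1 (fun u => @kernel_rem R 1 u / u) (G u).
  move=> u0; eapply is_derive_eq.
    by der; [exact: is_derive_kernel_rem1|rewrite gt_eqF].
  by rewrite /G; cbv beta; field; rewrite gt_eqF.
have G0 u : 0 < u -> 0 <= G u.
  by move=> u0; rewrite divr_ge0 ?subr_ge0 ?kernel_rem1_le_deriv// exprn_ge0// ltW.
have cG u : 0 < u -> {for u, continuous G}.
  move=> u0; eapply is_derive_continuous; rewrite /G; der.
  - exact: is_derive_kernel_rem1_deriv.
  - exact: is_derive_kernel_rem1.
  - by rewrite expf_neq0// gt_eqF.
have c0 : @kernel_rem R 1 u / u @[u --> (0:R)^'+] --> (0:R).
  apply: (@squeeze_cvgr _ _ _ _ (cst 0) (fun u => 2 * inv_pole_sum 2 * u ^+ 2)).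
  - near=> u; have u0 : 0 < u by near: u; exact: nbhs_right_gt.
    have /andP[-> _] /= := kernel_rem1_div_le u0; rewrite ler_pdivrMr//.
    by apply: le_trans (kernel_rem_le 1 u0) _; rewrite exprSr mulrA.
  - exact: cvg_cst.
  - exact: cvg0_monomial.
have l0 := laplaceable_kernel_rem1_div.
apply: completely_monotonic_eq (completely_monotonic_laplace (laplaceable_parts l0 d cG G0 c0) G0).
by move=> t t0; rewrite -(laplaceMparts l0 t0 d).
Unshelve. all: by end_near. Qed.

End KernelPositivity.

(** * The gamma function *)

Section GammaFunction.
Context {R : realType}.
Notation mu := (@lebesgue_measure R).
Notation D := (`]0%R, +oo[%classic : set R).
Implicit Types (s t u x y : R).

Lemma ln_le_sub1 y : 0 < y -> ln y <= y - 1.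
Proof. move=> y0; have := @le_ln1Dx R (y - 1).
have -> : 1 + (y - 1) = y by ring.
by apply; lra. Qed.

(* Bernoulli's inequality, from the tangent of ln at the weighted mean z of 1 and y. *)
Lemma powR_bernoulli y s : 0 < y -> 0 <= s <= 1 -> y `^ s <= 1 - s + s * y.
Proof.
move=> y0 /andP[s0 s1]; set z := 1 - s + s * y.
have z0 : 0 < z.
  rewrite /z; have [->|s1'] := eqVneq s 1; first by rewrite subrr add0r mul1r.
  by rewrite ltr_pwDl ?subr_gt0 ?lt_neqAle ?s1'// mulr_ge0// ltW.
rewrite /powR gt_eqF// -[leRHS](lnK z0) ler_expR.
have h1 : - ln z <= z^-1 - 1 by rewrite -lnV// ln_le_sub1// invr_gt0.
have h2 : ln y - ln z <= y / z - 1 by rewrite -ln_div ?posrE// ln_le_sub1// divr_gt0.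
have h3 : (1 - s) * (z^-1 - 1) + s * (y / z - 1) = 0.
  have -> : (1 - s) * (z^-1 - 1) + s * (y / z - 1) = z / z - 1 by rewrite [in RHS]/z; ring.
  by rewrite divff ?subrr// gt_eqF.
have h4 : (1 - s) * - ln z <= (1 - s) * (z^-1 - 1) by rewrite ler_wpM2l// subr_ge0.
have h5 : s * (ln y - ln z) <= s * (y / z - 1) by rewrite ler_wpM2l.
lra.
Qed.

Lemma laplaceable_powR_ge0 t : 0 <= t -> laplaceable (fun u => u `^ t).
Proof.
move=> t0; apply: (@le_laplaceable _ (fun u => 1 + u ^+ (Num.truncn t).+1)).
- apply: measurable_funTS; exact: measurable_powR.
- move=> u u0; rewrite ger0_norm ?powR_ge0// -powR_mulrn ?(ltW u0)//.
  have [u1|u1] := leP u 1.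
    apply: (@le_trans _ _ (u `^ 0)); last by rewrite powRr0 lerDl powR_ge0.
    by rewrite ger_powR// u0.
  apply: (@le_trans _ _ (u `^ (Num.truncn t).+1%:R)); last by rewrite lerDr.
  by rewrite ler_powR ?(ltW u1)// ltW// truncnS_gt.
- by apply: laplaceableD; [exact: laplaceable_cst|exact: laplaceableX].
Qed.

Lemma continuous_powRl t u : 0 < u -> {for u, continuous (fun u => u `^ t)}.
Proof. by move=> u0; exact: is_derive_continuous (is_derive1_powR t u0). Qed.

Lemma cvg0_powRl t : 0 < t -> u `^ t @[u --> (0:R)^'+] --> (0:R).
Proof. exact: powR_cvg0. Qed.

(** Bundles the hypotheses of the integration by parts of u^t. It is used once for the integrability
    of u^(t-1), unbounded at 0 when t < 1, and once for the functional equation of Gamma. *)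
Let parts t (P : Prop) : 0 < t ->
  (laplaceable (fun u => u `^ t) ->
   (forall s : R, 0 < s -> is_derive s 1 (fun u => u `^ t) (t * s `^ (t - 1))) ->
   (forall s, 0 < s -> {for s, continuous (fun s => t * s `^ (t - 1))}) ->
   (forall s, 0 < s -> 0 <= t * s `^ (t - 1)) -> s `^ t @[s --> (0:R)^'+] --> (0:R) -> P) -> P.
Proof.
move=> t0 h.
have d (s : R) : 0 < s -> is_derive s 1 (fun u => u `^ t) (t * s `^ (t - 1)).
  by move=> s0; exact: is_derive1_powR.
have c s : 0 < s -> {for s, continuous (fun s => t * s `^ (t - 1))}.
  by move=> s0; apply: continuous1M; [exact: cvg_cst|exact: continuous_powRl].
apply: (h (laplaceable_powR_ge0 (ltW t0)) d c _ (cvg0_powRl t0)).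
by move=> s s0; rewrite mulr_ge0 ?powR_ge0// ltW.
Qed.

Lemma laplaceable_powR t : 0 < t -> laplaceable (fun u => u `^ (t - 1)).
Proof.
move=> t0; have -> : (fun u => u `^ (t - 1)) = (fun u => t^-1 * (t * u `^ (t - 1))).
  by apply/funext => u; rewrite mulKf// gt_eqF.
apply: laplaceableZ; apply: (parts t0) => l0 d0 c0 G0 F0.
exact: (laplaceable_parts l0 d0 c0 G0 F0).
Qed.

Lemma Gamma_laplace t : Gamma t = laplace (fun u => u `^ (t - 1)) 1.
Proof. by apply: eq_Rintegral => u _; rewrite mul1r. Qed.

Lemma Gamma_gt0 t : 0 < t -> 0 < Gamma t.
Proof.
move=> t0; rewrite Gamma_laplace; apply: laplace_gt0 => //; first exact: laplaceable_powR.
by move=> u u0; rewrite powR_gt0.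
Qed.

Lemma GammaD1 t : 0 < t -> Gamma (t + 1) = t * Gamma t.
Proof.
move=> t0; rewrite !Gamma_laplace addrK -(laplaceZ _ (laplaceable_powR t0) ltr01).
rewrite -[LHS]mul1r; apply: (parts t0) => l0 d0 c0 G0 F0.
exact: (laplaceMparts l0 ltr01 d0 c0 G0 F0).
Qed.

(** Bernoulli's inequality for (u/x)^s, integrated against u^(x-1) e^(-u), gives a weighted mean of
    Gamma(x) and Gamma(x+1)/x, which are equal. It plays the role of log-convexity. *)
Lemma Gamma_wendel x s : 0 < x -> 0 <= s <= 1 -> Gamma (x + s) <= Gamma x * x `^ s.
Proof.
move=> x0 /andP[s0 s1].
have xs0 : 0 < x + s by rewrite ltr_wpDr.
have x10 : 0 < x + 1 by rewrite addr_gt0.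
have -> : Gamma x * x `^ s = x `^ s * ((1 - s) * Gamma x + s / x * Gamma (x + 1)).
  by rewrite GammaD1//; field; rewrite gt_eqF.
have l1 := laplaceable_powR x0; have l2 := laplaceable_powR x10.
have l3 := laplaceableZ (1 - s) l1; have l4 := laplaceableZ (s / x) l2.
rewrite !Gamma_laplace -(laplaceZ _ l1 ltr01) -(laplaceZ _ l2 ltr01) -(laplaceD l3 l4 ltr01).
have l5 := laplaceableD l3 l4.
rewrite -(laplaceZ _ l5 ltr01); apply: le_laplace => //; first exact: laplaceable_powR.
  exact: laplaceableZ.
move=> u u0; have := @powR_bernoulli (u / x) s (divr_gt0 u0 x0).
rewrite s0 s1 => /(_ isT).
have ux : u = x * (u / x) by field; rewrite gt_eqF.
have u1 : 0 < u `^ (x - 1) by rewrite powR_gt0.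
rewrite -(ler_pM2l (mulr_gt0 u1 (powR_gt0 s x0))).
have -> : u `^ (x - 1) * x `^ s * (u / x) `^ s = u `^ (x + s - 1).
  rewrite -mulrA -powRM ?(ltW x0)//; last by rewrite divr_ge0// ltW.
  rewrite -ux -powRD ?(gt_eqF u0) ?implybT//.
  by congr (_ `^ _); ring.
move/le_trans; apply; rewrite addrK.
have -> : u `^ x = u `^ (x - 1) * u.
  by rewrite -[X in _ * X](powRr1 (ltW u0)) -powRD ?(gt_eqF u0) ?implybT// subrK.
by rewrite le_eqVlt; apply/orP; left; apply/eqP; field; rewrite gt_eqF.
Qed.

(** Integrating e^(-u) over the region s^2 < u, first in u, gives the Gaussian integral; first in s,
    it gives the integral of sqrt(u) e^(-u). The exchange stands in for the substitution u = s^2. *)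
Lemma Gamma3half : Gamma (3 / 2) = Num.sqrt pi / 2 :> R.
Proof.
have k0 u : 0 < u -> 0 <= expR (- u) by rewrite expR_ge0.
have mk : measurable_fun D (fun u => expR (- u)).
  by apply: continuous_measurable_gt0 => u _; apply: is_derive_continuous; der.
have mphi : measurable_fun [set: R] (fun s => s ^+ 2) by exact: exprn_measurable.
have := tonelli_gt0 (G := fun=> 1) mphi (measurable_cst _) mk (fun _ _ => ler01) k0.
have -> : (\int[mu]_(s in D) (1%:E * \int[mu]_(u in D `&` [set u | (s ^+ 2 < u)%R]) (expR (- u))%:E)
  = (Num.sqrt pi / 2)%:E)%E.
  rewrite -integral0y_gauss -integral_itv_obnd_cbnd; last first.
    apply/measurable_EFinP/measurable_funTS; exact: measurable_gauss_fun.
  apply: eq_integral => s; rewrite inE/= in_itv/= andbT => s0.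
  have -> : D `&` [set u | s ^+ 2 < u] = `]s ^+ 2, +oo[%classic.
    rewrite -set_itvoy; apply/seteqP; split=> u /=; rewrite !in_itv/= !andbT; first by case.
    by move=> su; split=> //; apply: le_lt_trans su; exact: sqr_ge0.
  have := @integral_expR_gt R 1 (s ^+ 2) ltr01.
  under eq_integral do rewrite !mul1r.
  by rewrite mul1e /gauss_fun mul1r => ->.
have -> : (\int[mu]_(u in D) ((expR (- u))%:E * \int[mu]_(s in D `&` [set s | (s ^+ 2 < u)%R]) 1%:E)
  = (Gamma (3 / 2))%:E)%E.
  rewrite Gamma_laplace EFin_laplace//; last by apply: laplaceable_powR; lra.
  apply: eq_integral => u; rewrite inE/= in_itv/= andbT => u0.
  have -> : D `&` [set s | s ^+ 2 < u] = `]0, Num.sqrt u[%classic.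
    apply/seteqP; split=> s /=; rewrite !in_itv/= ?andbT; last move=> /andP[s0 su].
      by move=> [s0 su]; rewrite s0/= -(ger0_norm (ltW s0)) -sqrtr_sqr ltr_sqrt.
    split=> //; rewrite -[ltRHS](sqr_sqrtr (ltW u0)) ltr_sqr ?nnegrE ?sqrtr_ge0 ?(ltW s0)//.
  rewrite integral_cst//= mul1e lebesgue_measure_itv/= lte_fin sqrtr_gt0 u0 sube0 -EFinM.
  rewrite mul1r mulrC -powR12_sqrt ?(ltW u0)//.
  by have -> : (3 / 2 - 1 : R) = 2^-1 by field.
by move=> [].
Qed.

Lemma Gamma_half : Gamma (1 / 2) = Num.sqrt pi :> R.
Proof.
have := @GammaD1 (1 / 2); have -> : (1 / 2 + 1 : R) = 3 / 2 by field.
by rewrite Gamma3half => /(_ _)/esym h; have := h ltac:(by []); lra.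
Qed.

End GammaFunction.

(** * Binet's formula *)

Section Binet.
Context {R : realType}.
Implicit Types (s t u x y : R).

Lemma eq_is_derive_cvg0 (f g f' : R -> R) :
  (forall x : R, 0 < x -> is_derive x 1 f (f' x)) ->
  (forall x : R, 0 < x -> is_derive x 1 g (f' x)) ->
  f x @[x --> +oo] --> 0 -> g x @[x --> +oo] --> 0 -> forall x, 0 < x -> f x = g x.
Proof.
move=> df dg f0 g0 x x0.
have dh (y : R) : 0 < y -> is_derive y 1 (fun x => f x - g x) 0.
  by move=> y0; rewrite -(subrr (f' y)); apply: is_derive1D; [exact: df|apply: is_derive1N; exact: dg].
have dh' (y : R) : 0 < y -> is_derive y 1 (fun x => - (f x - g x)) 0.
  by move=> y0; rewrite -oppr0; apply: is_derive1N; exact: dh.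
have h0 : f y - g y @[y --> +oo] --> 0 by rewrite -(subrr 0); exact: cvgB.
apply/eqP; rewrite -subr_eq0; apply/eqP.
suff c : f y - g y @[y --> +oo] --> f x - g x by exact: cvg_unique c h0.
apply: (@cvg_trans _ ((fun=> f x - g x) @ (+oo : set_system R))); last exact: cvg_cst.
apply: near_eq_cvg; near=> y.
have xy : x <= y by near: y; apply: nbhs_pinfty_ge; exact: num_real.
apply/eqP; rewrite eq_le; cbv beta.
rewrite (gt0_is_derive_le dh (fun _ _ => lexx 0) x0 xy)/=.
by have := gt0_is_derive_le dh' (fun _ _ => lexx 0) x0 xy; rewrite lerN2.
Unshelve. all: by end_near. Qed.

Definition binet t := laplace (fun u => @binet_kernel R u / u) t.

Lemma binet_kernel_div_le u : 0 < u -> 0 <= @binet_kernel R u / u <= kernel_coef 1.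
Proof.
move=> u0; rewrite divr_ge0 ?(ltW u0) ?(ltW (binet_kernel_gt0 u0))//=.
by rewrite ler_pdivrMr// binet_kernel_le.
Qed.

Lemma binet_bounds t : 0 < t -> 0 <= binet t <= kernel_coef 1 / t.
Proof.
move=> t0; rewrite laplace_ge0/=; last by move=> u /binet_kernel_div_le/andP[].
rewrite -(laplace_cst _ t0); apply: le_laplace => //.
- exact: laplaceable_binet_kernel_div.
- exact: laplaceable_cst.
- by move=> u /binet_kernel_div_le/andP[].
Qed.

Lemma ln_quotient_bounds t : 0 < t -> (t + 1)^-1 <= ln (t + 1) - ln t <= t^-1.
Proof.
move=> t0; have t10 : 0 < t + 1 by rewrite addr_gt0.
rewrite -ln_div ?posrE//; apply/andP; split.
  have := @ln_le_sub1 R (t / (t + 1)) (divr_gt0 t0 t10).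
  rewrite !ln_div ?posrE//.
  have -> : t / (t + 1) - 1 = - (t + 1)^-1 by field; rewrite gt_eqF.
  lra.
have := @ln_le_sub1 R ((t + 1) / t) (divr_gt0 t10 t0).
by have -> : (t + 1) / t - 1 = t^-1 by field; rewrite gt_eqF.
Qed.

(* Both sides vanish at +oo together with their derivatives, and their second
   derivatives are the same elementary Laplace transform. *)
Lemma binet_recurrence t : 0 < t ->
  binet t - binet (t + 1) = (t + 1 / 2) * (ln (t + 1) - ln t) - 1.
Proof.
pose b u := @binet_kernel R u / u.
pose k u := (1 - expR (- u)) * b u.
have lb : laplaceable b by exact: laplaceable_binet_kernel_div.
have be u : 0 < u -> 0 <= 1 - expR (- u) <= 1.
  by move=> u0; rewrite subr_ge0 expR_le1 oppr_le0 (ltW u0)/= gerBl expR_ge0.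
have k01 u : 0 < u -> 0 <= k u <= kernel_coef 1 * u ^+ 0.
  move=> u0; have /andP[b0 b1] := binet_kernel_div_le u0; have /andP[e0 e1] := be u u0.
  by rewrite mulr_ge0//= mulr1 (le_trans _ b1)// ler_piMl.
have lk : laplaceable k.
  apply: (le_laplaceable _ _ lb).
    apply: measurable_funM; last exact: laplaceable_measurable lb.
    by apply: continuous_measurable_gt0 => u _; eapply is_derive_continuous; der.
  move=> u u0; have /andP[b0 b1] := binet_kernel_div_le u0; have /andP[e0 e1] := be u u0.
  by rewrite normrM ger0_norm// ger0_norm// ler_piMl.
have E1 s : 0 < s -> binet s - binet (s + 1) = laplace k s.
  move=> s0; have s1 : 0 < s + 1 by rewrite addr_gt0.
  have -> : binet (s + 1) = laplace (fun u => expR (- u) * b u) s.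
    apply: eq_Rintegral => u _; rewrite [in RHS]mulrAC [in RHS]mulrC; congr (_ * _).
    by rewrite -expRD; congr expR; ring.
  have lbe : laplaceable (fun u => expR (- u) * b u).
    apply: (le_laplaceable _ _ lb).
      apply: measurable_funM; last exact: laplaceable_measurable lb.
      by apply: continuous_measurable_gt0 => u _; eapply is_derive_continuous; der.
    move=> u u0; have /andP[b0 _] := binet_kernel_div_le u0.
    by rewrite normrM ger0_norm ?expR_ge0// ger0_norm// ler_piMl// expR_le1 oppr_le0 ltW.
  rewrite -mulN1r -(laplaceZ _ lbe s0) -laplaceD//; last exact: laplaceableZ.
  apply: eq_laplace => u _; rewrite /k /b.
  by move: (expR _) (_ / u) => e d; ring.
have lk1 := laplaceableM_id lk.
have dk (s : R) : 0 < s -> is_derive s 1 (laplace k) (- laplace (fun u => u * k u) s).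
  exact: is_derive_laplace.
pose g1 s : R := ln (s + 1) - ln s + (s + 1 / 2) * ((s + 1)^-1 - s^-1).
pose g2 s : R := 1 / 2 * (s ^- 2 + (s + 1) ^- 2) - (s^-1 - (s + 1)^-1).
have dg1 (s : R) : 0 < s -> is_derive s 1 (fun s => (s + 1 / 2) * (ln (s + 1) - ln s) - 1) (g1 s).
  move=> s0; have s1 : 0 < s + 1 by rewrite addr_gt0.
  eapply is_derive_eq; first by (der; rewrite ?gt_eqF).
  by rewrite /g1; cbv beta; ring.
have dg2 (s : R) : 0 < s -> is_derive s 1 g1 (g2 s).
  move=> s0; have s1 : 0 < s + 1 by rewrite addr_gt0.
  eapply is_derive_eq; first by (rewrite /g1; der; rewrite ?gt_eqF).
  by rewrite /g2; cbv beta; field; rewrite !gt_eqF.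
(* The factor 1 - e^(-u) cancels the denominator e^u - 1, so that u^2 k(u) = u (1 + e^(-u))/2 - 1 +
   e^(-u). *)
have E2 s : 0 < s -> laplace (fun u => u * (u * k u)) s = g2 s.
  move=> s0; have s1 : 0 < s + 1 by rewrite addr_gt0.
  have lX n := @laplaceableX R n.
  have le n : laplaceable (fun u => u ^+ n * expR (- u)).
    apply: (le_laplaceable _ _ (lX n)).
      by apply: continuous_measurable_gt0 => u _; eapply is_derive_continuous; der.
    move=> u u0; rewrite ger0_norm ?mulr_ge0 ?expR_ge0 ?exprn_ge0 ?(ltW u0)//.
    by rewrite ger_pMr ?exprn_gt0// expR_le1 oppr_le0 ltW.
  have Le n : laplace (fun u => u ^+ n * expR (- u)) s = n`!%:R / (s + 1) ^+ n.+1.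
    rewrite -(laplaceX _ s1); apply: eq_Rintegral => u _; rewrite -mulrA; congr (_ * _).
    by rewrite -expRD; congr expR; ring.
  have l1 := laplaceableZ (1 / 2) (laplaceableD (lX 1) (le 1)).
  have l2 := laplaceableZ (-1) (lX 0).
  have -> : g2 s = laplace (fun u => 1 / 2 * (u ^+ 1 + u ^+ 1 * expR (- u)) + (-1 * u ^+ 0 + u ^+ 0 * expR (- u))) s.
    rewrite laplaceD//; last exact: laplaceableD.
    rewrite laplaceZ//; last exact: laplaceableD.
    rewrite !laplaceD// laplaceZ// !laplaceX// !Le !fact0 !factS !fact0 /g2 !expr1; ring.
  apply: eq_laplace => u u0; rewrite /k /b /binet_kernel expRN.
  have e0 := expR_sub1_gt0 u0; rewrite expr0 expr1.
  by field; rewrite !gt_eqF ?expR_gt0.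
have cD1 : (s + 1)^-1 @[s --> +oo] --> (0:R).
  apply: (@squeeze_cvgr _ _ _ _ (cst 0) (fun s => s^-1)); [|exact: cvg_cst|exact: cvgyV].
  near=> s; have s0 : 0 < s by near: s; exact: nbhs_pinfty_gt.
  by rewrite invr_ge0 addr_ge0 ?(ltW s0)//= lef_pV2 ?posrE ?addr_gt0// lerDl.
have cg1 : g1 s @[s --> +oo] --> 0.
  apply: (@squeeze_cvgr _ _ _ _ (fun s => - s^-1) (fun s => s^-1)); last 2 first.
  - by rewrite -oppr0; apply: cvgN; exact: cvgyV.
  - exact: cvgyV.
  near=> s; have s1 : 1 < s by near: s; exact: nbhs_pinfty_gt.
  have s0 : 0 < s by exact: lt_trans s1.
  have s10 : 0 < s + 1 by rewrite addr_gt0.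
  have /andP[h1 h2] := ln_quotient_bounds s0.
  have e : (s + 1 / 2) * ((s + 1)^-1 - s^-1) = - (1 / 2 * (s^-1 + (s + 1)^-1)).
    by field; rewrite !gt_eqF.
  have h3 : (s + 1)^-1 <= s^-1 by rewrite lef_pV2 ?posrE// lerDl.
  have h4 : 0 < (s + 1)^-1 by rewrite invr_gt0.
  by rewrite /g1 e; apply/andP; split; lra.
have cg : (s + 1 / 2) * (ln (s + 1) - ln s) - 1 @[s --> +oo] --> (0:R).
  apply: (@squeeze_cvgr _ _ _ _ (fun s => - s^-1) (fun s => s^-1)); last 2 first.
  - by rewrite -oppr0; apply: cvgN; exact: cvgyV.
  - exact: cvgyV.
  near=> s; have s1 : 1 < s by near: s; exact: nbhs_pinfty_gt.
  have s0 : 0 < s by exact: lt_trans s1.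
  have s10 : 0 < s + 1 by rewrite addr_gt0.
  have p0 : 0 < s + 1 / 2 by lra.
  have /andP[h1 h2] := ln_quotient_bounds s0.
  have := ler_wpM2l (ltW p0) h1; have := ler_wpM2l (ltW p0) h2.
  have -> : (s + 1 / 2) / s = 1 + 1 / 2 * s^-1 by field; rewrite gt_eqF.
  have -> : (s + 1 / 2) / (s + 1) = 1 - 1 / 2 * (s + 1)^-1 by field; rewrite gt_eqF.
  have h3 : (s + 1)^-1 <= s^-1 by rewrite lef_pV2 ?posrE// lerDl.
  have h4 : 0 < (s + 1)^-1 by rewrite invr_gt0.
  by move=> h5 h6; apply/andP; split; lra.
have ck1 : - laplace (fun u => u * k u) s @[s --> +oo] --> 0.
  rewrite -oppr0; apply: cvgN; apply: (@laplace_cvg0 _ _ (kernel_coef 1) 1%N) => // u u0.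
  have /andP[h1 h2] := k01 u u0; rewrite mulr1 in h2.
  by rewrite mulr_ge0 ?(ltW u0)//= mulrC ler_wpM2r// ltW.
have E3 s : 0 < s -> - laplace (fun u => u * k u) s = g1 s.
  move: s; apply: (eq_is_derive_cvg0 _ dg2 ck1 cg1) => x x0.
  by rewrite -E2// -[laplace _ x]opprK; apply: is_derive1N; exact: is_derive_laplace.
move=> t0; rewrite E1//.
have dk' (s : R) : 0 < s -> is_derive s 1 (laplace k) (g1 s).
  by move=> s0; rewrite -E3//; exact: dk.
exact: (eq_is_derive_cvg0 dk' dg1 (laplace_cvg0 lk k01) cg t0).
Unshelve. all: by end_near. Qed.

End Binet.

(** * Uniqueness up to a constant, and the constant in Stirling's formula *)

Section Stirling.
Context {R : realType}.
Implicit Types (s t u x y p : R).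

Lemma ln_mul x y : 0 < x -> 0 < y -> ln (x * y) = ln x + ln y.
Proof. by move=> x0 y0; rewrite lnM ?posrE. Qed.

Lemma gt0_periodicM (f : R -> R) p n x : 0 < p -> (forall x, 0 < x -> f (x + p) = f x) ->
  0 < x -> f (x + n%:R * p) = f x.
Proof.
move=> p0 fp x0; elim: n => [|n IH]; first by rewrite mul0r addr0.
rewrite -natr1 mulrDl mul1r addrA fp// ltr_wpDr// mulr_ge0//; exact: ltW.
Qed.

Lemma gt0_periodic_cvg (f : R -> R) p l x : 0 < p -> (forall x, 0 < x -> f (x + p) = f x) ->
  f x @[x --> +oo] --> l -> 0 < x -> f x = l.
Proof.
move=> p0 fp fl x0.
have c : x + n%:R * p @[n --> \oo] --> +oo.
  apply/cvgryPge => A; near=> n.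
  have : (A - x) / p <= n%:R by near: n; exact: nbhs_infty_ger.
  by rewrite ler_pdivrMr// lerBlDl.
have := cvg_comp (fun n => x + n%:R * p) f c fl; rewrite /comp; under eq_fun do rewrite (gt0_periodicM _ p0 fp x0).
by move=> h; exact: cvg_unique (cvg_cst _) h.
Unshelve. all: by end_near. Qed.

(** ln Gamma without its additive constant ln(2 pi)/2, as [binet_formula] will show. *)
Definition stirling t := (t - 1 / 2) * ln t - t + binet t.

Local Opaque Gamma binet kernel_coef.

Lemma stirlingD1 t : 0 < t -> stirling (t + 1) = stirling t + ln t.
Proof. by move=> /binet_recurrence h; rewrite /stirling; lra. Qed.

Lemma cvgyZV (C : R) : C * x^-1 @[x --> +oo] --> 0.
Proof. by rewrite -[X in _ --> X](mulr0 C); apply: cvgMr; exact: cvgyV. Qed.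

Lemma cvg_binet : binet t @[t --> +oo] --> (0 : R).
Proof.
apply: (@squeeze_cvgr _ _ _ _ (cst 0) (fun s => kernel_coef 1 * s^-1)); [|exact: cvg_cst|exact: cvgyZV].
by near=> s; apply: binet_bounds; near: s; exact: nbhs_pinfty_gt.
Unshelve. all: by end_near. Qed.

Lemma ln_increment_bounds x s : 0 < x -> 0 <= s -> s / (x + s) <= ln (x + s) - ln x <= s / x.
Proof.
move=> x0 s0; have xs0 : 0 < x + s by rewrite ltr_wpDr.
have h1 := @ln_le_sub1 R (x / (x + s)) (divr_gt0 x0 xs0).
have h2 := @ln_le_sub1 R ((x + s) / x) (divr_gt0 xs0 x0).
move: h1 h2; rewrite !ln_div ?posrE//.
have -> : x / (x + s) - 1 = - (s / (x + s)) by field; rewrite gt_eqF.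
have -> : (x + s) / x - 1 = s / x by field; rewrite gt_eqF.
by move=> h1 h2; apply/andP; split; lra.
Qed.

(** Wendel's inequality at (x, s) bounds ln Gamma(x + s) from above and at (x + s, 1 - s) from
    below, both by ln Gamma(x) + s ln x up to O(1/x). The increment of [stirling] is s ln x up to
    O(1/x) too. *)
Lemma lnGamma_stirling_increment x s : 1 <= x -> 0 <= s <= 1 ->
  `|(ln (Gamma (x + s)) - stirling (x + s)) - (ln (Gamma x) - stirling x)| <= (1 + kernel_coef 1) * x^-1.
Proof.
move=> x1 /andP[s0 s1]; have x0 : 0 < x by exact: lt_le_trans x1.
have xs0 : 0 < x + s by rewrite ltr_wpDr.
have G0 := Gamma_gt0 x0; have Gs0 := Gamma_gt0 xs0.
have u1 : ln (Gamma (x + s)) <= ln (Gamma x) + s * ln x.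
  have p0 := powR_gt0 s x0; rewrite -ln_powR -ln_mul//.
  rewrite ler_ln ?posrE//; last exact: mulr_gt0.
  by apply: Gamma_wendel => //; rewrite s0.
have u2 : ln x + ln (Gamma x) <= ln (Gamma (x + s)) + (1 - s) * ln (x + s).
  have p0 := powR_gt0 (1 - s) xs0; rewrite -ln_powR -!ln_mul//.
  rewrite ler_ln ?posrE//; [|exact: mulr_gt0|exact: mulr_gt0].
  rewrite -GammaD1//; have -> : x + 1 = x + s + (1 - s) by ring.
  by apply: Gamma_wendel => //; rewrite subr_ge0 s1 gerBl.
have /andP[b1 b2] := binet_bounds x0; have /andP[b3 b4] := binet_bounds xs0.
have /andP[l1 l2] := ln_increment_bounds x0 s0.
have C0 : 0 <= @kernel_coef R 1.
  by have := le_trans b1 b2; rewrite pmulr_lge0// invr_gt0.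
have xV0 : 0 < x^-1 by rewrite invr_gt0.
have xsV : (x + s)^-1 <= x^-1 by rewrite lef_pV2 ?posrE// lerDl.
have b5 : binet (x + s) <= kernel_coef 1 * x^-1 by rewrite (le_trans b4)// ler_wpM2l.
have e1 : s / (x + s) <= x^-1 by rewrite (le_trans _ xsV)// ler_piMl// invr_ge0 ltW.
have e2 : s / x <= x^-1 by rewrite ler_piMl// ltW.
have q0 : 0 <= x + s - 1 / 2 by clear -x1 s0; lra.
have l3 := ler_wpM2l q0 l1.
have q1 : 0 <= x + 1 / 2 by clear -x0; lra.
have l4 := ler_wpM2l q1 l2.
have E1 : (x + s - 1 / 2) * (s / (x + s)) = s - 1 / 2 * (s / (x + s)) by field; rewrite gt_eqF.
have E2 : (x + 1 / 2) * (s / x) = s + 1 / 2 * (s / x) by field; rewrite gt_eqF.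
rewrite E1 in l3; rewrite E2 in l4.
rewrite /stirling ler_norml; clear -u1 u2 b1 b2 b3 b4 l1 l2 C0 xV0 xsV b5 e1 e2 l3 l4; move: u1 u2 b1 b2 b3 b4 l1 l2 C0 xV0 xsV b5 e1 e2 l3 l4.
move: (ln (Gamma (x + s))) (ln (Gamma x)) (ln (x + s)) (ln x) (binet x) (binet (x + s)) (kernel_coef 1)
  (s / x) (s / (x + s)) => a1 a2 a3 a4 a5 a6 a7 a8 a9.
by move=> *; apply/andP; split; nra.
Qed.

(** The difference d is 1-periodic by the two functional equations. For s in [0, 1], d(x + s) - d(x)
    is 1-periodic in x and tends to 0, so it vanishes. *)
Lemma lnGamma_stirling_cst t : 0 < t ->
  ln (Gamma t) - stirling t = ln (Gamma 1) - stirling 1.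
Proof.
pose d (t : R) : R := ln (Gamma t) - stirling t.
have dD1 x : 0 < x -> d (x + 1) = d x.
  move=> x0; rewrite /d stirlingD1// GammaD1// ln_mul ?Gamma_gt0//; ring.
have dD x s : 0 < x -> 0 <= s <= 1 -> d (x + s) = d x.
  move=> x0 s01; apply/eqP; rewrite -subr_eq0; apply/eqP.
  apply: (@gt0_periodic_cvg (fun x => d (x + s) - d x) 1 0 x ltr01 _ _ x0).
    move=> y y0; have /andP[s0 _] := s01.
    have ys0 : 0 < y + s := ltr_wpDr s0 y0.
    by rewrite [y + 1 + s]addrAC !dD1.
  apply: (@squeeze_cvgr _ _ _ _ (fun x => - (1 + kernel_coef 1) * x^-1) (fun x => (1 + kernel_coef 1) * x^-1)).
  - near=> y; have y1 : 1 <= y by near: y; exact: nbhs_pinfty_ge.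
    by rewrite mulNr -ler_norml; exact: lnGamma_stirling_increment.
  - exact: cvgyZV.
  - exact: cvgyZV.
move=> t0; have /andP[n1 n2] := truncn_itv (ltW t0).
suff E : d t = d 1 by exact: E.
rewrite -(dD1 t t0).
(* t + 1 is reached from 1 by the fractional part of t and then by unit steps; starting from 1 keeps
   every argument positive. *)
have -> : t + 1 = 1 + (t - (Num.truncn t)%:R) + (Num.truncn t)%:R * 1 by ring.
rewrite gt0_periodicM ?dD// ?subr_ge0 ?n1//.
  by rewrite lerBlDl natr1 ltW.
by rewrite ltr_wpDr// subr_ge0.
Unshelve. all: by end_near. Qed.

Lemma cvgDcst_y (c : R) : x + c @[x --> +oo] --> +oo.
Proof.
apply/cvgryPge => A; near=> x; rewrite -lerBlDr.
by near: x; apply: nbhs_pinfty_ge; exact: num_real.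
Unshelve. all: by end_near. Qed.

(* Legendre's duplication formula for [stirling]: the defect [m] is 1/2-periodic
   and converges at +oo. *)
Lemma stirling_half : stirling (1 / 2) = - (1 / 2 * ln 2).
Proof.
pose m t := stirling t + stirling (t + 1 / 2) - stirling (2 * t) - (1 - 2 * t) * ln 2.
have two0 : (0 : R) < 2 by [].
have mp t : 0 < t -> m (t + 1 / 2) = m t.
  move=> t0; rewrite /m.
  have -> : t + 1 / 2 + 1 / 2 = t + 1 by field.
  have -> : 2 * (t + 1 / 2) = 2 * t + 1 by field.
  have t20 := mulr_gt0 two0 t0.
  rewrite (stirlingD1 t0) (stirlingD1 t20) (ln_mul two0 t0).
  move: (stirling _) (stirling _) (stirling _) (ln t) (ln 2) => *; ring.
have cm : m t @[t --> +oo] --> - (1 / 2 * ln 2).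
  have E t : 0 < t -> m t = (t * (ln (t + 1 / 2) - ln t) - 1 / 2) - 1 / 2 * ln 2
      + (binet t + binet (t + 1 / 2) - binet (2 * t)).
    move=> t0; rewrite /m /stirling (ln_mul two0 t0).
    move: (binet _) (binet _) (binet _) (ln t) (ln 2) (ln (_ + _)) => *; by field.
  have c0 : t * (ln (t + 1 / 2) - ln t) - 1 / 2 @[t --> +oo] --> (0:R).
    apply: (@squeeze_cvgr _ _ _ _ (fun t => -1 * t^-1) (fun t => 1 * t^-1)); [|exact: cvgyZV|exact: cvgyZV].
    near=> t; have t0 : 0 < t by near: t; exact: nbhs_pinfty_gt.
    have th : 0 < t + 1 / 2 by rewrite addr_gt0.
    have /andP[h1 h2] := @ln_increment_bounds t (1 / 2) t0 ltac:(by []).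
    have := ler_wpM2l (ltW t0) h1; have := ler_wpM2l (ltW t0) h2.
    have -> : t * (1 / 2 / t) = 1 / 2 by field; rewrite gt_eqF.
    have -> : t * (1 / 2 / (t + 1 / 2)) = 1 / 2 - 1 / 4 * (t + 1 / 2)^-1.
      have {1}-> : t = t + 1 / 2 - 1 / 2 by rewrite addrK.
      by move: (t + 1 / 2) th => q q0; field; rewrite gt_eqF.
    have tV : (t + 1 / 2)^-1 <= t^-1 by rewrite lef_pV2 ?posrE// lerDl.
    have tV0 : 0 < t^-1 by rewrite invr_gt0.
    by move=> h3 h4; apply/andP; split; lra.
  have c1 : binet (t + 1 / 2) @[t --> +oo] --> (0:R) by exact: cvg_comp (cvgDcst_y _) cvg_binet.
  have c2 : binet (2 * t) @[t --> +oo] --> (0:R).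
    by apply: cvg_comp cvg_binet; exact: gt0_cvgMry.
  have : (t * (ln (t + 1 / 2) - ln t) - 1 / 2) - 1 / 2 * ln 2
      + (binet t + binet (t + 1 / 2) - binet (2 * t)) @[t --> +oo] --> (0 : R) - 1 / 2 * ln 2 + (0 + 0 - 0).
    apply: cvgD; first by apply: cvgB => //; exact: cvg_cst.
    exact: cvgB (cvgD cvg_binet c1) c2.
  rewrite sub0r !addr0 subr0 addr0; apply: cvg_trans; apply: near_eq_cvg; near=> t.
  by rewrite E//; near: t; exact: nbhs_pinfty_gt.
have h0 : (0 : R) < 1 / 2 by [].
(* At t = 1/2 the two values [stirling 1] cancel and the factor 1 - 2t vanishes, leaving
   [stirling (1 / 2)] alone. *)
have := gt0_periodic_cvg h0 mp cm h0; rewrite /m.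
have -> : (1 / 2 + 1 / 2 : R) = 1 by field.
have -> : (2 * (1 / 2) : R) = 1 by field.
by move=> <-; ring.
Unshelve. all: by end_near. Qed.

(** The constant is evaluated at 1/2: ln Gamma(1/2) - stirling(1/2) = ln(pi)/2 + ln(2)/2. *)
Lemma binet_formula t : 0 < t ->
  ln (Gamma t) - (t - 1 / 2) * ln t + t - 1 / 2 * ln (2 * pi) = binet t.
Proof.
move=> t0; have h0 : (0 : R) < 1 / 2 by [].
have p0 := @pi_gt0 R.
have h := lnGamma_stirling_cst t0; have h2 := lnGamma_stirling_cst h0.
have h3 : ln (Num.sqrt pi) = 2^-1 * ln pi :> R by rewrite -(powR12_sqrt (ltW p0)) ln_powR.
rewrite stirling_half Gamma_half in h2.
rewrite h3 in h2.
have two0 : (0 : R) < 2 by [].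
rewrite (ln_mul two0 p0); move: (etrans h (esym h2)); rewrite /stirling.
move: (binet t) (ln (Gamma t)) (ln t) (ln 2) (ln pi); clear; move=> *; lra.
Qed.

End Stirling.

(** * Degrees *)

Section Degrees.
Context {R : realType}.
Implicit Types (a b t u : R) (f g h : R -> R).

Lemma cm_degree_eq f g d : (forall t, 0 < t -> f t = g t) -> cm_degree f d -> cm_degree g d.
Proof.
move=> fg [cmf [l fl deg]]; split; first exact: completely_monotonic_eq cmf.
exists l.
  apply: cvg_trans fl; apply: near_eq_cvg; near=> t.
  by rewrite fg//; near: t; exact: nbhs_pinfty_gt.
have E (a : R) : completely_monotonic (fun t => t `^ a * (g t - l)) <->
    completely_monotonic (fun t => t `^ a * (f t - l)).
  by split; apply: completely_monotonic_eq => t t0; rewrite fg.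
by case: d deg => [r [r0 deg]|deg|//]; [split=> // a a0; rewrite E; exact: deg|move=> a; rewrite E].
Unshelve. all: by end_near. Qed.

(** One global bound does two jobs: its transform C n!/t^(n+1) controls the blow-up at 0+, hence the
    degree from above, and the decay at +oo, hence h(oo) = 0. *)
Lemma cm_degree_laplace f C n p : (p <= n.+1)%N -> laplaceable f ->
  (forall u, 0 < u -> 0 < f u <= C * u ^+ n) ->
  completely_monotonic (fun t => t ^+ p * laplace f t) ->
  exists2 d, cm_degree (laplace f) d%:E & p%:R <= d <= n.+1%:R.
Proof.
move=> pn lf f0 cm; apply: cm_degree_between.
- exact: ler0n.
- by rewrite ler_nat.
- by apply: completely_monotonic_eq cm => t t0; rewrite powR_mulrn// ltW.
- by apply: (@laplace_cvg0 _ _ C n) => // u /f0/andP[/ltW-> ->].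
- by apply: laplace_gt0 => // u /f0/andP[].
move=> a na; exists n.+1%:R, (C * n`!%:R); split=> // t /andP[t0 _].
rewrite powRN powR_mulrn ?(ltW t0)// -mulrA -laplaceX// -laplaceZ//; last exact: laplaceableX.
apply: le_laplace => //; first exact/laplaceableZ/laplaceableX.
by move=> u /f0/andP[].
Qed.

(* The upper bound 0 on the degree comes from the merely logarithmic growth of
   [binet] at 0+, read off [binet_recurrence]. *)
Lemma cm_degree_binet : cm_degree (@binet R) 0%:E.
Proof.
have [|||a a0|d cm deg] := @cm_degree_between R (@binet R) 0 0 (lexx 0) (lexx 0).
- apply: completely_monotonic_eq (completely_monotonic_laplace laplaceable_binet_kernel_div _).
    by move=> t _; rewrite powRr0 mul1r.
  by move=> u /binet_kernel_div_le/andP[].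
- exact: cvg_binet.
- apply: laplace_gt0 => //; first exact: laplaceable_binet_kernel_div.
  by move=> u u0; rewrite divr_gt0 ?binet_kernel_gt0.
- pose b := a / 2; have b0 : 0 < b by rewrite divr_gt0.
  (* In the recurrence with t < 1, [binet (t + 1)] is at most [kernel_coef 1], the factor t + 1/2 at
     most 3/2, and ln(t + 1) - ln t at most 1 + t^(-b)/b; constants are absorbed by t^(-b) >= 1. *)
  exists b, (kernel_coef 1 + 3 / 2 + 3 / 2 / b); split; first by rewrite /b; lra.
  move=> t /andP[t0 t1]; have t10 : 0 < t + 1 by rewrite addr_gt0.
  have /binet_recurrence h := t0.
  have /andP[c0 c1] := binet_bounds t10.
  have {}c1 : binet (t + 1) <= kernel_coef 1.
    have C0 : 0 <= @kernel_coef R 1.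
      by have := le_trans c0 c1; rewrite pmulr_lge0// invr_gt0.
    by rewrite (le_trans c1)// ler_piMr// invf_le1// lerDr ltW.
  have p0 : 0 < t `^ (- b) by rewrite powR_gt0.
  have h1 := ln_le_sub1 p0; rewrite ln_powR in h1.
  have h2 := @ln_le_sub1 R (t + 1) t10.
  have p1 : 1 <= t `^ (- b).
    by rewrite powRN invf_ge1 ?powR_gt0// -(powRr0 t) ger_powR ?t0 ?ltW.
  have h3 : - ln t <= b^-1 * t `^ (- b).
    by rewrite mulrC ler_pdivlMr//; lra.
  have bV : 0 < b^-1 by rewrite invr_gt0.
  have l1 : ln (t + 1) - ln t <= 1 + b^-1 * t `^ (- b) by lra.
  have l0 : 0 <= ln (t + 1) - ln t.
    have /andP[+ _] := ln_quotient_bounds t0; apply: le_trans.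
    by rewrite invr_ge0 ltW.
  have C0 : 0 <= @kernel_coef R 1 by exact: le_trans c1.
  have m1 : (t + 1 / 2) * (ln (t + 1) - ln t) <= 3 / 2 * (ln (t + 1) - ln t).
    by rewrite ler_wpM2r//; clear -t1; lra.
  have m2 : kernel_coef 1 <= kernel_coef 1 * t `^ (- b) by rewrite ler_peMr.
  have -> : (kernel_coef 1 + 3 / 2 + 3 / 2 / b) * t `^ (- b) =
      kernel_coef 1 * t `^ (- b) + 3 / 2 * t `^ (- b) + 3 / 2 * (b^-1 * t `^ (- b)) by ring.
  move: h l1 m1 m2 p1 c1; move: ((_ + _) * (_ - _)) => q.
  move: (ln (t + 1) - ln t) (t `^ (- b)) (b^-1) (kernel_coef 1) (binet t) (binet (t + 1)); clear.
  move=> *; lra.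
by move: deg cm; rewrite andbC -eq_le => /eqP ->.
Qed.

Context (B : nat -> R) (hB : is_bernoulli B).

(** The transform of u^(2k-1) is (2k-1)!/t^(2k), which turns the coefficient B_2k/(2k)! into
    B_2k/(2k). *)
Lemma laplace_kernel_rem n t : 0 < t -> laplace (@kernel_rem R n) t =
  (-1) ^+ n * (laplace (@binet_kernel R) t -
    \sum_(1 <= k < n.+1) B (2 * k)%N / (2 * k)%:R * (1 / t ^+ (2 * k))).
Proof.
move=> t0; elim: n => [|n IH].
  by rewrite big_geq// subr0 mul1r; apply: eq_laplace => u _; rewrite binet_kernel_rem0.
have -> : laplace (@kernel_rem R n.+1) t =
    (-1) ^+ n * kernel_coef n.+1 * ((2 * n).+1`!%:R / t ^+ (2 * n).+2) - laplace (@kernel_rem R n) t.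
  have lX := @laplaceableX R (2 * n).+1; have lr := @laplaceable_kernel_rem R n.
  rewrite -laplaceX// -laplaceZ// -[X in _ = _ + X]mulN1r -laplaceZ// -laplaceD//; try exact: laplaceableZ.
  apply: eq_laplace => u _; rewrite kernel_remS mulN1r /kernel_coef/=.
  by rewrite !mulrA -exprMn mulrNN mulr1 expr1n mul1r.
rewrite IH [in RHS]big_nat_recr//; cbv beta.
have -> : B (2 * n.+1)%N / (2 * n.+1)%:R = kernel_coef n.+1 * (2 * n).+1`!%:R.
  rewrite -(is_bernoulli_coef hB)//; have -> : (2 * n.+1 = (2 * n).+2)%N by lia.
  rewrite [(2 * n).+2`!]factS natrM.
  have : (2 * n).+1`!%:R != 0 :> R by rewrite pnatr_eq0 -lt0n fact_gt0.
  have : (2 * n).+2%:R != 0 :> R by rewrite pnatr_eq0.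
  by move: ((2 * n).+1`!%:R : R) ((2 * n).+2%:R : R) => f x x0 f0; field; rewrite f0.
have -> : (2 * n.+1 = (2 * n).+2)%N by lia.
rewrite [(-1) ^+ n.+1]exprS /=.
move: (\sum_(_ <= _ < _) _) (laplace _ _) (kernel_coef _) ((-1) ^+ n : R) ((2 * n).+1`!%:R : R) (t ^- (2 * n).+2).
by move=> S L k s f q; ring.
Qed.

Lemma RnE n t : 0 < t -> Rn B n t = (-1) ^+ n * (binet t -
  \sum_(1 <= k < n.+1) B (2 * k)%N / ((2 * k)%:R * (2 * k - 1)%:R) * (1 / t ^+ (2 * k - 1))).
Proof. by move=> t0; rewrite /Rn binet_formula. Qed.

Lemma is_derive_binet t : 0 < t -> is_derive t 1 (@binet R) (- laplace (@binet_kernel R) t).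
Proof.
move=> t0; have -> : laplace (@binet_kernel R) t = laplace (fun u => u * (@binet_kernel R u / u)) t.
  by apply: eq_laplace => u u0; field; rewrite gt_eqF.
exact: is_derive_laplace laplaceable_binet_kernel_div t0.
Qed.

Lemma is_derive_Rn n t : 0 < t -> is_derive t 1 (Rn B n) (- laplace (@kernel_rem R n) t).
Proof.
move=> t0.
have d : is_derive t 1 (fun t => (-1) ^+ n * (binet t -
    \sum_(1 <= k < n.+1) B (2 * k)%N / ((2 * k)%:R * (2 * k - 1)%:R) * (1 / t ^+ (2 * k - 1))))
    ((-1) ^+ n * (- laplace (@binet_kernel R) t -
    \sum_(1 <= k < n.+1) B (2 * k)%N / ((2 * k)%:R * (2 * k - 1)%:R) * (- (2 * k - 1)%:R * t ^- (2 * k - 1).+1))).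
  have ds (k : nat) : is_derive t 1 (fun t => B (2 * k)%N / ((2 * k)%:R * (2 * k - 1)%:R) * (1 / t ^+ (2 * k - 1)))
      (B (2 * k)%N / ((2 * k)%:R * (2 * k - 1)%:R) * (- (2 * k - 1)%:R * t ^- (2 * k - 1).+1)).
    move: (2 * k - 1)%N (_ / _) => m c.
    eapply is_derive_eq; first by (der; rewrite expf_neq0// gt_eqF).
    (* m = 0 arises only from k = 0, outside the range of the sum: [is_derive1_sum] asks for all
       indices, and 2 * 0 - 1 is 0 in [nat]. *)
    case: m => [|m]; first by cbv beta; rewrite !mul0r; ring.
    by cbv beta => /=; rewrite !exprS; field; rewrite expf_neq0 ?gt_eqF.
  eapply is_derive_eq.
    by der; [exact: is_derive_binet|apply: is_derive1_sum => k; exact: ds].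
  by cbv beta; ring.
apply: (gt0_eq_is_derive _ t0 (is_derive_eq d _)); first by move=> s s0; rewrite RnE.
rewrite laplace_kernel_rem//.
set S2 := (X in _ = - (_ * (_ - X))); set S1 := (X in _ * (_ - X) = _).
suff -> : S1 = - S2 by ring.
rewrite /S1 /S2 -sumrN; apply: eq_big_nat => k /andP[k1 _].
have -> : (2 * k - 1).+1 = (2 * k)%N by lia.
have k2 : (2 * k)%:R != 0 :> R by rewrite pnatr_eq0; lia.
have k3 : (2 * k - 1)%:R != 0 :> R by rewrite pnatr_eq0; lia.
have t2 : t ^+ (2 * k) != 0 by rewrite expf_neq0// gt_eqF.
by move: ((2 * k)%:R : R) ((2 * k - 1)%:R : R) (t ^+ (2 * k)) k2 k3 t2 => x y z *; field; exact/and3P.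
Qed.

Lemma derive1_Rn n t : 0 < t -> - derive1 (Rn B n) t = laplace (@kernel_rem R n) t.
Proof. by move=> t0; have d := is_derive_Rn n t0; rewrite derive1E derive_val opprK. Qed.

(** Differentiability of Gamma is drawn from Binet's formula, by writing Gamma as an exponential. *)
Lemma digammaE t : 0 < t -> digamma t = - laplace (@binet_kernel R) t + ln t - 1 / (2 * t).
Proof.
move=> t0; have G0 := Gamma_gt0 t0.
have E (s : R) : 0 < s -> expR (binet s + (s - 1 / 2) * ln s - s + 1 / 2 * ln (2 * pi)) = Gamma s.
  move=> s0; rewrite -[RHS]lnK ?posrE ?Gamma_gt0//; congr expR.
  by rewrite -(binet_formula s0); ring.
have d : is_derive t 1 (@Gamma R) (Gamma t * (- laplace (@binet_kernel R) t + ln t - 1 / (2 * t))).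
  apply: (gt0_eq_is_derive E t0); eapply is_derive_eq.
    by der; [exact: is_derive_binet|].
  by cbv beta; rewrite E//; field; rewrite gt_eqF.
by rewrite /digamma derive1E derive_val mulrC mulKf// gt_eqF.
Qed.

Lemma Rn0 t : 0 < t -> Rn B 0 t = binet t.
Proof. by move=> t0; rewrite RnE// big_geq// subr0 mul1r. Qed.

Lemma Rn1 t : 0 < t -> Rn B 1 t = laplace (fun u => @kernel_rem R 1 u / u) t.
Proof.
move=> t0; rewrite RnE// big_nat1 expr1 mulN1r opprB !muln1 mulr1.
have -> : laplace (fun u => @kernel_rem R 1 u / u) t =
    laplace (fun u => kernel_coef 1 + -1 * (@binet_kernel R u / u)) t.
  by apply: eq_laplace => u u0; rewrite kernel_rem1; field; rewrite gt_eqF.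
have lb := @laplaceable_binet_kernel_div R.
rewrite laplaceD//; [|exact: laplaceable_cst|exact: laplaceableZ].
rewrite laplace_cst// (laplaceZ _ lb t0) -(is_bernoulli_coef hB)//.
have -> : (2 * 1)`! = 2 by [].
by rewrite mulN1r expr1 muln1; congr (_ - _); field; rewrite gt_eqF.
Qed.

End Degrees.

Unset Implicit Arguments.

Theorem theorem2p1 (R : realType) (B : nat -> R) (hB : is_bernoulli B) :
  (forall (n : nat) (t : R), 0 < t ->
     - derive1 (Rn B n) t =
     (-1) ^+ n.+1 *
     (digamma t - ln t + 1 / (2 * t)
      + \sum_(1 <= k < n.+1) B (2 * k)%N / (2 * k)%:R * (1 / t ^+ (2 * k))))
  /\
  (cm_degree (Rn B 0) 0%:E /\ cm_degree (Rn B 1) 1%:E)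
  /\
  (cm_degree (fun t => - derive1 (Rn B 0) t) 1%:E /\
   cm_degree (fun t => - derive1 (Rn B 1) t) 2%:E)
  /\
  (forall n : nat, (2 <= n)%N ->
     exists d : \bar R,
       cm_degree (fun t => - derive1 (Rn B n) t) d /\
       ((2 * n - 1)%:R%:E <= d)%E /\ (d <= (2 * n)%:R%:E)%E).
Proof.
have lrem n := @laplaceable_kernel_rem R n.
have remE n t : 0 < t -> laplace (@kernel_rem R n) t = - derive1 (Rn B n) t.
  by move=> t0; rewrite derive1_Rn.
(* When t^(n+1) is admissible for a kernel of growth u^n, the two bounds on the degree coincide. *)
have exact_degree (f g : R -> R) C n : laplaceable f ->
    (forall u, 0 < u -> 0 < f u <= C * u ^+ n) ->
    completely_monotonic (fun t => t ^+ n.+1 * laplace f t) ->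
    (forall t, 0 < t -> laplace f t = g t) -> cm_degree g n.+1%:R%:E.
  move=> lf f0 cm fg; have [d deg] := cm_degree_laplace (leqnn _) lf f0 cm.
  by rewrite -eq_le => /eqP dE; rewrite dE; exact: cm_degree_eq deg.
split=> [n t t0|].
  rewrite derive1_Rn// (laplace_kernel_rem hB)// digammaE// exprS.
  by move: (\sum_(_ <= _ < _) _) (laplace _ _) (ln t) (1 / (2 * t)) ((-1) ^+ n : R) => *; ring.
split; [split|split; [split|]].
- by apply: cm_degree_eq (@cm_degree_binet R) => t t0; rewrite Rn0.
- apply: (exact_degree _ _ (kernel_coef 1) 0%N (@laplaceable_kernel_rem1_div R)).
  + move=> u u0; rewrite divr_gt0 ?kernel_rem_gt0//= mulr1.
    by have /andP[] := kernel_rem1_div_le u0.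
  + exact: completely_monotonic_kernel_rem1_div.
  + by move=> t t0; rewrite Rn1.
- apply: (exact_degree _ _ (1 / 2) 0%N (lrem 0%N)) (remE 0%N).
  + by move=> u u0; rewrite kernel_rem_gt0//= binet_kernel_rem0 mulr1 binet_kernel_le_half.
  + apply: completely_monotonic_eq (@completely_monotonic_binet_kernel R) => t t0.
    by rewrite expr1; congr (_ * _); apply: eq_laplace => u _; rewrite binet_kernel_rem0.
(* Although cubic near 0, [kernel_rem 1] grows only linearly, whence the degree is at most 2. *)
- apply: (exact_degree _ _ (kernel_coef 1) 1%N (lrem 1%N)) (remE 1%N).
  + move=> u u0; rewrite kernel_rem_gt0//= expr1 kernel_rem1 gerBl.
    exact/ltW/binet_kernel_gt0.
  + exact: completely_monotonic_kernel_rem1.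
case=> // n n1.
(* With n + 1 in place of n, the growth u^(2n+1) bounds the degree by 2n + 2, and the termwise
   argument admits the exponent 2n + 1. *)
have [|u u0||d deg /andP[d1 d2]] := @cm_degree_laplace R (kernel_rem n.+1) (2 * inv_pole_sum n.+1)
  (2 * n).+1 (2 * n).+1 _ (lrem n.+1).
- exact: leqnSn.
- by rewrite kernel_rem_gt0//= kernel_remS gerBl kernel_rem_ge0.
- have := @completely_monotonic_kernel_rem R n.+1 isT.
  by have -> : (2 * n.+1).-1 = (2 * n).+1 by lia.
exists d%:E; split; first exact: cm_degree_eq (remE n.+1) deg.
have -> : (2 * n.+1 - 1 = (2 * n).+1)%N by lia.
have -> : (2 * n.+1 = (2 * n).+2)%N by lia.
by rewrite !lee_fin.
Qed.
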